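(* Let $T$ be a completion of $\mathrm{ACFA}$ (of arbitrary characteristic), and let $\sigma$ be its distinguished automorphism. Then the theory $$T\cup\{\tau\text{ is a field automorphism and }\tau\sigma=\sigma\tau\},$$ in the language of difference fields expanded by a new unary function symbol $\tau$, has no model companion.
   Context: The language of difference fields is the language of rings together with a unary function symbol $\sigma$. $\mathrm{ACFA}$ is the model companion of the theory of fields with an automorphism $\sigma$. A completion of $\mathrm{ACFA}$ is a complete consistent theory in this language extending $\mathrm{ACFA}$. A model companion of a theory $S$ is a model-complete theory $S^*$ in the same language such that every model of either theory embeds into a model of the other. *)

(* Defs.v *)
From mathcomp Require Import all_boot.

Set Implicit Arguments.
Unset Strict Implicit.
Unset Printing Implicit Defensive.

(* Languages have equality and function symbols, but no other relation
   symbols: this covers all the expansions of the language of rings below. *)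
Record language := Language { symb :> Type; arity : symb -> nat }.

(* [term L n] and [formula L n] have their free variables indexed by 'I_n.
   In [All p], with [p : formula L n.+1], the bound variable has index 0 in p,
   and the free variable i of [All p] has index i + 1 in p. *)
Inductive term (L : language) (n : nat) : Type :=
| Var (i : 'I_n)
| App (f : L) (args : 'I_(arity f) -> term L n).
Arguments Var {L n} & i.
Arguments App {L n} f args.

Inductive formula (L : language) (n : nat) : Type :=
| Bot
| Eq (s t : term L n)
| Imp (p q : formula L n)
| All (p : formula L n.+1).
Arguments Bot {L n}.
Arguments Eq {L n} & s t.
Arguments Imp {L n} & p q.
Arguments All {L n} & p.

(* Without excluded middle, [holds] makes [Ex p] a doubly negated existential. *)
Definition Not L n (p : formula L n) : formula L n := Imp p Bot.
Definition Ex L n (p : formula L n.+1) : formula L n := Not (All (Not p)).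
Arguments Not {L n} & p.
Arguments Ex {L n} & p.

Definition sentence (L : language) := formula L 0.
Definition theory (L : language) := sentence L -> Prop.

Record structure (L : language) := Structure {
  carrier :> Type;
  interp : forall f : L, ('I_(arity f) -> carrier) -> carrier
}.

Fixpoint eval L (M : structure L) n (e : 'I_n -> M) (t : term L n) : M :=
  match t with
  | Var i => e i
  | App f args => interp (fun i => eval e (args i))
  end.

Definition env_cons (T : Type) n (x : T) (e : 'I_n -> T) : 'I_n.+1 -> T :=
  fun i => if unlift ord0 i is Some j then e j else x.

Fixpoint holds L (M : structure L) n (e : 'I_n -> M) (p : formula L n) : Prop :=
  match p with
  | Bot => False
  | Eq s t => eval e s = eval e t
  | Imp p q => holds e p -> holds e q
  | All p => forall x : M, holds (env_cons x e) p
  end.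

Definition env0 (T : Type) (i : 'I_0) : T :=
  match notF (ltn_ord i) with end.

Definition satisfies L (M : structure L) (p : sentence L) : Prop :=
  holds (@env0 M) p.

Definition model L (T : theory L) (M : structure L) : Prop :=
  forall p, T p -> satisfies M p.

Definition entails L (T : theory L) (p : sentence L) : Prop :=
  forall M : structure L, model T M -> satisfies M p.

Definition consistent L (T : theory L) : Prop :=
  exists M : structure L, model T M.

Definition complete L (T : theory L) : Prop :=
  forall p : sentence L, entails T p \/ entails T (Not p).

(* Theories are not assumed to be deductively closed, so that T' extends T
   when it entails all the sentences of T. *)
Definition extends L (T T' : theory L) : Prop :=
  forall p, T p -> entails T' p.

Definition completion L (T T' : theory L) : Prop :=
  [/\ complete T', consistent T' & extends T T'].

Definition embedding L (M N : structure L) (h : M -> N) : Prop :=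
  injective h /\
  forall (f : L) (x : 'I_(arity f) -> M), h (interp x) = interp (h \o x).

Definition elementary L (M N : structure L) (h : M -> N) : Prop :=
  forall n (p : formula L n) (e : 'I_n -> M),
    holds e p <-> holds (h \o e) p.

Definition model_complete L (T : theory L) : Prop :=
  forall M N : structure L, model T M -> model T N ->
  forall h : M -> N, embedding h -> elementary h.

Definition models_embed L (T T' : theory L) : Prop :=
  forall M : structure L, model T M ->
  exists2 N : structure L, model T' N & exists h : M -> N, embedding h.

Definition model_companion L (S S' : theory L) : Prop :=
  [/\ model_complete S', models_embed S S' & models_embed S' S].

(* The symbols of rings, together with a unary symbol [Aut a] for each a : A. *)
Inductive ring_symbol (A : Type) : Type :=
| Zero | One | Opp | Add | Mul | Aut (a : A).
Arguments Zero {A}.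
Arguments One {A}.
Arguments Opp {A}.
Arguments Add {A}.
Arguments Mul {A}.

Definition ring_arity A (f : ring_symbol A) : nat :=
  match f with
  | Zero | One => 0
  | Opp | Aut _ => 1
  | Add | Mul => 2
  end.

Definition ring_lang (A : Type) : language := Language (@ring_arity A).

Section RingTerms.
Variables (A : Type) (n : nat).
Implicit Types s t : term (ring_lang A) n.

Definition tvar k (ltkn : k < n) : term (ring_lang A) n := Var (Ordinal ltkn).
Definition tzero : term (ring_lang A) n :=
  @App (ring_lang A) n Zero (@env0 _).
Definition tone : term (ring_lang A) n :=
  @App (ring_lang A) n One (@env0 _).
Definition topp t := @App (ring_lang A) n Opp (fun=> t).
Definition tadd s t :=
  @App (ring_lang A) n Add (fun i : 'I_2 => if val i == 0 then s else t).
Definition tmul s t :=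
  @App (ring_lang A) n Mul (fun i : 'I_2 => if val i == 0 then s else t).
Definition taut (a : A) t := @App (ring_lang A) n (Aut a) (fun=> t).

End RingTerms.

Arguments tvar {A n} & k ltkn.
Arguments tzero {A n}.
Arguments tone {A n}.
Arguments topp {A n} & t.
Arguments tadd {A n} & s t.
Arguments tmul {A n} & s t.
Arguments taut {A n} & a t.

Declare Scope fol_scope.
Delimit Scope fol_scope with fol.
Notation "''v_' k" := (tvar k isT)
  (at level 8, k at level 2, format "''v_' k") : fol_scope.
Notation "0" := tzero : fol_scope.
Notation "1" := tone : fol_scope.
Notation "- x" := (topp x) : fol_scope.
Notation "x + y" := (tadd x y) : fol_scope.
Notation "x * y" := (tmul x y) : fol_scope.
Notation "s == t" := (Eq s t) : fol_scope.
Notation "p ==> q" := (Imp p q) : fol_scope.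
Notation "~~ p" := (Not p) : fol_scope.

Section Sentences.
Variable A : Type.
Local Open Scope fol_scope.

Inductive field_axiom : theory (ring_lang A) :=
| ax_addA : field_axiom
    (All (All (All ('v_2 + ('v_1 + 'v_0) == ('v_2 + 'v_1) + 'v_0))))
| ax_addC : field_axiom (All (All ('v_1 + 'v_0 == 'v_0 + 'v_1)))
| ax_add0 : field_axiom (All (0 + 'v_0 == 'v_0))
| ax_addN : field_axiom (All (- 'v_0 + 'v_0 == 0))
| ax_mulA : field_axiom
    (All (All (All ('v_2 * ('v_1 * 'v_0) == ('v_2 * 'v_1) * 'v_0))))
| ax_mulC : field_axiom (All (All ('v_1 * 'v_0 == 'v_0 * 'v_1)))
| ax_mul1 : field_axiom (All (1 * 'v_0 == 'v_0))
| ax_mulDl : field_axiom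
    (All (All (All (('v_2 + 'v_1) * 'v_0 == 'v_2 * 'v_0 + 'v_1 * 'v_0))))
| ax_neq10 : field_axiom (~~ (1 == 0))
| ax_inv : field_axiom (All ((~~ ('v_0 == 0)) ==> Ex ('v_1 * 'v_0 == 1))).

Inductive aut_axiom (a : A) : theory (ring_lang A) :=
| ax_autD : aut_axiom a
    (All (All (taut a ('v_1 + 'v_0) == taut a 'v_1 + taut a 'v_0)))
| ax_autM : aut_axiom a
    (All (All (taut a ('v_1 * 'v_0) == taut a 'v_1 * taut a 'v_0)))
| ax_aut1 : aut_axiom a (taut a 1 == 1)
| ax_aut_inj : aut_axiom a
    (All (All ((taut a 'v_1 == taut a 'v_0) ==> ('v_1 == 'v_0))))
| ax_aut_surj : aut_axiom a (All (Ex (taut a 'v_0 == 'v_1))).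

Definition commute_axiom (a b : A) : sentence (ring_lang A) :=
  All (taut a (taut b 'v_0) == taut b (taut a 'v_0)).

End Sentences.

Definition diff_lang : language := ring_lang unit.

Definition difference_field : theory diff_lang :=
  fun p => field_axiom p \/ aut_axiom tt p.

Definition is_ACFA (T : theory diff_lang) : Prop :=
  model_companion difference_field T.

(* None is the new symbol; Some embeds the unary symbols of diff_lang. *)
Definition diff_tau_lang : language := ring_lang (option unit).
Definition sigma : option unit := Some tt.
Definition tau : option unit := None.

Fixpoint lift_term n (t : term diff_lang n) : term diff_tau_lang n :=
  match t with
  | Var i => Var i
  | App f args =>
      match f return ('I_(@arity diff_lang f) -> term diff_tau_lang n) ->
                     term diff_tau_lang n with
      | Zero => @App diff_tau_lang n Zero
      | One => @App diff_tau_lang n One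
      | Opp => @App diff_tau_lang n Opp
      | Add => @App diff_tau_lang n Add
      | Mul => @App diff_tau_lang n Mul
      | Aut _ => @App diff_tau_lang n (Aut sigma)
      end (fun i => lift_term (args i))
  end.

Fixpoint lift_formula n (p : formula diff_lang n) : formula diff_tau_lang n :=
  match p with
  | Bot => Bot
  | Eq s t => Eq (lift_term s) (lift_term t)
  | Imp p q => Imp (lift_formula p) (lift_formula q)
  | All p => All (lift_formula p)
  end.

Inductive with_commuting_aut (T : theory diff_lang) : theory diff_tau_lang :=
| wca_base p : T p -> with_commuting_aut T (lift_formula p)
| wca_aut p : aut_axiom tau p -> with_commuting_aut T p
| wca_comm : with_commuting_aut T (commute_axiom tau sigma).

(* Main.v *)
(** Consider the pattern "there are x fixed by sigma and tau, and y, z with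
    (y^2 - y)(x - a) = 1 and (z^2 - z)(x - b) = 1, such that exactly one of
    tau y = sigma y and tau z = sigma z holds".  It fails whenever b = sigma^n a,
    since then sigma^n y is z or 1 - z and tau commutes with sigma.  Start from a
    model in which tau = sigma and the sigma-orbit of a is infinite.  In an
    ultrapower, the pattern also fails for b = [sigma^k a]_k; but it is realized in
    an extension, so the ultrapower is not existentially closed.

    For the extension of an algebraically closed N, adjoin x = [c_k]_k, where the
    c_k are distinct elements of N fixed by sigma and tau, and let K be the algebraic
    closure of N(x).  Take an automorphism gamma of K over N(x) that exchanges z
    and 1 - z but fixes the elements that are power series in x - b; they include
    everything unramified at x = b.  As b has an infinite orbit, each element of K
    is fixed by almost all the conjugates sigma^n gamma sigma^-n, so their product
    over all n in Z makes sense.  It commutes with sigma, fixes y (in any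
    characteristic y is unramified at x = sigma^n b outside a and a - 4) and moves z;
    if tau does not realize the pattern, its composite with this product does.

    Finally (K, sigma, tau) embeds into a model of ACFA with commuting tau:
    amalgamation of difference fields over an algebraically closed one allows tau
    to be extended step by step, and one passes to the colimit. *)
From HB Require Import structures.
From mathcomp Require Import all_boot all_algebra fieldext separable.
From mathcomp Require Import boolp classical_sets filter ring.
Require Import Defs.

Set Implicit Arguments.
Unset Strict Implicit.
Unset Printing Implicit Defensive.
Import GRing.Theory.
Local Open Scope classical_set_scope.
Local Open Scope ring_scope.

(** * Subfields and subrings as types *)

(** Since x is fixed and tau a = sigma a, both tau y and sigma y are roots of (Y^2 - Y)(x - sigma a)
    = 1, and these roots are exchanged by Y -> 1 - Y. So the truth of tau y = sigma y is one bit
    that does not depend on the choice of y, and the pattern says that the bits of a and b differ.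
    Unlike Y^2 = x - a, this equation is separable in characteristic 2 too; with denominators
    cleared its discriminant is (x - a)(x - a + 4), the source of the constant 4. The obstacle is
    that lifts of sigma and tau from N(x) to its algebraic closure commute only up to the Galois
    group. Taking x in an ultrapower of N removes it: automorphisms of N that fix the c_k act
    coefficientwise, hence compatibly with composition. One element, [z] in [initial_model], fixed
    by sigma and not a root of unity, serves twice: its powers are the c_k, and sigma a = z a makes
    the orbit of a infinite. A model of ACFA that extends a model of T is again a model of T, by
    model completeness. In the algebra, subrings are presented by morphisms that may have a kernel,
    which avoids quotients. *)

Section SubField.
Variables (E : fieldType) (D : E -> Prop).
Hypotheses (D1 : D 1) (DB : forall x y, D x -> D y -> D (x - y))
  (DM : forall x y, D x -> D y -> D (x * y)) (DV : forall x, D x -> D x^-1).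

Definition subf : {pred E} := fun x => `[< D x >].

Fact subf_closed : GRing.divring_closed subf.
Proof.
split; first exact/asboolP.
  by move=> x y /asboolP Dx /asboolP Dy; apply/asboolP/DB.
by move=> x y /asboolP Dx /asboolP Dy; apply/asboolP/DM => //; exact: DV.
Qed.
HB.instance Definition _ := GRing.isDivringClosed.Build E subf subf_closed.

Record subfT := SubfT { subf_val :> E; _ : subf_val \in subf }.
HB.instance Definition _ := [isSub for subf_val].
HB.instance Definition _ := [Choice of subfT by <:].
HB.instance Definition _ := [SubChoice_isSubComUnitRing of subfT by <:].
HB.instance Definition _ := [SubComUnitRing_isSubIntegralDomain of subfT by <:].
HB.instance Definition _ := [SubIntegralDomain_isSubField of subfT by <:].

Lemma subfield_type :
  exists (K : fieldType) (i : {rmorphism K -> E}), forall x, D x <-> exists y, i y = x.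
Proof.
exists subfT, (\val : {rmorphism subfT -> E}) => x; split.
  move=> Dx; have xD : x \in subf by exact/asboolP.
  by exists (SubfT xD).
by case=> -[y /asboolP Dy] /= <-.
Qed.
End SubField.

Section SubRing.
Variables (E : comNzRingType) (D : E -> Prop).
Hypotheses (D1 : D 1) (DB : forall x y, D x -> D y -> D (x - y))
  (DM : forall x y, D x -> D y -> D (x * y)).

Definition subr : {pred E} := fun x => `[< D x >].

Fact subr_closed : GRing.subring_closed subr.
Proof.
split; first exact/asboolP.
  by move=> x y /asboolP Dx /asboolP Dy; apply/asboolP/DB.
by move=> x y /asboolP Dx /asboolP Dy; apply/asboolP/DM.
Qed.
HB.instance Definition _ := GRing.isSubringClosed.Build E subr subr_closed.

Record subrT := SubrT { subr_val :> E; _ : subr_val \in subr }.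
HB.instance Definition _ := [isSub for subr_val].
HB.instance Definition _ := [Choice of subrT by <:].
HB.instance Definition _ := [SubChoice_isSubComNzRing of subrT by <:].

Lemma subring_type :
  exists (K : comNzRingType) (i : {rmorphism K -> E}),
    injective i /\ forall x, D x <-> exists y, i y = x.
Proof.
exists subrT, (\val : {rmorphism subrT -> E}); split=> [|x]; first exact: val_inj.
split.
  move=> Dx; have xD : x \in subr by exact/asboolP.
  by exists (SubrT xD).
by case=> -[y /asboolP Dy] /= <-.
Qed.
End SubRing.

(** * Minimal algebraic relations *)

Local Notation "p ^^ f" := (map_poly f p) (at level 9, format "p ^^ f").

Lemma pseudo_division (R : comNzRingType) (d q : {poly R}) : d != 0 ->
  exists k (Q r : {poly R}), lead_coef d ^+ k *: q = Q * d + r /\ (size r < size d)%N.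
Proof.
move=> d0; have E := Pdiv.ComRing.rdivp_eq d q.
by do 3!eexists; split; [exact: E | rewrite Pdiv.Ring.ltn_rmodp].
Qed.

(** [e] may kill leading coefficients, so degrees are measured on images; truncation brings the size
    of a polynomial down to that of its image. *)
Lemma map_poly_truncate (R B : nzRingType) (e : {rmorphism R -> B}) (q : {poly R}) :
  exists2 P : {poly R}, P^^e = q^^e & size P = size (q^^e).
Proof.
have E : (take_poly (size (q^^e)) q)^^e = q^^e.
  apply/polyP => i; rewrite !coef_map coef_take_poly /=.
  by case: ltnP => // ?; rewrite rmorph0 -coef_map nth_default.
exists (take_poly (size (q^^e)) q); first exact: E.
apply/eqP; rewrite eqn_leq size_take_poly /= -{1}E.
exact: size_poly.
Qed.

Lemma size_map_poly_leq (R B : nzRingType) (e : {rmorphism R -> B}) (p : {poly R}) :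
  (size p^^e <= size p)%N.
Proof. exact: size_poly. Qed.

Section MinimalRelation.
Variables (R : comNzRingType) (B : fieldType) (e : {rmorphism R -> B}) (x : B).

(** A fraction-free minimal polynomial of [x] over the field generated by the image of [e]. As [e]
    may have a kernel, polynomials with the same image count as equal. *)
Definition minimal_relation (P : {poly R}) :=
  [/\ e (lead_coef P) != 0, (P^^e).[x] = 0 &
      forall q : {poly R}, (size (q^^e) < size P)%N -> (q^^e).[x] = 0 -> q^^e = 0].

Lemma lead_coef_truncate (P : {poly R}) :
  P^^e != 0 -> size P = size (P^^e) -> e (lead_coef P) != 0.
Proof.
move=> P0 szP; rewrite lead_coefE szP -coef_map -lead_coefE.
by rewrite lead_coef_eq0.
Qed.

Lemma minimal_relation_exists :
  (exists2 p : {poly R}, p^^e != 0 & (p^^e).[x] = 0) ->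
  exists P, minimal_relation P.
Proof.
move=> [p p0 px].
pose S n := `[< exists q : {poly R}, [/\ size q^^e = n, q^^e != 0 & (q^^e).[x] = 0] >].
have exS : exists n, S n by exists (size p^^e); apply/asboolP; exists p.
case: (ex_minnP exS) => n /asboolP[q [szq q0 qx]] minq.
have [P PE szP] := map_poly_truncate e q.
rewrite -PE in szq q0 qx szP; exists P; split=> //; first exact: lead_coef_truncate.
move=> r ltr rx; apply/eqP/negP => /negP r0.
suff: (n <= size r^^e)%N by rewrite leqNgt -szq -szP ltr.
by apply: minq; apply/asboolP; exists r.
Qed.

Section Min.
Variables (P : {poly R}) (minP : minimal_relation P).

Lemma minimal_relation_neq0 : P != 0.
Proof.
case: minP => lP _ _; rewrite -lead_coef_eq0.
by apply: contraNneq lP => ->; rewrite rmorph0.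
Qed.

(** The remainder of a pseudo-division by [P] vanishes at [x] and is shorter than [P], so its image
    is zero. *)
Lemma minimal_relation_divides (q : {poly R}) : (q^^e).[x] = 0 ->
  exists k (Q r : {poly R}), lead_coef P ^+ k *: q = Q * P + r /\ r^^e = 0.
Proof.
case: minP => _ Px min qx.
have [k [Q [r [E ltr]]]] := pseudo_division q minimal_relation_neq0.
exists k, Q, r; split=> //; apply: min; first exact: leq_ltn_trans (size_poly _ _) ltr.
have : ((lead_coef P ^+ k *: q)^^e).[x] = ((Q * P + r)^^e).[x] by rewrite E.
by rewrite map_polyZ rmorphD rmorphM !hornerE /= qx Px !mulr0 add0r.
Qed.

Lemma minimal_relation_size : (1 < size P)%N.
Proof.
case: minP => lP Px _; rewrite ltnNge; apply/negP => /size1_polyC PC.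
move: Px lP; rewrite PC map_polyC hornerC lead_coefC => ->; by rewrite eqxx.
Qed.

(** Over the fraction field [P] is irreducible, hence coprime to [w]. A combination [d] of [w] and
    [P] of least degree divides both up to scalars; it does not vanish at [x] because [w] does not,
    so its cofactor in [P] does and has at least the degree of [P], which makes [d] constant. *)
Lemma minimal_relation_bezout (w : {poly R}) : (w^^e).[x] != 0 ->
  exists (u v : {poly R}) r (s : {poly R}), [/\ u * w + v * P = r%:P + s, s^^e = 0 & e r != 0].
Proof.
move=> wx; have [lP Px min] := minP.
(* The ideal generated by [w] and [P], modulo polynomials with zero image. *)
pose J (d : {poly R}) := exists u v s : {poly R}, u * w + v * P = d + s /\ s^^e = 0.
pose S n := `[< exists d, [/\ size d^^e = n, J d & d^^e != 0] >].
have exS : exists n, S n.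
  exists (size w^^e); apply/asboolP; exists w; split=> //.
    by exists 1, 0, 0; rewrite mul1r mul0r rmorph0.
  by apply: contraNneq wx => ->; rewrite horner0.
case: (ex_minnP exS) => n /asboolP[d' [szd [u [v [s [Jd s0]]]] d0]] mind.
have [d dE szE] := map_poly_truncate e d'; rewrite -dE in szd d0 szE.
have {s0 Jd dE} [s' [s0 Jd]] : exists s : {poly R}, s^^e = 0 /\ u * w + v * P = d + s.
  exists (s + (d' - d)); rewrite rmorphD rmorphB /= s0 dE subrr addr0; split=> //.
  by rewrite Jd addrCA addrC [d + _]addrC subrK addrC.
have small (r : {poly R}) : J r -> (size r < size d)%N -> r^^e = 0.
  move=> Jr ltr; apply/eqP/negP => /negP r0.
  suff: (n <= size r^^e)%N.
    by rewrite leqNgt -szd -szE (leq_ltn_trans (size_poly _ _) ltr).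
  by apply: mind; apply/asboolP; exists r.
have dn0 : d != 0 by apply: contraNneq d0 => ->; rewrite rmorph0.
have ld0 := lead_coef_truncate d0 szE.
have divJ (a b : {poly R}) : exists k (Q : {poly R}),
    (e (lead_coef d) ^+ k) *: (a * w + b * P)^^e = Q^^e * d^^e.
  have [k [Q [r [E ltr]]]] := pseudo_division (a * w + b * P) dn0.
  exists k, Q; rewrite -rmorphXn -map_polyZ E rmorphD rmorphM /= (small r) ?addr0 //.
  exists (lead_coef d ^+ k *: a - Q * u), (lead_coef d ^+ k *: b - Q * v), (- Q * s').
  rewrite rmorphM /= s0 mulr0; split=> //.
  rewrite -[r](addKr (Q * d)) -E scalerDr !mulrBl -!scalerAl.
  have -> : Q * d = Q * (u * w + v * P) - Q * s' by rewrite Jd mulrDr addrK.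
  by rewrite mulrDr !mulrA mulNr; ring.
have lk0 k : e (lead_coef d) ^+ k != 0 by rewrite expf_eq0 negb_and ld0 orbT.
have dx : (d^^e).[x] != 0.
  have [k [Q]] := divJ 1 0; rewrite mul1r mul0r addr0 => /(congr1 (horner^~ x)) /=.
  rewrite hornerZ hornerM => E; apply: contraNneq wx => dx.
  by move/eqP: E; rewrite dx mulr0 mulf_eq0 (negbTE (lk0 k)).
have [k [Q]] := divJ 0 1; rewrite mul1r mul0r add0r => E.
have Pe0 : P^^e != 0.
  by apply: contraNneq lP => P0; rewrite -coef_map P0 coef0.
have Q0 : Q^^e != 0.
  apply: contraNneq Pe0 => Q0; move/eqP: E; rewrite Q0 mul0r scaler_eq0.
  by rewrite (negbTE (lk0 k)).
have Qx : (Q^^e).[x] = 0.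
  move/(congr1 (horner^~ x))/eqP: (E); rewrite hornerZ hornerM Px mulr0 eq_sym mulf_eq0.
  by rewrite (negbTE dx) orbF => /eqP.
have leQ : (size P <= size Q^^e)%N.
  by rewrite leqNgt; apply: contraNN Q0 => ltQ; rewrite (min Q).
have sz1 : (size d <= 1)%N.
  move/(congr1 (size \o polyseq)): E => /=; rewrite size_scale // size_mul // -szE => E.
  have := leq_trans (size_map_poly_leq e P) leQ.
  by rewrite E -subn1 leq_subLR addnC leq_add2r.
exists u, v, d`_0, s'; split=> //; first by rewrite Jd {1}(size1_polyC sz1).
by move: ld0; rewrite (size1_polyC sz1) lead_coefC coefC.
Qed.
End Min.
End MinimalRelation.

Section ExtendMorphism.
Variables (R : comNzRingType) (B A : fieldType).
Variables (e : {rmorphism R -> B}) (h : {rmorphism R -> A}) (x : B) (y : A).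
Variable P : {poly R}.
Hypotheses (minP : minimal_relation e x P) (ker : forall r, e r = 0 -> h r = 0).
Hypothesis Py : (P^^h).[y] = 0.

Lemma map_poly_ker (q : {poly R}) : q^^e = 0 -> q^^h = 0.
Proof.
move=> q0; apply/polyP => i; rewrite coef_map coef0 /=; apply: ker.
by rewrite -coef_map q0 coef0.
Qed.

(** This makes q(x) -> q(y) well defined. Pseudo-division multiplies [q] by a power of the leading
    coefficient of [P], which must therefore survive [h]. *)
Lemma extend_morphism_ker (q : {poly R}) :
  h (lead_coef P) != 0 -> (q^^e).[x] = 0 -> (q^^h).[y] = 0.
Proof.
move=> lP /(minimal_relation_divides minP)[k [Q [r [E /map_poly_ker r0]]]].
have : ((lead_coef P ^+ k *: q)^^h).[y] = ((Q * P + r)^^h).[y] by rewrite E.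
rewrite map_polyZ rmorphD rmorphM !hornerE /= Py r0 horner0 mulr0 addr0 rmorphXn.
by move/eqP; rewrite mulf_eq0 expf_eq0 (negbTE lP) andbF => /eqP.
Qed.

End ExtendMorphism.

(** [r] is the constant of the Bezout identity. It depends on [w] and [P] only, so an induction can
    ask for [h r != 0] before [y] is chosen. *)
Lemma extend_morphism_neq0 (R : comNzRingType) (B : fieldType) (e : {rmorphism R -> B})
    x (P w : {poly R}) : minimal_relation e x P -> (w^^e).[x] != 0 ->
  exists2 r, e r != 0 & forall (A : fieldType) (h : {rmorphism R -> A}) y,
    (forall r, e r = 0 -> h r = 0) -> (P^^h).[y] = 0 -> h r != 0 -> (w^^h).[y] != 0.
Proof.
move=> minP /(minimal_relation_bezout minP)[u [v [r [s [E s0 er]]]]].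
exists r => // A h y ker Py hr; apply: contra_neq hr => wy.
have : ((u * w + v * P)^^h).[y] = ((r%:P + s)^^h).[y] by rewrite E.
rewrite !rmorphD !rmorphM !hornerE /= Py wy !mulr0 addr0 map_polyC.
by rewrite (map_poly_ker ker s0) horner0 hornerC addr0.
Qed.

(** * Specializations of finitely generated algebras *)

Definition alg_closed (F : fieldType) :=
  forall p : {poly F}, size p != 1 -> exists x, p.[x] = 0.

Lemma alg_closed_nonroot (F : fieldType) (p : {poly F}) :
  alg_closed F -> p != 0 -> exists x, p.[x] != 0.
Proof.
move=> acF p0; have [sz|sz] := leqP (size p) 1.
  exists 0; rewrite horner_coef0.
  by move: p0; rewrite (size1_polyC sz) polyC_eq0 coefC.
have sz1 : size (p + 1) = size p by rewrite size_polyDl // size_poly1.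
have /acF[x] : size (p + 1) != 1 by rewrite sz1 neq_ltn sz orbT.
rewrite hornerD hornerC => px; exists x.
by apply/eqP => px0; move/eqP: px; rewrite px0 add0r oner_eq0.
Qed.

Definition evalm (R B : comNzRingType) (e : {rmorphism R -> B}) (x : B) :
  {rmorphism {poly R} -> B} := horner_morph (fun a => mulrC x (e a)).

Lemma evalmE R B e x p : @evalm R B e x p = (p^^e).[x].
Proof. by []. Qed.

(** A Nullstellensatz for the [A]-algebra generated by [s], presented by an iterated polynomial ring
    [R]. A new generator that is algebraic is sent to a root of its specialized minimal relation, a
    transcendental one to any value at which [w] survives. *)
Lemma specialization (A B : fieldType) (g : {rmorphism A -> B}) (s : seq B) :
  alg_closed A ->
  exists (R : comNzRingType) (i : {rmorphism A -> R}) (e : {rmorphism R -> B}),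
    [/\ forall a, e (i a) = g a, {in s, forall x, exists r, e r = x}
      & forall r, e r != 0 -> exists h : {rmorphism R -> A},
        [/\ forall a, h (i a) = a, forall r, e r = 0 -> h r = 0 & h r != 0]].
Proof.
move=> acA; elim: s => [|x s [R [i [e [ei es eh]]]]].
  exists A, idfun, g; split=> // r gr; exists idfun; split=> // [r' /eqP|].
    by rewrite fmorph_eq0 => /eqP.
  by apply/eqP => /= r0; move: gr; rewrite r0 rmorph0 eqxx.
exists {poly R}, (polyC \o i), (evalm e x); split.
- by move=> a; rewrite evalmE /= map_polyC hornerC /= ei.
- move=> z; rewrite inE => /orP[/eqP->|/es[r er]].
    by exists 'X; rewrite evalmE map_polyX hornerX.
  by exists r%:P; rewrite evalmE map_polyC hornerC.
move=> w; rewrite evalmE => wx.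
have [[p p0 px]|tr] := pselect (exists2 p : {poly R}, p^^e != 0 & (p^^e).[x] = 0).
  have [|P minP] := @minimal_relation_exists _ _ e x; first by exists p.
  have [r er hr] := extend_morphism_neq0 minP wx.
  have [lP Px _] := minP.
  (* One nonvanishing condition for two purposes: [r] keeps [w] nonzero at [y], and the leading
     coefficient keeps the degree of [P], so that a root [y] exists. *)
  have /eh[h [hi ker hn0]] : e (r * lead_coef P) != 0 by rewrite rmorphM mulf_neq0.
  move: hn0; rewrite rmorphM mulf_eq0 negb_or => /andP[hr0 hl0].
  have szh : size (P^^h) = size P by rewrite size_poly_eq // -lead_coefE.
  have [|y Py] := acA (P^^h).
    by rewrite szh neq_ltn (minimal_relation_size minP) orbT.
  exists (evalm h y); split=> [a|q|].
  + by rewrite evalmE /= map_polyC hornerC /= hi.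
  + rewrite !evalmE; exact: extend_morphism_ker minP ker Py q hl0.
  + by rewrite evalmE; apply: hr.
have nz (q : {poly R}) : (q^^e).[x] = 0 -> q^^e = 0.
  by move=> qx; apply/eqP/negP => /negP q0; apply: tr; exists q.
have w0 : w^^e != 0 by apply: contraNneq wx => ->; rewrite horner0.
have [k ek] : exists k, e w`_k != 0.
  by exists (size w^^e).-1; rewrite -coef_map -lead_coefE lead_coef_eq0.
have [h [hi ker hn0]] := eh _ ek.
have wh0 : w^^h != 0.
  by apply: contraNneq hn0 => wh; rewrite -coef_map wh coef0.
have [y wy] := alg_closed_nonroot acA wh0.
exists (evalm h y); split=> [a|q|]; last by rewrite evalmE.
  by rewrite evalmE /= map_polyC hornerC /= hi.
by rewrite !evalmE => /nz/(map_poly_ker ker)->; rewrite horner0.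
Qed.

(** Only finitely many elements are controlled; an ultraproduct over all [s] later glues such maps
    into a ring morphism defined on [B]. *)
Lemma finite_specialization (A B : fieldType) (g : {rmorphism A -> B}) (s : seq B) :
  alg_closed A -> exists h : B -> A,
    [/\ forall a, h (g a) = a, {in s &, forall x y, h (x - y) = h x - h y}
      & {in s &, forall x y, h (x * y) = h x * h y}].
Proof.
move=> acA; have [R [i [e [ei es eh]]]] := specialization g s acA.
have /eh[h [hi ker _]] : e 1 != 0 by rewrite rmorph1 oner_eq0.
have [h' h'E] : exists h' : B -> A, forall r, h' (e r) = h r.
  (* Outside the image of [e] the value is a default 0. *)
  exists (fun b => if pselect (exists r, e r = b) is left ex then h (projT1 (cid ex)) else 0).
  move=> r; case: pselect => [ex|[]]; last by exists r.
  case: cid => /= r' /eqP; rewrite -subr_eq0 -rmorphB => /eqP/ker/eqP.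
  by rewrite rmorphB subr_eq0 => /eqP.
exists h'; split=> [a|x y /es[r <-] /es[r' <-]|x y /es[r <-] /es[r' <-]].
- by rewrite -ei h'E hi.
- by rewrite -rmorphB !h'E rmorphB.
- by rewrite -rmorphM !h'E rmorphM.
Qed.

(** The image of [p] is required to be nonzero, since [i] may have a kernel. *)
Definition algebraic_over (A : comNzRingType) (E : fieldType) (i : {rmorphism A -> E}) x :=
  exists2 p : {poly A}, p^^i != 0 & (p^^i).[x] = 0.

Lemma rmorphism_of (A B : comNzRingType) (f : A -> B) :
  f 1 = 1 -> {morph f : x y / x - y} -> {morph f : x y / x * y} ->
  exists g : {rmorphism A -> B}, g =1 f.
Proof.
move=> f1 fB fM.
pose fA := GRing.isZmodMorphism.Build A B f fB.
pose fR := GRing.isMonoidMorphism.Build A B f (f1, fM).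
pose g : {rmorphism A -> B} := HB.pack f fA fR.
by exists g.
Qed.

(** * Extending embeddings along algebraic extensions, by Zorn's lemma *)

Section ExtendEmbedding.
Variables (A : comNzRingType) (E L : fieldType).
Variables (i1 : {rmorphism A -> E}) (i2 : {rmorphism A -> L}).
Hypotheses (acL : alg_closed L) (ker : forall a, i1 a = 0 <-> i2 a = 0).
Hypothesis algE : forall x, algebraic_over i1 x.

(** [G] is the graph of an isomorphism between subrings of [E] and [L]; the last clause makes it
    both single-valued and injective. Graphs are ordered by inclusion, which suits Zorn's lemma. *)
Definition partial_embedding (G : set (E * L)) :=
  [/\ forall a, G (i1 a, i2 a),
      forall z t, G z -> G t -> G (z - t), forall z t, G z -> G t -> G (z * t)
    & forall z, G z -> z.1 = 0 <-> z.2 = 0].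

Lemma maximal_partial_embedding :
  exists2 G, partial_embedding G & forall H, partial_embedding H -> G `<=` H -> H `<=` G.
Proof.
pose base : set (E * L) := [set z | exists a, z = (i1 a, i2 a)].
have base_emb : partial_embedding base.
  split=> [a|z t [a ->] [b ->]|z t [a ->] [b ->]|z [a ->]]; last exact: ker.
  - by exists a.
  - by exists (a - b); rewrite !rmorphB.
  - by exists (a * b); rewrite !rmorphM.
have [F Fsub Ftot|G [PG maxG]] :=
    @Zorn_bigcup _ [set G | G = set0 \/ partial_embedding G].
  have [allE|/existsNP[X /not_implyP[FX X0]]] := pselect (forall X, F X -> X = set0).
    by left; rewrite bigcup0.
  have Xe : partial_embedding X by case: (Fsub X FX).
  have join z t : (\bigcup_(Y in F) Y) z -> (\bigcup_(Y in F) Y) t ->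
      exists Y, [/\ F Y, partial_embedding Y, Y z & Y t].
    move=> [Y FY Yz] [Z FZ Zt].
    have ne W u : F W -> W u -> partial_embedding W.
      by move=> FW Wu; case: (Fsub W FW) => // W0; rewrite W0 in Wu.
    have [YZ|ZY] := Ftot Y Z FY FZ.
      by exists Z; split=> //; [exact: ne Zt | exact: YZ].
    by exists Y; split=> //; [exact: ne Yz | exact: ZY].
  right; split=> [a|z t Uz Ut|z t Uz Ut|z Uz].
  - by exists X => //; case: Xe.
  - by have [Y [FY [_ YB _ _] Yz Yt]] := join z t Uz Ut; exists Y => //; exact: YB.
  - by have [Y [FY [_ _ YM _] Yz Yt]] := join z t Uz Ut; exists Y => //; exact: YM.
  - by have [Y [FY [_ _ _ Yk] Yz _]] := join z z Uz Uz; exact: Yk.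
have maxG' H : partial_embedding H -> G `<=` H -> H `<=` G.
  move=> He GH; apply: contrapT => HG; apply: (maxG H); last by right.
  by split.
exists G => //; case: PG => // G0; case: (maxG base); last by right.
by rewrite G0; split=> // /(_ (i1 0, i2 0)); apply; exists 0.
Qed.

(** The subring [K] of pairs in a maximal [G], with its two projections, is a base over which any
    [x] can be adjoined; by maximality [x] was in the domain already. *)
Theorem extend_embedding : exists h : {rmorphism E -> L}, forall a, h (i1 a) = i2 a.
Proof.
have [G Ge maxG] := maximal_partial_embedding; have [Gi GB GM Gk] := Ge.
have G1 : G 1 by have := Gi 1; rewrite !rmorph1.
have [K [i [iinj iG]]] := subring_type G1 GB GM.
have Gtot x : exists y, G (x, y).
  pose e : {rmorphism K -> E} := fst \o i; pose h : {rmorphism K -> L} := snd \o i.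
  have eh r : e r = 0 <-> h r = 0 by apply: Gk; apply/iG; exists r.
  have [j jE] : {j : A -> K & forall a, i (j a) = (i1 a, i2 a)}.
    by apply: (@boolp.choice A K (fun a b => i b = (i1 a, i2 a))) => a; apply/iG.
  have j0 : j 0 = 0 by apply: iinj; rewrite jE !rmorph0.
  have [P minP] : exists P, minimal_relation e x P.
    apply: minimal_relation_exists; have [p p0 px] := algE x.
    have E1 : (map_poly j p)^^e = p^^i1.
      by apply/polyP => k; rewrite !coef_map_id0 ?rmorph0 //= jE.
    by exists (map_poly j p); rewrite E1.
  have [lP Px _] := minP.
  have hl : h (lead_coef P) != 0 by apply: contra_neq lP => /eh.
  have [|y Py] := @acL (P^^h).
    by rewrite size_poly_eq -?lead_coefE // neq_ltn (minimal_relation_size minP) orbT.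
  (* The graph of q(x) -> q(y), which contains [G] and the pair of [x] and [y]. *)
  pose H : set (E * L) := [set z | exists q : {poly K}, z = ((q^^e).[x], (q^^h).[y])].
  suff He : partial_embedding H.
    have GH : G `<=` H.
      by move=> z /iG[r <-]; exists r%:P; rewrite !map_polyC !hornerC /=; case: (i r).
    by exists y; apply: (maxG H He GH); exists 'X; rewrite !map_polyX !hornerX.
  split=> [a|z t [q ->] [q' ->]|z t [q ->] [q' ->]|z [q ->]].
  - by exists (j a)%:P; rewrite !map_polyC !hornerC /= jE.
  - by exists (q - q'); rewrite !rmorphB !hornerE.
  - by exists (q * q'); rewrite !rmorphM !hornerE.
  split=> /= [|qy]; first by apply: extend_morphism_ker minP _ Py q hl => r /eh.
  apply/eqP/negP => /negP qx; have [r er hr] := extend_morphism_neq0 minP qx.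
  have : (q^^h).[y] != 0 by apply: hr => // [s /eh|]; last by apply: contra_neq er => /eh.
  by rewrite qy eqxx.
have Ginj x y z : G (x, y) -> G (x, z) -> y = z.
  by move=> xy xz; apply/eqP; rewrite -subr_eq0; apply/eqP/(Gk _ (GB _ _ xy xz)); rewrite /= subrr.
have [f fG] := choice Gtot.
have [|||h hf] := @rmorphism_of E L f.
- exact: Ginj (fG 1) G1.
- by move=> x y; exact: Ginj (fG _) (GB _ _ (fG x) (fG y)).
- by move=> x y; exact: Ginj (fG _) (GM _ _ (fG x) (fG y)).
by exists h => a; rewrite hf; exact: Ginj (fG _) (Gi a).
Qed.

End ExtendEmbedding.

(** * Fields as first-order structures *)

Definition ring_interp (A : Type) (F : fieldType) (s : A -> F -> F) (f : ring_symbol A) :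
    ('I_(ring_arity f) -> F) -> F :=
  match f return ('I_(ring_arity f) -> F) -> F with
  | Zero => fun=> 0
  | One => fun=> 1
  | Opp => fun x => - x ord0
  | Add => fun x => x ord0 + x ord_max
  | Mul => fun x => x ord0 * x ord_max
  | Aut a => fun x => s a (x ord0)
  end.

Definition field_structure (A : Type) (F : fieldType) (s : A -> F -> F) :
  structure (ring_lang A) := @Structure (ring_lang A) F (ring_interp s).

Section TermEvaluation.
Variables (A : Type) (M : structure (ring_lang A)).

Definition zeroM : M := @interp _ M Zero (@env0 _).
Definition oneM : M := @interp _ M One (@env0 _).
Definition oppM (x : M) : M := @interp _ M Opp (fun=> x).
Definition addM (x y : M) : M := @interp _ M Add (fun i : 'I_2 => if val i == 0%N then x else y).
Definition mulM (x y : M) : M := @interp _ M Mul (fun i : 'I_2 => if val i == 0%N then x else y).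
Definition autM a (x : M) : M := @interp _ M (Aut a) (fun=> x).

Lemma env0_eq T (f g : 'I_0 -> T) : f = g.
Proof. by apply: funext => -[]. Qed.

Section Env.
Variables (n : nat) (e : 'I_n -> M).

Lemma eval_zero : eval e tzero = zeroM.
Proof. by rewrite /zeroM /=; congr (interp _); exact: env0_eq. Qed.
Lemma eval_one : eval e tone = oneM.
Proof. by rewrite /oneM /=; congr (interp _); exact: env0_eq. Qed.
Lemma eval_opp t : eval e (topp t) = oppM (eval e t).
Proof. by []. Qed.
Lemma eval_add s t : eval e (tadd s t) = addM (eval e s) (eval e t).
Proof. by rewrite /addM /=; congr (interp _); apply: funext => i; case: ifP. Qed.
Lemma eval_mul s t : eval e (tmul s t) = mulM (eval e s) (eval e t).
Proof. by rewrite /mulM /=; congr (interp _); apply: funext => i; case: ifP. Qed.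
Lemma eval_aut a t : eval e (taut a t) = autM a (eval e t).
Proof. by []. Qed.
Lemma eval_tvar0 x lt : eval (env_cons x e) (@tvar A n.+1 0 lt) = x.
Proof. by rewrite /= /env_cons; case: unliftP => // j /(congr1 val) /=. Qed.
Lemma eval_tvarS x k (lt : (k < n)%N) : eval (env_cons x e) (@tvar A n.+1 k.+1 lt) = eval e (tvar k lt).
Proof.
rewrite /= /env_cons; case: unliftP => [j|] /(congr1 val) //= [kj].
by congr (e _); exact: val_inj.
Qed.
End Env.

Definition evalE :=
  (eval_tvar0, eval_tvarS, eval_zero, eval_one, eval_opp, eval_add, eval_mul, eval_aut).
End TermEvaluation.

Lemma holds_Eq L (M : structure L) n (e : 'I_n -> M) s t :
  holds e (Eq s t) = (eval e s = eval e t).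
Proof. by []. Qed.

Lemma holds_Imp L (M : structure L) n (e : 'I_n -> M) p q :
  holds e (Imp p q) = (holds e p -> holds e q).
Proof. by []. Qed.

Lemma holds_Not L (M : structure L) n (e : 'I_n -> M) p :
  holds e (Not p) = ~ holds e p.
Proof. by []. Qed.

Lemma holds_Ex L (M : structure L) n (e : 'I_n -> M) (p : formula L n.+1) :
  holds e (Ex p) = exists x, holds (env_cons x e) p.
Proof.
apply: propext; split=> [h|[x px] h]; last exact: h px.
by apply: contrapT => /forallNP.
Qed.

Lemma holds_All L (M : structure L) n (e : 'I_n -> M) (p : formula L n.+1) :
  holds e (All p) -> forall x, holds (env_cons x e) p.
Proof. by []. Qed.

Lemma holds_AllE L (M : structure L) n (e : 'I_n -> M) (p : formula L n.+1) :
  holds e (All p) = forall x, holds (env_cons x e) p.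
Proof. by []. Qed.

Definition holdsE := (holds_Eq, holds_Ex, holds_Not, holds_Imp).

Lemma ord2E (T : Type) (x : 'I_2 -> T) :
  (fun i : 'I_2 => if val i == 0%N then x ord0 else x ord_max) = x.
Proof.
by apply: funext => -[[|[|//]] lt] /=; congr (x _); exact: val_inj.
Qed.

Section MakeField.
Variables (T : Type) (zero one : T) (opp : T -> T) (add mul : T -> T -> T).
Hypotheses (addA : associative add) (addC : commutative add) (add0 : left_id zero add).
Hypotheses (addN : left_inverse zero opp add) (mulA : associative mul).
Hypotheses (mulC : commutative mul) (mul1 : left_id one mul).
Hypotheses (mulD : left_distributive mul add) (neq10 : one <> zero).
Variable inv : T -> T.
Hypothesis mulV : forall x, x <> zero -> mul (inv x) x = one.

Definition fieldT : Type := T.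
HB.instance Definition _ := gen_eqMixin fieldT.
HB.instance Definition _ := gen_choiceMixin fieldT.
HB.instance Definition _ := GRing.isZmodule.Build fieldT addA addC add0 addN.

Fact fieldT_neq10 : one != zero :> fieldT.
Proof. exact/eqP. Qed.
HB.instance Definition _ :=
  GRing.Zmodule_isComNzRing.Build fieldT mulA mulC mul1 mulD fieldT_neq10.

Definition fieldT_inv (x : fieldT) : fieldT := if x == 0 then 0 else (inv x : fieldT).
Fact fieldT_mulV (x : fieldT) : x != 0 -> fieldT_inv x * x = 1.
Proof. by rewrite /fieldT_inv; case: eqP => // /mulV. Qed.
Fact fieldT_inv0 : fieldT_inv 0 = 0.
Proof. by rewrite /fieldT_inv eqxx. Qed.
HB.instance Definition _ := GRing.ComNzRing_isField.Build fieldT fieldT_mulV fieldT_inv0.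

Definition make_field : fieldType := fieldT.
End MakeField.

(** Extensionality gives an equality and not just an isomorphism, so that an arbitrary model can be
    replaced by a field with [subst]. *)
Lemma structure_is_field (A : Type) (M : structure (ring_lang A)) :
  (forall p, field_axiom p -> satisfies M p) ->
  exists (F : fieldType) (s : A -> F -> F), M = field_structure s.
Proof.
move=> fieldM; have fM p : field_axiom p -> holds (@env0 M) p := @fieldM p.
have addA : associative (@addM A M).
  by move=> x y z; have := holds_All (holds_All (holds_All (fM _ (ax_addA A)) x) y) z; rewrite !holdsE !evalE.
have addC : commutative (@addM A M).
  by move=> x y; have := holds_All (holds_All (fM _ (ax_addC A)) x) y; rewrite !holdsE !evalE.
have add0 : left_id (@zeroM A M) (@addM A M).
  by move=> x; have := holds_All (fM _ (ax_add0 A)) x; rewrite !holdsE !evalE.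
have addN : left_inverse (@zeroM A M) (@oppM A M) (@addM A M).
  by move=> x; have := holds_All (fM _ (ax_addN A)) x; rewrite !holdsE !evalE.
have mulA : associative (@mulM A M).
  by move=> x y z; have := holds_All (holds_All (holds_All (fM _ (ax_mulA A)) x) y) z; rewrite !holdsE !evalE.
have mulC : commutative (@mulM A M).
  by move=> x y; have := holds_All (holds_All (fM _ (ax_mulC A)) x) y; rewrite !holdsE !evalE.
have mul1 : left_id (@oneM A M) (@mulM A M).
  by move=> x; have := holds_All (fM _ (ax_mul1 A)) x; rewrite !holdsE !evalE.
have mulD : left_distributive (@mulM A M) (@addM A M).
  by move=> x y z; have := holds_All (holds_All (holds_All (fM _ (ax_mulDl A)) x) y) z; rewrite !holdsE !evalE.
have neq10 : oneM M <> zeroM M.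
  by have := fM _ (ax_neq10 A); rewrite !holdsE !evalE.
have [inv invP] : {inv : M -> M & forall x, x <> zeroM M -> mulM (inv x) x = oneM M}.
  apply: (@boolp.choice M M (fun x y => x <> zeroM M -> mulM y x = oneM M)) => x.
  have := holds_All (fM _ (ax_inv A)) x; rewrite !holdsE !evalE => ex.
  have [->|x0] := pselect (x = zeroM M); first by exists (zeroM M).
  have [y] := ex x0; rewrite !holdsE !evalE mulC => xy.
  by exists y => _; rewrite mulC -xy mulC.
exists (make_field addA addC add0 addN mulA mulC mul1 mulD neq10 invP), (@autM A M).
clear fM fieldM.
case: M addA addC add0 addN mulA mulC mul1 mulD neq10 inv invP => T I /= addA addC add0 addN mulA mulC mul1 mulD neq10 inv invP.
congr (Structure _); apply: functional_extensionality_dep => f.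
apply: funext => x; case: f x => [||||| a] x /=.
- by congr (I _); exact: env0_eq.
- by congr (I _); exact: env0_eq.
- by rewrite /oppM /=; congr (I _); apply: funext => i; rewrite (ord1 i).
- by rewrite -[x in LHS]ord2E.
- by rewrite -[x in LHS]ord2E.
- by rewrite /autM /=; congr (I _); apply: funext => i; rewrite (ord1 i).
Qed.

Section FieldStructure.
Variables (A : Type) (F : fieldType) (s : A -> F -> F).
Local Notation M := (field_structure s).

Lemma zeroE : zeroM M = 0. Proof. by []. Qed.
Lemma oneE : oneM M = 1. Proof. by []. Qed.
Lemma oppE x : @oppM A M x = - x. Proof. by []. Qed.
Lemma addE x y : @addM A M x y = x + y. Proof. by []. Qed.
Lemma mulE x y : @mulM A M x y = x * y. Proof. by []. Qed.
Lemma autE a x : @autM A M a x = s a x. Proof. by []. Qed.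
Definition opE := (zeroE, oneE, oppE, addE, mulE, autE).

Lemma field_structureP p : field_axiom p -> satisfies M p.
Proof.
rewrite /satisfies; case.
- by rewrite holds_AllE => x; rewrite holds_AllE => y; rewrite holds_AllE => z; rewrite !holdsE !evalE !opE addrA.
- by rewrite holds_AllE => x; rewrite holds_AllE => y; rewrite !holdsE !evalE !opE addrC.
- by rewrite holds_AllE => x; rewrite !holdsE !evalE !opE add0r.
- by rewrite holds_AllE => x; rewrite !holdsE !evalE !opE addNr.
- by rewrite holds_AllE => x; rewrite holds_AllE => y; rewrite holds_AllE => z; rewrite !holdsE !evalE !opE mulrA.
- by rewrite holds_AllE => x; rewrite holds_AllE => y; rewrite !holdsE !evalE !opE mulrC.
- by rewrite holds_AllE => x; rewrite !holdsE !evalE !opE mul1r.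
- by rewrite holds_AllE => x; rewrite holds_AllE => y; rewrite holds_AllE => z; rewrite !holdsE !evalE !opE mulrDl.
- by rewrite !holdsE !evalE !opE; apply/eqP/oner_neq0.
rewrite holds_AllE => x; rewrite !holdsE !evalE !opE => /eqP x0.
by exists x^-1; rewrite !holdsE !evalE !opE divff.
Qed.

Definition is_aut (f : F -> F) :=
  [/\ f 1 = 1, {morph f : x y / x - y}, {morph f : x y / x * y}
    & forall y, exists x, f x = y].

Lemma aut_axiomP a : (forall p, aut_axiom a p -> satisfies M p) <-> is_aut (s a).
Proof.
rewrite /satisfies; split=> [ax|[s1 sB sM sS] p].
  have sD : {morph s a : x y / x + y}.
    move=> x y; have := holds_All (holds_All (ax _ (ax_autD a)) x) y.
    by rewrite !holdsE !evalE !opE.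
  split.
  - by have := ax _ (ax_aut1 a); rewrite !holdsE !evalE !opE.
  - by move=> x y; have := sD (x - y) y; rewrite subrK => ->; rewrite addrK.
  - move=> x y; have := holds_All (holds_All (ax _ (ax_autM a)) x) y.
    by rewrite !holdsE !evalE !opE.
  - move=> y; have := holds_All (ax _ (ax_aut_surj a)) y.
    by rewrite !holdsE => -[x]; rewrite !holdsE !evalE !opE => E; exists x.
have [g gE] := rmorphism_of s1 sB sM.
case.
- by rewrite holds_AllE => x; rewrite holds_AllE => y; rewrite !holdsE !evalE !opE -!gE rmorphD.
- by rewrite holds_AllE => x; rewrite holds_AllE => y; rewrite !holdsE !evalE !opE -!gE rmorphM.
- by rewrite !holdsE !evalE !opE.
- by rewrite holds_AllE => x; rewrite holds_AllE => y; rewrite !holdsE !evalE !opE -!gE => /fmorph_inj.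
- by rewrite holds_AllE => y; rewrite !holdsE; have [x] := sS y; exists x; rewrite !holdsE !evalE !opE.
Qed.

Lemma is_aut_morph f : is_aut f -> exists2 g : {rmorphism F -> F}, g =1 f & bijective g.
Proof.
case=> f1 fB fM fS; have [g gE] := rmorphism_of f1 fB fM; exists g => //.
have [k kE] := boolp.choice fS; exists k => x; last by rewrite gE kE.
by apply: (fmorph_inj g); rewrite gE kE.
Qed.

Lemma commute_axiomP a b :
  satisfies M (commute_axiom a b) <-> forall x, s a (s b x) = s b (s a x).
Proof.
rewrite /satisfies; split=> [h x|h]; first by have := holds_All h x; rewrite !holdsE !evalE !opE.
by rewrite holds_AllE => x; rewrite !holdsE !evalE !opE.
Qed.

End FieldStructure.

Lemma rmorph_is_aut (F : fieldType) (g : {rmorphism F -> F}) :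
  (forall y, exists x, g x = y) -> is_aut g.
Proof. by split=> [|x y|x y|] //; rewrite (rmorph1, rmorphB, rmorphM). Qed.

Lemma structure_embedding (A : Type) (F K : fieldType) (s : A -> F -> F) (t : A -> K -> K)
    (h : {rmorphism F -> K}) : (forall a x, h (s a x) = t a (h x)) ->
  @embedding _ (field_structure s) (field_structure t) h.
Proof.
move=> hs; split=> [|f x]; first exact: fmorph_inj.
case: f x => [||||| a] x /=.
- by rewrite rmorph0.
- by rewrite rmorph1.
- by rewrite rmorphN.
- by rewrite rmorphD.
- by rewrite rmorphM.
- by rewrite hs.
Qed.

Lemma embedding_rmorphism (A : Type) (F K : fieldType) (s : A -> F -> F) (t : A -> K -> K) h :
  @embedding _ (field_structure s) (field_structure t) h ->
  exists2 g : {rmorphism F -> K}, g =1 h & forall a x, g (s a x) = t a (g x).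
Proof.
case=> _ hh; have h0 : h 0 = 0 by have := hh Zero (fun=> 0).
have h1 : h 1 = 1 by have := hh One (fun=> 0).
have hN x : h (- x) = - h x by have := hh Opp (fun=> x).
have hD x y : h (x + y) = h x + h y.
  by have := hh Add (fun i : 'I_2 => if val i == 0%N then x else y).
have hM : {morph h : x y / x * y}.
  by move=> x y; have := hh Mul (fun i : 'I_2 => if val i == 0%N then x else y).
have [|g gE] := rmorphism_of h1 _ hM; first by move=> x y; rewrite hD hN.
by exists g => // a x; rewrite !gE; have := hh (Aut a) (fun=> x).
Qed.

(** * Reduced products and ultraproducts *)

Section ReducedProduct.
Variables (L : language) (I : Type) (M : I -> structure L) (F : set_system I).
Context {FF : ProperFilter F}.
Variable D : set (forall i, M i).
Hypothesis D_interp : forall (f : L) (x : 'I_(arity f) -> forall i, M i),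
  (forall k, D (x k)) -> D (fun i => interp (fun k => x k i)).
Variable d0 : forall i, M i.
Hypothesis D_d0 : D d0.

Definition germ_eq (f g : forall i, M i) := F [set i | f i = g i].

Lemma germ_eq_refl f : germ_eq f f.
Proof. exact: filterS filterT. Qed.

Lemma germ_eq_sym f g : germ_eq f g -> germ_eq g f.
Proof. exact: filterS. Qed.

Lemma germ_eq_trans f g h : germ_eq f g -> germ_eq g h -> germ_eq f h.
Proof. by apply: filterS2 => i /= ->. Qed.

(** The choice depends only on the predicate of being an element of [D] equivalent to [f], and
    equivalent families have equal predicates. The quotient is thus carved out as the set of fixed
    points of [germ_repr]. *)
Definition germ_repr (f : forall i, M i) : forall i, M i :=
  if pselect (exists g, D g /\ germ_eq f g) is left ex then projT1 (cid ex) else d0.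

Lemma germ_reprP f : D f -> D (germ_repr f) /\ germ_eq f (germ_repr f).
Proof.
rewrite /germ_repr; case: pselect => [ex|nex] Df; first by case: cid.
by case: nex; exists f; split=> //; exact: germ_eq_refl.
Qed.

Lemma germ_repr_eq f g : germ_eq f g -> germ_repr f = germ_repr g.
Proof.
move=> fg; rewrite /germ_repr.
suff -> : (fun h => D h /\ germ_eq f h) = (fun h => D h /\ germ_eq g h) by [].
apply: funext => h; apply: propext; split=> -[Dh E]; split=> //.
  exact: germ_eq_trans (germ_eq_sym fg) E.
exact: germ_eq_trans fg E.
Qed.

Definition germ := {f : forall i, M i | D f /\ germ_repr f = f}.

Fact germ_repr_subproof f : D f -> D (germ_repr f) /\ germ_repr (germ_repr f) = germ_repr f.
Proof.
by move=> Df; have [Dr /germ_repr_eq E] := germ_reprP Df; split.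
Qed.

Definition pi_germ (f : forall i, M i) : germ :=
  if pselect (D f) is left Df then exist _ _ (germ_repr_subproof Df)
  else exist _ _ (germ_repr_subproof D_d0).

Definition repr (c : germ) : forall i, M i := projT1 c.

Lemma reprD c : D (repr c). Proof. by case: c => f []. Qed.

Lemma repr_pi f : D f -> germ_eq f (repr (pi_germ f)).
Proof.
move=> Df; rewrite /pi_germ; case: pselect => // Df' /=.
exact: (germ_reprP Df).2.
Qed.

Lemma repr_inj c d : germ_eq (repr c) (repr d) -> c = d.
Proof.
move=> /germ_repr_eq; case: c d => [f [Df rf]] [g [Dg rg]] /= E.
have fg : f = g by rewrite -rf -rg.
by case: _ / fg Dg rg {E} => Dg rg; congr (exist _ _ _); exact: Prop_irrelevance.
Qed.

Lemma pi_repr c : pi_germ (repr c) = c.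
Proof. by apply/repr_inj/germ_eq_sym/repr_pi/reprD. Qed.

Lemma pi_eq f g : D f -> D g -> pi_germ f = pi_germ g <-> germ_eq f g.
Proof.
move=> Df Dg; split=> [E|E].
  apply: germ_eq_trans (repr_pi Df) _; rewrite E; exact: germ_eq_sym (repr_pi Dg).
apply: repr_inj; apply: germ_eq_trans (germ_eq_sym (repr_pi Df)) _.
exact: germ_eq_trans E (repr_pi Dg).
Qed.

(** The restriction to [D] covers two cases: all families with an ultrafilter give an ultraproduct,
    eventually coherent families with the Frechet filter give the colimit of a chain. *)
Definition reduced_product : structure L :=
  @Structure L germ (fun f x => pi_germ (fun i => interp (fun k => repr (x k) i))).

Lemma interp_pi (f : L) (x : 'I_(arity f) -> forall i, M i) : (forall k, D (x k)) ->
  @interp _ reduced_product f (fun k => pi_germ (x k)) = pi_germ (fun i => interp (fun k => x k i)).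
Proof.
move=> Dx; apply/pi_eq; [by apply: D_interp => k; exact: reprD | exact: D_interp |].
have : F [set i | forall k, x k i = repr (pi_germ (x k)) i].
  by apply: filter_forall => k; exact: repr_pi.
by apply: filterS => i E; congr (interp _); apply: funext => k; rewrite -E.
Qed.

Lemma repr_eval n (t : term L n) (e : 'I_n -> reduced_product) :
  F [set i | repr (eval e t) i = eval (fun k => repr (e k) i) t].
Proof.
elim: t => [k|f args IH] /=; first exact: germ_eq_refl.
have : F [set i | forall k, repr (eval e (args k)) i = eval (fun k => repr (e k) i) (args k)].
  by apply: filter_forall => k; exact: IH.
have := repr_pi (D_interp (fun k => reprD (eval e (args k)))).
apply: filterS2 => i /= <- E; congr (interp _); exact: funext.
Qed.

Lemma holds_repr_cons n (p : formula L n.+1) (e : 'I_n -> reduced_product) c i :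
  holds (fun k => repr (env_cons c e k) i) p =
  holds (env_cons (repr c i) (fun k => repr (e k) i)) p.
Proof.
congr (holds _ p); apply: funext => k; rewrite /env_cons.
by case: (unlift _ _).
Qed.

Hypothesis decided : forall n (p : formula L n) (e : 'I_n -> reduced_product),
  F [set i | holds (fun k => repr (e k) i) p] \/ F [set i | ~ holds (fun k => repr (e k) i) p].
Hypothesis witness : forall n (p : formula L n.+1) (e : 'I_n -> reduced_product),
  F [set i | exists x, holds (env_cons x (fun k => repr (e k) i)) p] ->
  exists2 f, D f & F [set i | holds (env_cons (f i) (fun k => repr (e k) i)) p].

(** [decided] stands in for the ultrafilter property, for implications and quantifiers alike;
    [witness] lets counterexamples be chosen inside [D]. *)
Theorem los n (p : formula L n) (e : 'I_n -> reduced_product) :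
  holds e p <-> F [set i | holds (fun k => repr (e k) i) p].
Proof.
elim: p e => {n} [n|n s t|n p IHp q IHq|n p IHp] e /=.
- by split=> // /filter_ex[i].
- split=> [E|].
    apply: filterS2 (repr_eval s e) (repr_eval t e) => i /= <- <-; by rewrite E.
  move=> E; apply: repr_inj; apply: filterS3 E (repr_eval s e) (repr_eval t e).
  by move=> i /= E -> ->.
- split=> [pq|pq /IHp Fp]; last by apply/IHq; apply: filterS2 pq Fp => i; apply.
  have [/IHp/pq/IHq|] := decided p e; first by apply: filterS => i /= hq _.
  by apply: filterS => i /= np /np.
split=> [pe|Fp c]; last first.
  by apply/IHp; apply: filterS Fp => i Fi /=; rewrite holds_repr_cons; exact: Fi.
have [//|nF] := decided (All p) e.
have [f Df] : exists2 f, D f & F [set i | holds (env_cons (f i) (fun k => repr (e k) i)) (Not p)].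
  by apply: witness; apply: filterS nF => i /= /existsNP[x px]; exists x.
move=> Fn; have /IHp Fp := pe (pi_germ f).
have /filter_ex[] : F set0; last by [].
apply: filterS3 Fn Fp (repr_pi Df) => i /= np.
by rewrite holds_repr_cons => + E; rewrite -E.
Qed.

End ReducedProduct.

Lemma holds_env0 L (M : structure L) (p : sentence L) (e e' : 'I_0 -> M) :
  holds e p -> holds e' p.
Proof. by rewrite (env0_eq e e'). Qed.

Record ultraproduct_spec (L : language) (I : Type) (U : set_system I)
    (M : I -> structure L) (P : structure L) (pi : (forall i, M i) -> P) : Prop := {
  ultra_surj : forall c, exists f, pi f = c;
  ultra_eq : forall f g, pi f = pi g <-> U [set i | f i = g i];
  ultra_interp : forall (f : L) (x : 'I_(arity f) -> forall i, M i),
    interp (fun k => pi (x k)) = pi (fun i => interp (fun k => x k i));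
  ultra_los : forall n (p : formula L n) (x : 'I_n -> forall i, M i),
    holds (fun k => pi (x k)) p <-> U [set i | holds (fun k => x k i) p] }.

Lemma ultraproduct_exists (L : language) (I : Type) (U : set_system I) (M : I -> structure L)
    (d0 : forall i, M i) : UltraFilter U ->
  exists (P : structure L) (pi : (forall i, M i) -> P), ultraproduct_spec U pi.
Proof.
move=> UU; have D_interp (f : L) (x : 'I_(arity f) -> forall i, M i) :
  (forall k, setT (x k)) -> setT (fun i => interp (fun k => x k i)) by [].
exists (@reduced_product L I M U _ setT d0 Logic.I), (@pi_germ L I M U _ setT d0 Logic.I).
split.
- by move=> c; exists (repr c); exact: pi_repr.
- by move=> f g; exact: pi_eq.
- by move=> f x; exact: interp_pi.
move=> n p x; set e := fun k => _.
have -> : U [set i | holds (fun k => x k i) p] <-> U [set i | holds (fun k => repr (e k) i) p].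
  have : U [set i | forall k, x k i = repr (e k) i].
    by apply: filter_forall => k; exact: repr_pi.
  move=> E; split=> H; apply: filterS2 E H => i /= E.
    by rewrite (_ : (fun k => repr _ _) = fun k => x k i) //; apply: funext.
  by rewrite (_ : (fun k => x _ _) = fun k => repr (e k) i) //; exact: funext.
apply: (los D_interp) => {n p x e} n p e.
  exact: in_ultra_setVsetC.
move=> Fex; pose f i := if pselect (exists x, holds (env_cons x (fun k => repr (e k) i)) p)
  is left ex then projT1 (cid ex) else d0 i.
exists f => //; apply: filterS Fex => i /= ex; rewrite /f.
by case: pselect => // ex'; case: cid.
Qed.

Lemma ultrafilter_extending (I : Type) (B : set (set I)) :
  (exists b, B b) -> (forall a b, B a -> B b -> exists2 c, B c & c `<=` a `&` b) ->
  (forall b, B b -> b !=set0) -> exists2 U : set_system I, UltraFilter U & B `<=` U.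
Proof.
move=> B0 BI Bn0.
have FB : Filter (filter_from B id) by apply: filter_from_filter.
have PB : ProperFilter (filter_from B id) by exact: filter_from_proper.
have [U [UU BU]] := ultraFilterLemma PB.
by exists U => // b Bb; apply: BU; exists b.
Qed.

Lemma ultrafilter_nat : exists2 U : set_system nat, UltraFilter U &
  forall n, U [set k | (n <= k)%N].
Proof.
have [U [UU EU]] := ultraFilterLemma eventually_filter.
by exists U => // n; apply: EU; exists n.
Qed.

(** Each element lies in almost all finite sequences, so that what holds for finite parts passes to
    the whole in an ultraproduct. *)
Lemma ultrafilter_seq (T : eqType) : exists2 U : set_system (seq T), UltraFilter U &
  forall x : T, U [set s : seq T | x \in s].
Proof.
have [| | |U UU BU] := @ultrafilter_extending (seq T)
    [set B | exists s : seq T, B = [set r : seq T | {subset s <= r}]].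
- by exists [set r : seq T | {subset [::] <= r}]; exists [::].
- move=> a b [s ->] [r ->]; exists [set t : seq T | {subset s ++ r <= t}]; first by exists (s ++ r).
  by move=> t srt; split=> x xs; apply: srt; rewrite mem_cat xs ?orbT.
- by move=> b [s ->]; exists s => x.
exists U => // x; apply: (@filterS _ _ _ [set r : seq T | {subset [:: x] <= r}]).
  by move=> s; apply; rewrite inE.
by apply: BU; exists [:: x].
Qed.

Section UltraproductField.
Variables (I : Type) (U : set_system I) (A : Type) (F : I -> fieldType).
Variables (s : forall i, A -> F i -> F i) (E : fieldType) (t : A -> E -> E).
Variable pi : (forall i, F i) -> E.
Hypothesis piP : ultraproduct_spec (L := ring_lang A) U
  (M := fun i => field_structure (@s i)) (P := field_structure t) pi.

Lemma ultra0 : pi (fun=> 0) = 0.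
Proof. by have := ultra_interp piP (f := Zero) (fun=> fun=> 0). Qed.

Lemma ultra1 : pi (fun=> 1) = 1.
Proof. by have := ultra_interp piP (f := One) (fun=> fun=> 0). Qed.

Lemma ultraN f : pi (fun i => - f i) = - pi f.
Proof. by have := ultra_interp piP (f := Opp) (fun=> f). Qed.

Lemma ultraD f g : pi (fun i => f i + g i) = pi f + pi g.
Proof.
by have := ultra_interp piP (f := Add) (fun i : 'I_2 => if val i == 0%N then f else g).
Qed.

Lemma ultraB f g : pi (fun i => f i - g i) = pi f - pi g.
Proof. by rewrite ultraD ultraN. Qed.

Lemma ultraM f g : pi (fun i => f i * g i) = pi f * pi g.
Proof.
by have := ultra_interp piP (f := Mul) (fun i : 'I_2 => if val i == 0%N then f else g).
Qed.

Lemma ultra_eq0 f : pi f = 0 <-> U [set i | f i = 0].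
Proof. by rewrite -ultra0 (ultra_eq piP). Qed.

Lemma ultra_diagonal (K : fieldType) (j : forall i, {rmorphism K -> F i}) :
  exists d : {rmorphism K -> E}, forall x, d x = pi (fun i => j i x).
Proof.
have [|x y|x y|d dE] := @rmorphism_of K E (fun x => pi (fun i => j i x)); last by exists d.
- by rewrite -ultra1; congr pi; apply: functional_extensionality_dep => i; rewrite rmorph1.
- by rewrite -ultraB; congr pi; apply: functional_extensionality_dep => i; rewrite rmorphB.
- by rewrite -ultraM; congr pi; apply: functional_extensionality_dep => i; rewrite rmorphM.
Qed.
End UltraproductField.

Lemma ultraproduct_field (I : Type) (U : set_system I) (A : Type) (F : I -> fieldType)
    (s : forall i, A -> F i -> F i) : UltraFilter U ->
  exists (E : fieldType) (t : A -> E -> E) (pi : (forall i, F i) -> E),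
    ultraproduct_spec (L := ring_lang A) U
      (M := fun i => field_structure (@s i)) (P := field_structure t) pi.
Proof.
move=> UU; have [P [pi piP]] := @ultraproduct_exists (ring_lang A) I U
  (fun i => field_structure (@s i)) (fun i => 0) UU.
have [|E [t Et]] := structure_is_field (M := P).
  move=> p /field_structureP Hp; rewrite /satisfies.
  have -> : @env0 P = fun k => pi (fun i => @env0 _ k) by exact: env0_eq.
  apply/(ultra_los piP); apply: filterS filterT => i _.
  exact: holds_env0 (Hp _ _).
by subst P; exists E, t, pi.
Qed.

(** * Algebraic closures *)

Lemma rmorphism_through (A : comNzRingType) (K L : fieldType) (v : {rmorphism K -> L})
    (i : {rmorphism A -> L}) : (forall a, exists x, v x = i a) ->
  exists j : {rmorphism A -> K}, forall a, v (j a) = i a.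
Proof.
move=> /boolp.choice[f fE].
have [|x y|x y|j jE] := @rmorphism_of A K f; try by apply: (fmorph_inj v).
- by apply: (fmorph_inj v); rewrite fE !rmorph1.
- by apply: (fmorph_inj v); rewrite rmorphB !fE rmorphB.
- by apply: (fmorph_inj v); rewrite rmorphM !fE rmorphM.
by exists j => a; rewrite jE fE.
Qed.

Lemma map_poly_map (A B C : nzRingType) (i : {rmorphism A -> B}) (j : {rmorphism B -> C})
    (k : A -> C) (p : {poly A}) : (forall a, j (i a) = k a) -> (p^^i)^^j = p^^k.
Proof.
move=> jik; have k0 : k 0 = 0 by rewrite -jik !raddf0.
by apply/polyP => n; rewrite !coef_map coef_map_id0 //= jik.
Qed.

Lemma horner_map_eq0 (K L : fieldType) (v : {rmorphism K -> L}) (p : {poly K}) x :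
  (p^^v).[v x] = 0 -> p.[x] = 0.
Proof. by rewrite horner_map => /eqP; rewrite fmorph_eq0 => /eqP. Qed.

Section RelativeClosure.
Variables (A : comNzRingType) (L : fieldType) (i : {rmorphism A -> L}).

Let fraction x := exists a b, i b != 0 /\ x = i a / i b.

Let fraction_field : exists (Q : fieldType) (w : {rmorphism Q -> L}),
  forall x, fraction x <-> exists y, w y = x.
Proof.
apply: subfield_type.
- by exists 1, 1; rewrite rmorph1 oner_eq0 divr1.
- move=> _ _ [a [b [b0 ->]]] [c [d [d0 ->]]]; exists (a * d - c * b), (b * d).
  rewrite rmorphB !rmorphM mulf_neq0 //; split=> //.
  by field; rewrite b0 d0.
- move=> _ _ [a [b [b0 ->]]] [c [d [d0 ->]]]; exists (a * c), (b * d).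
  by rewrite !rmorphM mulf_neq0 //; split=> //; rewrite mulf_div.
move=> _ [a [b [b0 ->]]]; have [a0|a0] := eqVneq (i a) 0.
  by exists 0, 1; rewrite a0 rmorph1 oner_eq0 rmorph0 !mul0r invr0.
by exists b, a; rewrite invf_div.
Qed.

(** Denominators are cleared coefficient by coefficient. Passing to the field [Q] gives access to
    the closure properties of [algebraicOver]. *)
Lemma algebraic_over_fraction (Q : fieldType) (w : {rmorphism Q -> L}) z :
  (forall x, fraction x <-> exists y, w y = x) ->
  algebraic_over i z <-> algebraicOver w z.
Proof.
move=> wE; split=> [[p p0 pz]|[p p0 /rootP pz]].
  have [j jE] : exists j : {rmorphism A -> Q}, forall a, w (j a) = i a.
    by apply: rmorphism_through => a; apply/wE; exists a, 1; rewrite rmorph1 oner_eq0 divr1.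
  exists (p^^j); last by apply/rootP; rewrite (map_poly_map _ jE).
  by apply: contraNneq p0 => pj; rewrite -(map_poly_map _ jE) pj rmorph0.
have [q [d [d0 qE]]] : exists (q : {poly A}) d, i d != 0 /\ q^^i = i d *: p^^w.
  elim/poly_ind: (p) => [|r c [q [d [d0 qE]]]].
    by exists 0, 1; rewrite rmorph1 oner_eq0 !rmorph0 scaler0.
  have [a [b [b0 cE]]] : fraction (w c) by apply/wE; exists c.
  exists (b *: q * 'X + (d * a)%:P), (d * b); rewrite rmorphM mulf_neq0 //; split=> //.
  rewrite !rmorphD !rmorphM /= map_polyZ qE !map_polyX !map_polyC /= cE.
  rewrite scalerDr -!scalerAl scalerA mulrC rmorphM; congr (_ + _).
  by rewrite -[LHS]mulr1 -alg_polyC; rewrite -!mul_polyC -!polyCM; congr (_%:P); rewrite mulr1; field.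
exists q; rewrite qE; last by rewrite hornerZ pz mulr0.
by rewrite scaler_eq0 negb_or d0 map_poly_eq0.
Qed.

(** A root of a polynomial over [K] is algebraic over [A] because the coefficients are. *)
Theorem relative_closure : exists (K : fieldType) (v : {rmorphism K -> L}) (j : {rmorphism A -> K}),
  [/\ forall a, v (j a) = i a, forall x, algebraic_over j x,
      forall z, algebraic_over i z -> exists x, v x = z
    & forall p : {poly K}, p != 0 -> forall z, (p^^v).[z] = 0 -> exists x, v x = z].
Proof.
have [Q [w wE]] := fraction_field.
have algE z := algebraic_over_fraction z wE.
have [K [v vE]] : exists (K : fieldType) (v : {rmorphism K -> L}),
    forall z, algebraic_over i z <-> exists x, v x = z.
  apply: subfield_type => [|x y|x y|x]; rewrite ?algE.
  - exact: algebraic1.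
  - exact: algebraic_sub.
  - exact: algebraic_mul.
  - exact: algebraic_inv.
have [j jE] : exists j : {rmorphism A -> K}, forall a, v (j a) = i a.
  apply: rmorphism_through => a; apply/vE/algE.
  have /wE[b <-] : fraction (i a) by exists a, 1; rewrite rmorph1 oner_eq0 divr1.
  exact: algebraic_id.
exists K, v, j; split=> // [x|z /vE //|p p0 z pz].
  have /vE[p p0 px] : exists y, v y = v x by exists x.
  exists p.
    by apply: contraNneq p0 => pj; rewrite -(map_poly_map _ jE) pj rmorph0.
  by apply: (@horner_map_eq0 _ _ v); rewrite (map_poly_map _ jE).
apply/vE/algE/integral_algebraic; apply: (@integral_root _ _ w (p^^v)).
- by rewrite map_poly_eq0.
- exact/rootP.
move=> c /(nthP 0)[k _ <-]; rewrite coef_map; apply/integral_algebraic/algE/vE.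
by exists p`_k.
Qed.

Theorem relative_closure_closed : alg_closed L ->
  exists (K : fieldType) (v : {rmorphism K -> L}) (j : {rmorphism A -> K}),
  [/\ forall a, v (j a) = i a, forall x, algebraic_over j x,
      forall z, algebraic_over i z -> exists x, v x = z & alg_closed K].
Proof.
move=> acL; have [K [v [j [jE jalg valg vroot]]]] := relative_closure.
exists K, v, j; split=> // p szp; have [->|p0] := eqVneq p 0.
  by exists 0; rewrite horner0.
have [|z pz] := acL (p^^v); first by rewrite size_map_poly.
have [x xz] := vroot p p0 z pz; exists x.
by apply: (@horner_map_eq0 _ _ v); rewrite xz.
Qed.
End RelativeClosure.

Lemma irreducible_divisor (F : fieldType) (p : {poly F}) : (1 < size p)%N ->
  exists2 q, irreducible_poly q & q %| p.
Proof.
move=> szp; pose S n := `[< exists q : {poly F}, [/\ size q = n, (1 < size q)%N & q %| p] >].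
have exS : exists n, S n by exists (size p); apply/asboolP; exists p.
case: (ex_minnP exS) => n /asboolP[q [szq q1 qp]] minq.
have q0 : q != 0 by rewrite -size_poly_gt0 ltnW.
exists q => //; split=> // r r1 rq; rewrite -dvdp_size_eqp //.
rewrite eqn_leq (dvdp_leq q0 rq) szq minq //; apply/asboolP; exists r; split=> //.
  have : r != 0 by apply: contraNneq q0 => r0; move: rq; rewrite r0 dvd0p.
  by rewrite -size_poly_gt0; case: (size r) r1 => [|[|]].
exact: dvdp_trans rq qp.
Qed.

Lemma root_extension (F : fieldType) (p : {poly F}) : (1 < size p)%N ->
  exists (L : fieldType) (i : {rmorphism F -> L}) z, (p^^i).[z] = 0.
Proof.
case/irreducible_divisor => q /irredp_FAdjoin[L _ [z /rootP qz _]] /dvdpP[r ->].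
by exists L, (in_alg L), z; rewrite rmorphM hornerM /= qz mulr0.
Qed.

Definition splits (F : fieldType) (p : {poly F}) :=
  exists s : seq F, p = lead_coef p *: \prod_(a <- s) ('X - a%:P).

Lemma splits_map (F L : fieldType) (i : {rmorphism F -> L}) (p : {poly F}) :
  splits p -> splits (p^^i).
Proof.
case=> s ps; exists [seq i a | a <- s].
rewrite [in LHS]ps map_polyZ rmorph_prod lead_coef_map /= big_map.
by congr (_ *: _); apply: eq_bigr => a _; rewrite rmorphB /= map_polyX map_polyC.
Qed.

Lemma splitting_extension (F : fieldType) (p : {poly F}) :
  exists (L : fieldType) (i : {rmorphism F -> L}), splits (p^^i).
Proof.
move: {2}(size p) (leqnn (size p)) => n; elim: n F p => [|n IHn] F p szp.
  exists F, idfun, [::]; move: szp; rewrite leqn0 size_poly_eq0 => /eqP->.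
  by rewrite rmorph0 lead_coef0 scale0r.
have [sz1|sz1] := leqP (size p) 1.
  exists F, idfun, [::]; rewrite big_nil (size1_polyC sz1) map_polyC /= lead_coefC.
  by rewrite alg_polyC.
have [L [i [z /rootP/factor_theorem[q pq]]]] := root_extension sz1.
have p0 : p^^i != 0 by rewrite -size_poly_gt0 size_map_poly ltnW.
have q0 : q != 0 by apply: contraNneq p0 => q0; rewrite pq q0 mul0r.
have szq : (size q <= n)%N.
  by move: szp; rewrite -(size_map_poly i) pq size_Mmonic ?monicXsubC // size_XsubC addn2.
have [K [j [s qs]]] := IHn L q szq.
exists K, (j \o i), (j z :: s); rewrite -(@map_poly_map _ _ _ i j _ p (fun=> erefl)) pq.
rewrite rmorphM /= lead_coefM rmorphB /= map_polyX map_polyC lead_coefXsubC mulr1.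
by rewrite big_cons {1}qs -scalerAl mulrC.
Qed.

Lemma splitting_extension_seq (F : fieldType) (s : seq {poly F}) :
  exists (L : fieldType) (i : {rmorphism F -> L}), {in s, forall p, splits (p^^i)}.
Proof.
elim: s => [|p s [L [i si]]]; first by exists F, idfun.
have [K [j pj]] := splitting_extension (p^^i).
exists K, (j \o i) => q; rewrite inE -(@map_poly_map _ _ _ i j _ q (fun=> erefl)).
by case/orP => [/eqP->//|/si]; exact: splits_map.
Qed.

(** Finitely many polynomials split in a common extension; the ultraproduct of such extensions over
    all finite sequences splits every polynomial of [F] at once. *)
Lemma splits_all_extension (F : fieldType) :
  exists (E : fieldType) (d : {rmorphism F -> E}), forall p, splits (p^^d).
Proof.
have [U UU Umem] := ultrafilter_seq {poly F}.
have /boolp.choice[L exL] := @splitting_extension_seq F.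
pose i s := projT1 (cid (exL s)); have Li s : {in s, forall p, splits (p^^(i s))} := projT2 (cid (exL s)).
have [E [t [pi piP]]] := @ultraproduct_field _ U unit L (fun s _ x => x) UU.
have [d dE] := ultra_diagonal piP i; exists E, d => p.
have [->|p0] := eqVneq p 0; first by exists [::]; rewrite rmorph0 lead_coef0 scale0r.
(* The number of roots is the same for almost all [s], so that the product has a fixed number of
   factors and commutes with [pi]. *)
pose n := (size p).-1.
have exr : forall s, exists r : nat -> L s,
    p \in s -> p^^(i s) = i s (lead_coef p) *: \prod_(k < n) ('X - (r k)%:P).
  move=> s; have [ps|] := boolP (p \in s); last by exists (fun=> 0).
  have [r pr] := Li s p ps; exists (nth 0 r) => _; rewrite [LHS]pr lead_coef_map.
  have szr : size r = n.
    have := congr1 (fun q : {poly _} => size q) pr.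
    rewrite lead_coef_map size_scale ?fmorph_eq0 ?lead_coef_eq0 // size_prod_XsubC.
    by rewrite size_map_poly /n => ->.
  by congr (_ *: _); rewrite -szr (big_nth 0) big_mkord.
pose r s := projT1 (cid (exr s)).
have rE s : p \in s -> _ = _ := projT2 (cid (exr s)).
have coefE m k : (\prod_(l < m) ('X - (pi (fun s => r s l))%:P))`_k =
    pi (fun s => (\prod_(l < m) ('X - (r s l)%:P))`_k).
  elim: m k => [|m IHm] k.
    rewrite big_ord0 coef1 -(ultra1 piP).
    transitivity (pi (fun s => (k == 0%N)%:R)); last first.
      by congr pi; apply: functional_extensionality_dep => s; rewrite big_ord0 coef1.
    by case: eqP => _; rewrite ?(ultra1 piP) ?(ultra0 piP).
  rewrite big_ord_recr /= mulrBr coefB coefMX coefMC !IHm.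
  transitivity (pi (fun s => (if k == 0%N then 0 else (\prod_(l < m) ('X - (r s l)%:P))`_k.-1)
      - (\prod_(l < m) ('X - (r s l)%:P))`_k * r s m)); last first.
    congr pi; apply: functional_extensionality_dep => s.
    by rewrite big_ord_recr /= mulrBr coefB coefMX coefMC.
  by rewrite (ultraB piP) (ultraM piP); case: eqP; rewrite ?(ultra0 piP).
exists [seq pi (fun s => r s k) | k <- iota 0 n].
have -> : iota 0 n = index_iota 0 n by rewrite /index_iota subn0.
rewrite big_map big_mkord lead_coef_map.
apply/polyP => k; rewrite coefZ coefE coef_map /= !dE -(ultraM piP).
apply/(ultra_eq piP); apply: filterS (Umem p) => s /= /rE/(congr1 (fun q : {poly _} => q`_k)).
by rewrite coef_map coefZ.
Qed.

(** [E] is only known to split polynomials over [F]. But a root of a polynomial over the relative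
    closure [K] is algebraic over [F], hence a root of a polynomial that already splits in [K]. *)
Theorem algebraic_closure (F : fieldType) :
  exists (K : fieldType) (j : {rmorphism F -> K}), alg_closed K.
Proof.
have [E [d splitE]] := splits_all_extension F.
have [K [v [j [jE jalg valg _]]]] := relative_closure d.
exists K, j => p szp; have [->|p0] := eqVneq p 0; first by exists 0; rewrite horner0.
have [|M [m [z pz]]] := @root_extension K p.
  by move: szp p0; rewrite -size_poly_gt0; case: (size p) => [|[|]].
have : algebraicOver (m \o j) z.
  apply/integral_algebraic; apply: (@integral_root _ _ (m \o j) (p^^m)).
  - by rewrite map_poly_eq0.
  - exact/rootP.
  move=> c /(nthP 0)[k _ <-]; rewrite coef_map; apply/integral_algebraic.
  have [q q0 qk] := jalg p`_k; exists q.
    by apply: contraNneq q0 => ->; rewrite rmorph0.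
  by apply/rootP; rewrite -(@map_poly_map _ _ _ j m _ q (fun=> erefl)) horner_map /= qk rmorph0.
case=> f f0 /rootP fz; have [s fs] := splitE f.
have /boolp.choice[r rE] : forall a, exists x, a \in s -> v x = a.
  move=> a; have [as_|] := boolP (a \in s); last by exists 0.
  have [|x xa] := valg a; last by exists x.
  exists f; first by rewrite map_poly_eq0.
  rewrite fs hornerZ; apply/eqP; rewrite mulf_eq0; apply/orP; right.
  by rewrite -rootE root_prod_XsubC.
have fj : f^^j = j (lead_coef f) *: \prod_(a <- s) ('X - (r a)%:P).
  apply: (map_poly_inj v); rewrite (map_poly_map _ jE) fs map_polyZ lead_coef_map jE.
  rewrite rmorph_prod /=; congr (_ *: _); apply: eq_big_seq => a as_.
  by rewrite rmorphB /= map_polyX map_polyC /= rE.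
move: fz; rewrite -(@map_poly_map _ _ _ j m _ f (fun=> erefl)) fj map_polyZ hornerZ rmorph_prod.
rewrite horner_prod => /eqP; rewrite mulf_eq0 !fmorph_eq0 lead_coef_eq0 (negbTE f0) /=.
rewrite prodf_seq_eq0 => /hasP[a _ /=].
rewrite rmorphB /= map_polyX map_polyC hornerXsubC subr_eq0 => /eqP za.
by exists (r a); apply: (@horner_map_eq0 _ _ m); rewrite -za.
Qed.

Lemma alg_closed_splits (F : fieldType) (p : {poly F}) : alg_closed F -> splits p.
Proof.
move=> acF; move: {2}(size p) (leqnn (size p)) => n.
elim: n p => [|n IHn] p szp.
  exists [::]; move: szp; rewrite leqn0 size_poly_eq0 => /eqP->.
  by rewrite lead_coef0 scale0r.
have [/eqP sz1|sz1] := eqVneq (size p) 1%N.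
  exists [::]; rewrite big_nil {2}(size1_polyC (eq_leq (eqP sz1))) lead_coefC alg_polyC.
  by rewrite -size1_polyC // (eqP sz1).
have [->|p0] := eqVneq p 0; first by exists [::]; rewrite lead_coef0 scale0r.
have [z /rootP/factor_theorem[q pq]] := acF p sz1.
have q0 : q != 0 by apply: contraNneq p0 => q0; rewrite pq q0 mul0r.
have [|s qs] := IHn q.
  by move: szp; rewrite pq size_Mmonic ?monicXsubC // size_XsubC addn2.
exists (z :: s); rewrite {1}pq pq lead_coefM lead_coefXsubC mulr1 big_cons.
by rewrite {1}qs -scalerAl mulrC.
Qed.

(** A polynomial over [A] splits in [K], so its roots in [L] are all images of roots in [K]. *)
Lemma algebraic_surjective (A : comNzRingType) (K L : fieldType) (i1 : {rmorphism A -> K})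
    (i2 : {rmorphism A -> L}) (h : {rmorphism K -> L}) :
  alg_closed K -> (forall a, h (i1 a) = i2 a) -> (forall x, algebraic_over i2 x) ->
  forall y, exists x, h x = y.
Proof.
move=> acK hi alg2 y; have [p p0] := alg2 y.
rewrite -(map_poly_map _ hi); have [s ->] := alg_closed_splits (p^^i1) acK.
rewrite map_polyZ hornerZ rmorph_prod horner_prod => /eqP; rewrite mulf_eq0 => /orP[|].
  rewrite fmorph_eq0 lead_coef_eq0 => /eqP pi; case/eqP: p0.
  by rewrite -(map_poly_map _ hi) pi rmorph0.
rewrite prodf_seq_eq0 => /hasP[a _ /=].
by rewrite rmorphB /= map_polyX map_polyC hornerXsubC subr_eq0 => /eqP->; exists a.
Qed.

(** Automorphisms are prescribed through two morphisms from one ring, such as [j] and [j \o s];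
    equality of the kernels makes the map from [i1 a] to [i2 a] well defined and injective. *)
Theorem extend_automorphism (A : comNzRingType) (K : fieldType) (i1 i2 : {rmorphism A -> K}) :
  alg_closed K -> (forall a, i1 a = 0 <-> i2 a = 0) ->
  (forall x, algebraic_over i1 x) -> (forall x, algebraic_over i2 x) ->
  exists h : {rmorphism K -> K}, (forall a, h (i1 a) = i2 a) /\ forall y, exists x, h x = y.
Proof.
move=> acK ker alg1 alg2; have [h hi] := extend_embedding acK ker alg1.
by exists h; split=> //; exact: algebraic_surjective acK hi alg2.
Qed.

Lemma surjective_inverse (F : fieldType) (s : {rmorphism F -> F}) :
  (forall y, exists x, s x = y) ->
  exists t : {rmorphism F -> F}, (forall x, s (t x) = x) /\ forall x, t (s x) = x.
Proof.
move=> sS; have [t st] := @rmorphism_through _ _ _ s idfun sS.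
by exists t; split=> // x; apply: (fmorph_inj s); rewrite st.
Qed.

Theorem difference_closure (F : fieldType) (s : {rmorphism F -> F}) :
  (forall y, exists x, s x = y) ->
  exists (K : fieldType) (j : {rmorphism F -> K}) (t : {rmorphism K -> K}),
  [/\ alg_closed K, forall y, exists x, t x = y & forall x, j (s x) = t (j x)].
Proof.
move=> sS; have [L [i acL]] := algebraic_closure F.
have [K [v [j [_ jalg _ acK]]]] := relative_closure_closed i acL.
have [r [sr rs]] := surjective_inverse sS.
have [|||t [tj tS]] := @extend_automorphism F K j (j \o s) acK.
- by move=> a; split=> [/eqP|/= /eqP]; rewrite !fmorph_eq0 => /eqP-> /=; rewrite !rmorph0.
- exact: jalg.
- move=> x; have [p p0 px] := jalg x.
  have E : (p^^r)^^(j \o s) = p^^j by apply: map_poly_map => a /=; rewrite sr.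
  by exists (p^^r); rewrite E.
by exists K, j, t; split=> // x; rewrite tj.
Qed.

(** * Algebraic closedness as a first-order property *)

Section RootFormula.
Variables (A : Type) (n : nat).
Local Notation term := (term (ring_lang A) n.+1).

Definition tpow (t : term) k : term := iter k (tmul t) tone.
Definition tsum (I : Type) (r : seq I) (t : I -> term) : term :=
  foldr (fun i u => tadd (t i) u) tzero r.

(** One formula for each degree, the lower coefficients of a monic polynomial being free variables:
    this transfers algebraic closedness along elementary maps and ultraproducts. *)
Definition root_formula : formula (ring_lang A) n :=
  Ex (Eq (tadd (tpow (Var ord0) n)
    (tsum (enum 'I_n) (fun i => tmul (Var (lift ord0 i)) (tpow (Var ord0) i)))) tzero).

Variables (F : fieldType) (s : A -> F -> F).
Local Notation M := (field_structure s).

Lemma eval_tpow (e : 'I_n.+1 -> M) t k : eval e (tpow t k) = (eval e t : F) ^+ k.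
Proof.
elim: k => [|k IHk]; first by rewrite expr0; exact: (eval_one e).
by rewrite exprS -IHk -opE -eval_mul.
Qed.

Lemma eval_tsum (I : Type) (e : 'I_n.+1 -> M) (r : seq I) t :
  eval e (tsum r t) = \sum_(i <- r) (eval e (t i) : F).
Proof.
elim: r => [|i r IHr]; first by rewrite big_nil; exact: (eval_zero e).
by rewrite big_cons -IHr -addE -eval_add.
Qed.

Lemma root_formulaP (e : 'I_n -> M) :
  holds e root_formula <-> exists x : F, x ^+ n + \sum_(i < n) (e i : F) * x ^+ i = 0.
Proof.
have E x : (holds (env_cons x e) (Eq (tadd (tpow (Var ord0) n)
    (tsum (enum 'I_n) (fun i => tmul (Var (lift ord0 i)) (tpow (Var ord0) i)))) tzero)) =
    (x ^+ n + \sum_(i < n) (e i : F) * x ^+ i = 0).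
  rewrite holds_Eq eval_zero eval_add !opE eval_tpow eval_tsum big_enum -[eval _ (Var ord0)]/(env_cons x e ord0).
  have -> : env_cons x e ord0 = x by rewrite /env_cons unlift_none.
  congr (_ + _ = _); apply: eq_bigr => i _; cbv beta; rewrite eval_mul opE eval_tpow /=.
  have -> : env_cons x e ord0 = x by rewrite /env_cons unlift_none.
  by rewrite /env_cons liftK.
by rewrite /root_formula holds_Ex; split=> -[x]; [rewrite E|rewrite -E]; exists x.
Qed.
End RootFormula.

Lemma alg_closedP (F : fieldType) : alg_closed F <->
  forall n (e : 'I_n -> F), (0 < n)%N -> exists x, x ^+ n + \sum_(i < n) e i * x ^+ i = 0.
Proof.
split=> [acF n e n0|rt p szp].
  pose p := 'X^n + \poly_(i < n) (if insub i is Some k then e k else 0).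
  have szp : size p = n.+1 by rewrite size_polyDl size_polyXn // ltnS size_poly.
  have [|x px] := acF p; first by rewrite szp; case: (n) n0.
  exists x; rewrite -[RHS]px hornerD hornerXn horner_poly; congr (_ + _).
  by apply: eq_bigr => i _; rewrite valK.
case szn : (size p) szp => [|[//|n]] _.
  by exists 0; move/eqP: szn; rewrite size_poly_eq0 => /eqP->; rewrite horner0.
have lp : lead_coef p != 0 by rewrite lead_coef_eq0 -size_poly_eq0 szn.
have [//|x px] := rt n.+1 (fun i => p`_i / lead_coef p); exists x.
apply: (mulIf (invr_neq0 lp)); rewrite mul0r -[RHS]px horner_coef szn big_ord_recr /=.
rewrite mulrDl addrC mulrAC [X in X * _](_ : _ = 1) ?mul1r.
  by congr (_ + _); rewrite mulr_suml; apply: eq_bigr => i _; rewrite mulrAC.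
by rewrite -(divff lp) [in RHS]lead_coefE szn /= lead_coefE szn.
Qed.

(** * Models of ACFA *)

Section Preservation.
Variable L : language.

Lemma embedding_comp (M N P : structure L) (h : M -> N) (g : N -> P) :
  embedding h -> embedding g -> embedding (g \o h).
Proof.
by case=> hi hf [gi gf]; split=> [|f x]; [exact: inj_comp | rewrite /= hf gf].
Qed.

Lemma env_cons_comp (T T' : Type) (h : T -> T') n (e : 'I_n -> T) x :
  h \o env_cons x e = env_cons (h x) (h \o e).
Proof. by apply: funext => i; rewrite /env_cons /=; case: (unlift _ _). Qed.

Inductive quantifier_free n : formula L n -> Prop :=
| qf_Bot : quantifier_free Bot
| qf_Eq s t : quantifier_free (Eq s t)
| qf_Imp p q : quantifier_free p -> quantifier_free q -> quantifier_free (Imp p q).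

(** [ex_Imp] is there for the axiom on inverses, where the existential follows the premise that the
    element is not 0. *)
Inductive existential : forall n, formula L n -> Prop :=
| ex_qf n (p : formula L n) : quantifier_free p -> existential p
| ex_Imp n (p q : formula L n) : quantifier_free p -> existential q -> existential (Imp p q)
| ex_Ex n (p : formula L n.+1) : existential p -> existential (Ex p).

Inductive forall_existential : forall n, formula L n -> Prop :=
| fe_ex n (p : formula L n) : existential p -> forall_existential p
| fe_All n (p : formula L n.+1) : forall_existential p -> forall_existential (All p).

Section Embedding.
Variables (M N : structure L) (h : M -> N).
Hypothesis hP : embedding h.

Lemma embedding_eval n (e : 'I_n -> M) t : h (eval e t) = eval (h \o e) t.
Proof.
by elim: t => //= f x IH; rewrite hP.2; congr (interp _); exact: funext.
Qed.

Lemma quantifier_free_embedding n (p : formula L n) (e : 'I_n -> M) :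
  quantifier_free p -> holds e p <-> holds (h \o e) p.
Proof.
elim=> {p} [|s t|p q _ [IHp IHp'] _ [IHq IHq']] //=.
  by rewrite -!embedding_eval; split=> [->//|/hP.1].
by split=> H /=; [move=> /IHp'/H/IHq | move=> /IHp/H/IHq'].
Qed.

Lemma existential_embedding n (p : formula L n) (e : 'I_n -> M) :
  existential p -> holds e p -> holds (h \o e) p.
Proof.
move=> exp; elim: exp e => {n p} [n p qp|n p q qp _ IHq|n p _ IHp] e.
- by move/(quantifier_free_embedding e qp).
- by rewrite !holds_Imp => pq /(quantifier_free_embedding e qp)/pq/IHq.
by rewrite !holds_Ex => -[x /IHp]; rewrite env_cons_comp => H; exists (h x).
Qed.
End Embedding.

(** The universal variables take values in [M]; witnesses found in [N] persist in [P] and come back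
    to [M] by elementarity. *)
Lemma forall_existential_descent (M N P : structure L) (h : M -> N) (g : N -> P) n
    (p : formula L n) (e : 'I_n -> M) : embedding g -> elementary (g \o h) ->
  forall_existential p -> holds (h \o e) p -> holds e p.
Proof.
move=> gP ghP fep; elim: fep e => {n p} [n p exp|n p _ IHp] e.
  by move/(existential_embedding gP exp)/ghP.
by rewrite !holds_AllE => Hp x; apply: IHp; rewrite env_cons_comp.
Qed.
End Preservation.

Lemma holds_env0_comp L (M N : structure L) (h : M -> N) (p : sentence L) :
  holds (h \o @env0 M) p <-> satisfies N p.
Proof. by rewrite /satisfies; split; apply: holds_env0. Qed.

Definition diff_structure (F : fieldType) (s : F -> F) : structure diff_lang :=
  field_structure (fun _ : unit => s).

Lemma diff_structureP (F : fieldType) (s : F -> F) :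
  model difference_field (diff_structure s) <-> is_aut s.
Proof.
rewrite -(aut_axiomP (fun=> s) tt); split=> [H p ax|H p [ax|ax]].
- by apply: H; right.
- exact: field_structureP.
- exact: H.
Qed.

Lemma diff_structure_of (M : structure diff_lang) : model difference_field M ->
  exists (F : fieldType) (s : F -> F), is_aut s /\ M = diff_structure s.
Proof.
move=> HM; have [|F [s Ms]] := structure_is_field (M := M).
  by move=> p ax; apply: HM; left.
subst M; have E : field_structure s = diff_structure (s tt).
  by rewrite /diff_structure; congr field_structure; apply: funext => -[].
by exists F, (s tt); split=> //; apply/diff_structureP; rewrite -E.
Qed.

Lemma difference_field_fe (p : sentence diff_lang) :
  difference_field p -> forall_existential p.
Proof.
have qf n (q : formula diff_lang n) : quantifier_free q -> forall_existential q.
  by move=> ?; exact/fe_ex/ex_qf.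
case; case; do ?[apply: fe_All]; try by apply: qf; do ?constructor.
- by apply/fe_ex/ex_Imp; [do ?constructor | apply/ex_Ex/ex_qf; constructor].
- by apply/fe_ex/ex_Ex/ex_qf; constructor.
Qed.

Section ACFA.
Variables (ACFA : theory diff_lang).
Hypothesis ACFA_companion : is_ACFA ACFA.

(** By definition a model only embeds into a difference field, which in turn embeds into another
    model. The composite is elementary, so the axioms, being of forall-exists form, descend. *)
Lemma ACFA_difference_field M : model ACFA M -> model difference_field M.
Proof.
move=> HM; have [mc toA ofA] := ACFA_companion.
have [N HN [h hP]] := ofA M HM; have [P HP [g gP]] := toA N HN.
move=> p ax; rewrite /satisfies.
apply: (forall_existential_descent (h := h) gP) (difference_field_fe ax) _.
  exact: mc (embedding_comp hP gP).
exact/holds_env0_comp/HN.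
Qed.

Lemma ACFA_extension (F : fieldType) (s : F -> F) : is_aut s ->
  exists (K : fieldType) (t : K -> K) (j : {rmorphism F -> K}),
  [/\ is_aut t, model ACFA (diff_structure t) & forall x, j (s x) = t (j x)].
Proof.
move=> /diff_structureP/(let: And3 _ toA _ := ACFA_companion in toA)[P HP [h hP]].
have [K [t [tA PE]]] := diff_structure_of (ACFA_difference_field HP).
subst P; have [g _ gs] := embedding_rmorphism hP.
by exists K, t, g; split=> // x; exact: gs tt x.
Qed.

Lemma ACFA_elementary (F K : fieldType) (s : F -> F) (t : K -> K) (j : {rmorphism F -> K}) :
  model ACFA (diff_structure s) -> model ACFA (diff_structure t) ->
  (forall x, j (s x) = t (j x)) ->
  @elementary _ (diff_structure s) (diff_structure t) j.
Proof.
move=> Hs Ht js; have [mc _ _] := ACFA_companion.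
by apply: mc => //; apply: structure_embedding => _.
Qed.

(** The model lies in an algebraically closed difference field, itself inside a larger model; the
    roots found there come back by elementarity. *)
Lemma ACFA_alg_closed (F : fieldType) (s : F -> F) :
  model ACFA (diff_structure s) -> alg_closed F.
Proof.
move=> Hs; have sA := (diff_structureP s).1 (ACFA_difference_field Hs).
have [g gs _] := is_aut_morph sA.
have gS y : exists x, g x = y by have [_ _ _ /(_ y)[x <-]] := sA; exists x.
have [K [j [t [acK tS jt]]]] := difference_closure gS.
have [L [u [i [uA Hu iu]]]] := ACFA_extension (rmorph_is_aut tS).
have el := @ACFA_elementary F L s u (i \o j) Hs Hu.
apply/alg_closedP => n e n0.
apply/(root_formulaP (s := fun _ : unit => s) e); apply/el.
  by move=> x /=; rewrite -gs jt iu.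
apply/(root_formulaP (s := fun _ : unit => u)).
have [x xr] := (alg_closedP K).1 acK n (j \o e) n0; exists (i x).
rewrite -[RHS](rmorph0 i) -xr rmorphD rmorphXn rmorph_sum; congr (_ + _).
by apply: eq_bigr => k _; rewrite rmorphM rmorphXn.
Qed.

End ACFA.

(** * Amalgamation of difference fields *)

Lemma ultraproduct_alg_closed (I : Type) (U : set_system I) (A : Type) (F : I -> fieldType)
    (s : forall i, A -> F i -> F i) (E : fieldType) (t : A -> E -> E) (pi : (forall i, F i) -> E) :
  UltraFilter U ->
  ultraproduct_spec (L := ring_lang A) U
    (M := fun i => field_structure (@s i)) (P := field_structure t) pi ->
  (forall i, alg_closed (F i)) -> alg_closed E.
Proof.
move=> UU piP acF; apply/alg_closedP => n e n0; apply/(root_formulaP (s := t) e).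
have [x xe] := boolp.choice (fun k => ultra_surj piP (e k)).
rewrite (_ : e = fun k => pi (x k)); last by apply: funext => k; rewrite xe.
apply/(ultra_los piP); apply: filterS filterT => i _.
by apply/(root_formulaP (s := @s i)); exact: (alg_closedP (F i)).1.
Qed.

Section Tensor.
Variables (A B B' : fieldType) (f : {rmorphism A -> B}) (g : {rmorphism A -> B'}).
Hypothesis acA : alg_closed A.

(** [E] will be an ultrapower of [B], [d] the diagonal, and [h] the class of the finite
    specializations [hs s] of [B'] to [A], followed by [f]. This is a substitute for a free
    compositum of [B] and [B'] over [A]. *)
Record independent_embeddings (E : fieldType) (d : {rmorphism B -> E}) (h : {rmorphism B' -> E})
    (U : set_system (seq B')) (hs : seq B' -> B' -> A) : Prop := {
  indep_agree : forall a, d (f a) = h (g a);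
  indep_spec : forall s a, hs s (g a) = a;
  indep_eq0 : forall y, h y = 0 -> y = 0;
  indep_sum : forall n (b : 'I_n -> B) (b' : 'I_n -> B'),
    \sum_(i < n) d (b i) * h (b' i) = 0 ->
    U [set s : seq B' | \sum_(i < n) b i * f (hs s (b' i)) = 0];
  indep_zero : forall y, U [set s : seq B' | hs s y = 0] -> y = 0 }.

Lemma independent_embeddings_exist : alg_closed B ->
  exists (E : fieldType) (d : {rmorphism B -> E}) (h : {rmorphism B' -> E}) U hs,
    [/\ alg_closed E, UltraFilter U & independent_embeddings d h U hs].
Proof.
move=> acB; have [U UU Umem] := ultrafilter_seq B'.
have [hs hsP] := boolp.choice (fun s => finite_specialization g s acA).
have [E [t [pi piP]]] := @ultraproduct_field _ U unit (fun=> B) (fun s _ x => x) UU.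
have [d dE] := ultra_diagonal piP (fun=> idfun).
have [|x y|x y|h hE] := @rmorphism_of B' E (fun y => pi (fun s => f (hs s y))).
- rewrite -(ultra1 piP); congr pi; apply: funext => s; have [hg _ _] := hsP s.
  by rewrite -(rmorph1 g) hg rmorph1.
- rewrite -(ultraB piP); apply/(ultra_eq piP); apply: filterS2 (Umem x) (Umem y) => s /= sx sy.
  by have [_ hB _] := hsP s; rewrite hB // rmorphB.
- rewrite -(ultraM piP); apply/(ultra_eq piP); apply: filterS2 (Umem x) (Umem y) => s /= sx sy.
  by have [_ _ hM] := hsP s; rewrite hM // rmorphM.
have eq0 y : U [set s : seq B' | hs s y = 0] -> y = 0.
  move=> Uy; apply/eqP; rewrite -(fmorph_eq0 h) hE; apply/eqP/(ultra_eq0 piP).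
  by apply: filterS Uy => s /= ->; rewrite rmorph0.
exists E, d, h, U, hs; split=> //; first exact: ultraproduct_alg_closed piP (fun=> acB).
split=> // [a|s a|y|n b b' sum0].
- by rewrite dE hE; congr pi; apply: funext => s; have [-> _ _] := hsP s.
- by have [] := hsP s.
- by move/eqP; rewrite fmorph_eq0 => /eqP.
have E1 : pi (fun s => \sum_(i < n) b i * f (hs s (b' i))) = 0.
  rewrite -[RHS]sum0; elim: n b b' {sum0} => [|n IHn] b b'.
    rewrite big_ord0 -(ultra0 piP); congr pi; apply: funext => s; exact: big_ord0.
  rewrite big_ord_recl -(IHn (b \o lift ord0) (b' \o lift ord0)) dE hE.
  rewrite -(ultraM piP) -(ultraD piP); congr pi; apply: funext => s.
  by rewrite big_ord_recl.
exact/(ultra_eq0 piP).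
Qed.

Section Transport.
Variables (E : fieldType) (d : {rmorphism B -> E}) (h : {rmorphism B' -> E}).
Variables (U : set_system (seq B')) (hs : seq B' -> B' -> A).
Context {UU : UltraFilter U}.
Hypothesis indep : independent_embeddings d h U hs.
Variables (al : {rmorphism A -> A}) (be : {rmorphism B -> B}) (be' : {rmorphism B' -> B'}).
Hypotheses (f_al : forall a, f (al a) = be (f a)) (g_al : forall a, g (al a) = be' (g a)).

(* Elements of B that are linearly independent over A stay so over h(B'),
   so a relation comes from linear relations over A, which are transported. *)
Lemma transport_relation n (b : 'I_n -> B) (b' : 'I_n -> B') :
  \sum_(i < n) d (b i) * h (b' i) = 0 ->
  \sum_(i < n) d (be (b i)) * h (be' (b' i)) = 0.
Proof.
move: {2}#|_| (leqnn #|[pred i | b' i != 0]|) => m.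
elim: m b' => [|m IHm] b' supp sum0.
  apply: big1 => i _; suff -> : b' i = 0 by rewrite !rmorph0 mulr0.
  apply: contraTeq supp => bi; rewrite -ltnNge; apply/card_gt0P; by exists i.
(* A dependency over [A] supported where [b'] is nonzero allows [b' j] to be eliminated, which
   shrinks the support. *)
have [[c [c_supp c_sum [j cj]]]|nodep] := pselect (exists c : 'I_n -> A,
    [/\ forall i, b' i = 0 -> c i = 0, \sum_(i < n) b i * f (c i) = 0 & exists j, c j != 0]).
  pose e i := c i / c j; pose b2 i := b' i - g (e i) * b' j.
  have esum : \sum_(i < n) b i * f (e i) = 0.
    under eq_bigr do rewrite fmorph_div mulrA.
    by rewrite -mulr_suml c_sum mul0r.
  have sum2 : \sum_(i < n) d (b i) * h (b2 i) = 0.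
    under eq_bigr do rewrite rmorphB rmorphM mulrBr mulrA -(indep_agree indep) -rmorphM.
    by rewrite sumrB -mulr_suml -rmorph_sum esum rmorph0 mul0r subr0.
  have := IHm b2 _ sum2; under eq_bigr do
    rewrite /b2 rmorphB [be' (_ * _)]rmorphM -g_al rmorphB rmorphM mulrBr mulrA
      -(indep_agree indep) f_al -!rmorphM.
  rewrite sumrB -mulr_suml -!rmorph_sum esum !rmorph0 mul0r subr0; apply.
  rewrite -ltnS; apply: leq_trans supp; apply: proper_card.
  apply/properP; split.
    apply/fintype.subsetP => i; rewrite !inE /b2 /e; apply: contraNneq => bi.
    by rewrite bi (c_supp i bi) mul0r rmorph0 mul0r subr0.
  exists j; rewrite !inE; first by apply: contraNneq cj => /c_supp->.
  by rewrite negbK /b2 /e divff // rmorph1 mul1r subrr.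
apply: big1 => i _; suff -> : b' i = 0 by rewrite !rmorph0 mulr0.
(* Almost every specialization of the relation would be such a dependency if [b' i] did not
   specialize to 0. *)
apply: (indep_zero indep); apply: filterS (indep_sum indep sum0) => s /= sum_s.
apply/eqP/negP => /negP hi; apply: nodep; exists (fun k => hs s (b' k)).
split=> //; last by exists i.
by move=> k ->; rewrite -(rmorph0 g) (indep_spec indep).
Qed.

Definition tensor (l : seq (B * B')) : E := \sum_(z <- l) d z.1 * h z.2.
Definition tensor_map (l : seq (B * B')) := [seq (be z.1, be' z.2) | z <- l].

Lemma tensor_map_eq0 l : tensor l = 0 -> tensor (tensor_map l) = 0.
Proof.
rewrite /tensor big_map [X in X = 0 -> _]big_tnth [X in _ -> X = 0]big_tnth.
exact: (@transport_relation _ (fun i => (tnth (in_tuple l) i).1)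
  (fun i => (tnth (in_tuple l) i).2)).
Qed.
End Transport.
End Tensor.

(** The subring of [E] generated by [B] and [B'] has an automorphism induced by [sB] and [sB'], well
    defined by [tensor_map_eq0] applied to it and to its inverse. It is encoded by the ring [K] of
    pairs (element, image) and extended to the relative algebraic closure [C]. *)
Theorem amalgamation (A B B' : fieldType) (sA : {rmorphism A -> A}) (sB : {rmorphism B -> B})
    (sB' : {rmorphism B' -> B'}) (f : {rmorphism A -> B}) (g : {rmorphism A -> B'}) :
  alg_closed A -> alg_closed B ->
  (forall y, exists x, sA x = y) -> (forall y, exists x, sB x = y) ->
  (forall y, exists x, sB' x = y) ->
  (forall a, f (sA a) = sB (f a)) -> (forall a, g (sA a) = sB' (g a)) ->
  exists (C : fieldType) (t : {rmorphism C -> C}) (d : {rmorphism B -> C})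
    (h : {rmorphism B' -> C}),
  [/\ forall y, exists x, t x = y, forall b, d (sB b) = t (d b),
      forall b, h (sB' b) = t (h b) & forall a, d (f a) = h (g a)].
Proof.
move=> acA acB sAS sBS sBS' fs gs.
have [E [d [h [U [hs [acE UU indep]]]]]] := independent_embeddings_exist f g acA acB.
have [tA [stA tsA]] := surjective_inverse sAS.
have [tB [stB tsB]] := surjective_inverse sBS.
have [tB' [stB' tsB']] := surjective_inverse sBS'.
have ft a : f (tA a) = tB (f a) by apply: (fmorph_inj sB); rewrite -fs stA stB.
have gt a : g (tA a) = tB' (g a) by apply: (fmorph_inj sB'); rewrite -gs stA stB'.
pose val := tensor d h; pose sl := tensor_map sB sB'; pose tl := tensor_map tB tB'.
have stl l : sl (tl l) = l.
  by rewrite /sl /tl /tensor_map -map_comp map_id_in // => -[b b'] _ /=; rewrite stB stB'.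
have tsl l : tl (sl l) = l.
  by rewrite /sl /tl /tensor_map -map_comp map_id_in // => -[b b'] _ /=; rewrite tsB tsB'.
have val0 l : val l = 0 <-> val (sl l) = 0.
  split; first exact: (tensor_map_eq0 indep fs gs).
  by move/(tensor_map_eq0 indep ft gt); rewrite -/tl tsl.
have [K [i [iinj iK]]] : exists (K : comNzRingType) (i : {rmorphism K -> (E * E)%type}),
    injective i /\ forall z, (exists l, z = (val l, val (sl l))) <-> exists k, i k = z.
  apply: subring_type.
  - exists [:: (1, 1)]; rewrite /val /sl /tensor /tensor_map /= !big_seq1 /=.
    by rewrite !rmorph1 mulr1.
  - move=> _ _ [l ->] [r ->]; exists (l ++ [seq (- z.1, z.2) | z <- r]).
    rewrite /val /sl /tensor /tensor_map map_cat !big_cat /= !big_map /=.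
    by congr pair; rewrite /= -sumrN; congr (_ + _); apply: eq_bigr => z _; rewrite !rmorphN mulNr.
  move=> _ _ [l ->] [r ->]; exists [seq (z.1 * w.1, z.2 * w.2) | z <- l, w <- r].
  rewrite /val /sl /tensor /tensor_map !big_map !big_allpairs_dep /=.
  congr pair; rewrite /= mulr_suml; apply: eq_bigr => z _; rewrite mulr_sumr;
    by apply: eq_bigr => w _; rewrite !rmorphM mulrACA.
pose i1 : {rmorphism K -> E} := fst \o i; pose i2 : {rmorphism K -> E} := snd \o i.
have i1i2 k : exists k', i2 k = i1 k'.
  have [l il] := (iK (i k)).2 (ex_intro _ k erefl).
  have [k' ik'] := (iK _).1 (ex_intro _ (sl l) erefl).
  by exists k'; rewrite /i1 /i2 /= il ik'.
have i2i1 k : exists k', i2 k' = i1 k.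
  have [l il] := (iK (i k)).2 (ex_intro _ k erefl).
  have [k' ik'] := (iK _).1 (ex_intro _ (tl l) erefl).
  by exists k'; rewrite /i1 /i2 /= il ik' /= stl.
have ker k : i1 k = 0 <-> i2 k = 0.
  by have [l il] := (iK (i k)).2 (ex_intro _ k erefl); rewrite /i1 /i2 /= il; exact: val0.
have [C [v [j [vj jalg valg acC]]]] := relative_closure_closed i1 acE.
have [|j2 vj2] := @rmorphism_through _ _ _ v i2.
  by move=> k; have [k' ->] := i1i2 k; exists (j k'); rewrite vj.
have [|||t [tj tS]] := @extend_automorphism K C j j2 acC.
- move=> k; split=> /eqP; rewrite -(fmorph_eq0 v).
    by rewrite vj => /eqP/ker/eqP; rewrite -vj2 fmorph_eq0 => /eqP.
  by rewrite vj2 => /eqP/ker/eqP; rewrite -vj fmorph_eq0 => /eqP.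
- exact: jalg.
- move=> x; have [p p0 px] := jalg x.
  have [c cE] : {c : K -> K & forall k, j2 (c k) = j k}.
    apply: (@boolp.choice K K (fun k k' => j2 k' = j k)) => k; have [k' E'] := i2i1 k.
    by exists k'; apply: (fmorph_inj v); rewrite vj vj2.
  have E1 : (\poly_(n < size p) c p`_n)^^j2 = p^^j.
    apply/polyP => n; rewrite !coef_map coef_poly; case: ltnP => [_|len]; first exact: cE.
    by rewrite [p`_n](nth_default _ len) !raddf0.
  by exists (\poly_(n < size p) c p`_n); rewrite E1.
have liftC (X : fieldType) (e : {rmorphism X -> E}) (s : X -> X) :
    (forall x, exists k, i k = (e x, e (s x))) ->
    exists e' : {rmorphism X -> C}, (forall x, v (e' x) = e x) /\ forall x, e' (s x) = t (e' x).
  move=> ek; have [|e' ve'] := @rmorphism_through _ _ _ v e.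
    by move=> x; have [k ik] := ek x; exists (j k); rewrite vj /i1 /= ik.
  exists e'; split=> // x; have [k ik] := ek x.
  have -> : e' x = j k by apply: (fmorph_inj v); rewrite ve' vj /i1 /= ik.
  by apply: (fmorph_inj v); rewrite tj ve' vj2 /i2 /= ik.
have [|d' [vd d's]] := liftC B d sB.
  move=> b; apply/iK; exists [:: (b, 1)]; rewrite /val /sl /tensor /tensor_map /= !big_seq1 /=.
  by rewrite !rmorph1 !mulr1.
have [|h' [vh h's]] := liftC B' h sB'.
  move=> b; apply/iK; exists [:: (1, b)]; rewrite /val /sl /tensor /tensor_map /= !big_seq1 /=.
  by rewrite !rmorph1 !mul1r.
exists C, t, d', h'; split=> // a.
by apply: (fmorph_inj v); rewrite vd vh (indep_agree indep).
Qed.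

(** * Commuting automorphisms of models of ACFA *)

Lemma elementary_embedding L (M N : structure L) (h : M -> N) : elementary h -> embedding h.
Proof.
move=> hE; split=> [x y hxy|f x].
  pose e (i : 'I_2) := if val i == 0%N then x else y.
  by apply: ((hE 2%N (Eq (Var ord0) (Var ord_max)) e).2 hxy).
have /hE : holds (env_cons (interp x) x) (Eq (Var ord0) (App f (fun i => Var (lift ord0 i)))).
  rewrite /= {1}/env_cons unlift_none; congr (interp _); apply: funext => i.
  by rewrite /env_cons liftK.
rewrite env_cons_comp /= {1}/env_cons unlift_none => ->; congr (interp _).
by apply: funext => i; rewrite /env_cons liftK.
Qed.

(** Quantifying over the chain lets the induction on [m] shift it; below [m] the values are the
    defaults [d]. *)
Lemma coherent_from (N : nat -> Type) (k : forall n, N n -> N n.+1) (d : forall n, N n) m (x : N m) :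
  exists2 f : forall n, N n, f m = x & forall n, (m <= n)%N -> f n.+1 = k n (f n).
Proof.
elim: m N k d x => [|m IHm] N k d x.
  by exists (fix f n := if n is n'.+1 return N n then k n' (f n') else x).
have [f fm fS] := IHm (fun n => N n.+1) (fun n => k n.+1) (fun n => d n.+1) x.
by exists (fun n => if n is n'.+1 return N n then f n' else d 0%N) => // -[|n] //; exact: fS.
Qed.

Lemma eventually_forall j (P : 'I_j -> set nat) :
  (forall i, \oo (P i)) -> \oo [set n | forall i, P i n].
Proof. by move=> FP; have := filter_forall eventually_filter FP. Qed.

Section Colimit.
Variables (L : language) (N : nat -> structure L) (k : forall n, N n -> N n.+1).
Hypothesis kE : forall n, elementary (@k n).

Definition coherent n (f : forall n, N n) := forall m, (n <= m)%N -> f m.+1 = k (f m).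

Lemma coherent_holds n m j (p : formula L j) (x : 'I_j -> forall n, N n) :
  (forall i, coherent n (x i)) -> (n <= m)%N ->
  holds (fun i => x i n) p <-> holds (fun i => x i m) p.
Proof.
move=> xc; elim: m => [|m IHm]; first by rewrite leqn0 => /eqP->.
rewrite leq_eqVlt => /orP[/eqP->//|]; rewrite ltnS => nm; rewrite (IHm nm) (@kE m).
by rewrite (_ : k (n := m) \o _ = fun i => x i m.+1) //; apply: funext => i; rewrite xc.
Qed.

Lemma eventually_coherent (f : forall n, N n) : (exists n, coherent n f) ->
  \oo [set n | coherent n f].
Proof.
move=> [n fc]; exists n => // m /= nm l ml; apply: fc; exact: leq_trans ml.
Qed.

Lemma eventually_holds j (p : formula L j) (x : 'I_j -> forall n, N n) n :
  (forall i, coherent n (x i)) ->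
  \oo [set m | holds (fun i => x i m) p] <-> holds (fun i => x i n) p.
Proof.
move=> xc; split=> [[m _ mp]|np].
  apply/(@coherent_holds n (maxn m n)) => //; first exact: leq_maxr.
  exact/mp/leq_maxl.
by exists n => // m /= nm; apply/(coherent_holds p xc nm).
Qed.

(** A reduced product over the Frechet filter, restricted to eventually coherent families: along
    these the truth of a formula is eventually constant, the maps being elementary, and this is what
    [los] asks for. *)
Theorem colimit (x0 : N 0%N) : exists (C : structure L) (c : forall n, N n -> C),
  [/\ forall n, elementary (@c n), forall n x, c n.+1 (k x) = c n x
    & forall y, exists n x, c n x = y].
Proof.
pose d0 := fix f n := if n is n'.+1 return N n then k (f n') else x0.
pose D : set (forall n, N n) := [set f | exists n, coherent n f].
have D_fin j (x : 'I_j -> forall n, N n) : (forall i, D (x i)) ->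
    exists n, forall i, coherent n (x i).
  move=> Dx; have /filter_ex[n] : \oo [set n | forall i, coherent n (x i)].
    apply: (eventually_forall (P := fun i => [set n | coherent n (x i)])) => i.
    by apply: eventually_coherent; exact: Dx.
  by exists n.
have D0 : D d0 by exists 0%N.
have D_interp (f : L) (x : 'I_(arity f) -> forall n, N n) :
    (forall i, D (x i)) -> D (fun n => interp (fun i => x i n)).
  move=> /D_fin[n xc]; exists n => m nm.
  rewrite (elementary_embedding (@kE m)).2; congr (interp _); apply: funext => i.
  exact: xc.
pose C := @reduced_product L nat N \oo eventually_filter D d0 D0.
pose pi := @pi_germ L nat N \oo eventually_filter D d0 D0.
have C_los j (p : formula L j) (e : 'I_j -> C) :
    holds e p <-> \oo [set n | holds (fun i => repr (e i) n) p].
  apply: (los D_interp) => {j p e} j p e; have [n ec] := D_fin _ _ (fun i => reprD (e i)).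
    have [np|np] := pselect (holds (fun i => repr (e i) n) p).
      by left; apply/eventually_holds.
    by right; apply/(eventually_holds (Not p) ec).
  move=> [m _ mp]; have [x xp] := mp (maxn m n) (leq_maxl _ _).
  have [f fm fc] := coherent_from k d0 x.
  exists f; first by exists (maxn m n).
  exists (maxn m n) => // l /= ml.
  pose y i := env_cons f (fun i => repr (e i)) i.
  have yE l' : (fun i => y i l') = env_cons (f l') (fun i => repr (e i) l').
    by apply: funext => i; rewrite /y /env_cons; case: (unlift _ _).
  rewrite -yE; apply/(@coherent_holds (maxn m n)) => //.
    move=> i; rewrite /y /env_cons; case: (unlift _ _) => [i'|]; last exact: fc.
    by move=> l' ml'; apply: ec; apply: leq_trans ml'; exact: leq_maxr.
  by rewrite yE fm.
pose ext n (x : N n) := projT1 (cid2 (coherent_from k d0 x)).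
have ext_at n (x : N n) : ext n x n = x by rewrite /ext; case: cid2.
have ext_coh n (x : N n) : coherent n (ext n x) by rewrite /ext; case: cid2.
have extD n (x : N n) : D (ext n x) by exists n.
exists C, (fun n x => pi (ext n x)); split.
- move=> n j p e; have := eventually_holds p (fun i => ext_coh n (e i)).
  rewrite (_ : (fun i => ext n (e i) n) = e); last exact: funext.
  move=> <-; rewrite C_los.
  have E : \oo [set m | forall i, ext n (e i) m = repr (pi (ext n (e i))) m].
    apply: (eventually_forall (P := fun i => [set m | ext n (e i) m = repr (pi (ext n (e i))) m])).
    by move=> i; exact: (@repr_pi _ _ _ _ eventually_filter _ _ D0 _ (extD _ _)).
  split=> H; apply: filterS2 E H => m /= E.
    by rewrite (_ : (fun i => repr _ _) = fun i => ext n (e i) m) //; apply: funext.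
  by rewrite (_ : (fun i => ext _ _ _) = fun i => repr (pi (ext n (e i))) m) //; apply: funext.
- move=> n x; apply: (iffRL (@pi_eq _ _ _ _ eventually_filter _ _ D0 _ _ (extD _ _) (extD _ _))); exists n.+1 => // m /= nm.
  elim: m nm => // m IHm; rewrite leq_eqVlt => /orP[/eqP[<-]|].
    by rewrite ext_at ext_coh // ext_at.
  rewrite ltnS => nm; rewrite ext_coh // IHm // ext_coh //; exact: ltnW.
move=> y; have [n yc] := reprD y; exists n, (repr y n).
rewrite -[RHS](@pi_repr _ _ _ _ eventually_filter _ _ D0); apply: (iffRL (@pi_eq _ _ _ _ eventually_filter _ _ D0 _ _ (extD _ _) (reprD y))).
exists n => // m /= nm; elim: m nm => [|m IHm].
  by rewrite leqn0 => /eqP n0; case: _ / n0 in y yc *.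
rewrite leq_eqVlt => /orP[/eqP<-|]; first by rewrite ext_at.
by rewrite ltnS => nm; rewrite ext_coh // IHm // yc.
Qed.
End Colimit.

Lemma colimit_lift L (N : nat -> structure L) (k : forall n, N n -> N n.+1) (C : structure L)
    (c : forall n, N n -> C) (T : Type) (w : forall n, N n -> T) :
  (forall n, injective (@c n)) -> (forall n x, c n.+1 (k n x) = c n x) ->
  (forall y, exists n x, c n x = y) -> (forall n x, w n.+1 (k n x) = w n x) ->
  exists W : C -> T, forall n x, W (c n x) = w n x.
Proof.
move=> cI ck cS wk.
have push n l x : (n <= l)%N -> exists x', c l x' = c n x /\ w l x' = w n x.
  elim: l => [|l IHl]; first by rewrite leqn0 => /eqP n0; subst n; exists x.
  rewrite leq_eqVlt => /orP[/eqP E|]; first by subst n; exists x.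
  by rewrite ltnS => /IHl[x' [E1 E2]]; exists (k l x'); rewrite ck wk.
have [W WE] := boolp.choice (fun y => cS y).
have [W' W'E] : exists W' : C -> T, forall y, exists n x, c n x = y /\ w n x = W' y.
  have ex y : exists t, exists n x, c n x = y /\ w n x = t.
    by have [n [x E]] := cS y; exists (w n x), n, x.
  by have [W' ?] := boolp.choice ex; exists W'.
exists W' => n x; have [m [x' [E <-]]] := W'E (c n x).
have [z [cz <-]] := push n (maxn n m) x (leq_maxl _ _).
have [z' [cz' <-]] := push m (maxn n m) x' (leq_maxr _ _).
by congr w; apply: cI; rewrite cz cz' E.
Qed.

(** * Extending commuting automorphisms to a model of ACFA *)

Section CommutingExtension.
Variable ACFA : theory diff_lang.
Hypothesis ACFA_companion : is_ACFA ACFA.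

Lemma ACFA_extension_morph (F : fieldType) (s : {rmorphism F -> F}) :
  (forall y, exists x, s x = y) ->
  exists (K : fieldType) (t : {rmorphism K -> K}) (j : {rmorphism F -> K}),
  [/\ forall y, exists x, t x = y, model ACFA (diff_structure t)
    & forall x, j (s x) = t (j x)].
Proof.
move=> /rmorph_is_aut/(ACFA_extension ACFA_companion)[K [t [j [tA Ht js]]]].
have [g gt _] := is_aut_morph tA; have {}gt : (g : K -> K) = t by exact: funext.
by exists K, g, j; rewrite gt; case: tA.
Qed.

(** [emb_l] plays the part of an inclusion, and [emb_r] that of a partial tau, defined on [dom] with
    values in [cod]; both are morphisms of difference fields. *)
Record stage := Stage {
  dom : fieldType; cod : fieldType;
  dom_s : {rmorphism dom -> dom}; cod_s : {rmorphism cod -> cod};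
  dom_surj : forall y, exists x, dom_s x = y;
  cod_surj : forall y, exists x, cod_s x = y;
  dom_model : model ACFA (diff_structure dom_s);
  cod_model : model ACFA (diff_structure cod_s);
  emb_l : {rmorphism dom -> cod}; emb_r : {rmorphism dom -> cod};
  emb_l_s : forall x, emb_l (dom_s x) = cod_s (emb_l x);
  emb_r_s : forall x, emb_r (dom_s x) = cod_s (emb_r x) }.
Arguments emb_l X : clear implicits, rename.
Arguments emb_r X : clear implicits, rename.
Arguments emb_l_s X : clear implicits, rename.
Arguments emb_r_s X : clear implicits, rename.
Arguments dom_s X : clear implicits, rename.
Arguments cod_s X : clear implicits, rename.
Arguments dom_model X : clear implicits, rename.
Arguments cod_model X : clear implicits, rename.


(** Amalgamating [B] with itself along [i] and [j] extends the partial map [j], seen through the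
    inclusion [i], to a map [j'] defined on all of [B], seen through the inclusion [i']. *)
Lemma amalgamated_stage (A B : fieldType) (a : {rmorphism A -> A}) (b : {rmorphism B -> B})
    (i j : {rmorphism A -> B}) (acA : alg_closed A) (aS : forall y, exists x, a x = y)
    (bS : forall y, exists x, b x = y) (Hb : model ACFA (diff_structure b))
    (ia : forall x, i (a x) = b (i x)) (ja : forall x, j (a x) = b (j x)) :
  exists (C : fieldType) (c : {rmorphism C -> C}) (cS : forall y, exists x, c x = y)
    (Hc : model ACFA (diff_structure c)) (i' j' : {rmorphism B -> C})
    (ib : forall x, i' (b x) = c (i' x)) (jb : forall x, j' (b x) = c (j' x)),
    forall x, j' (i x) = i' (j x).
Proof.
have [D [t [d [h [tS ds hs dh]]]]] :=
  amalgamation acA (ACFA_alg_closed ACFA_companion Hb) aS bS bS ia ja.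
have [C [c [e [cS Hc es]]]] := ACFA_extension_morph tS.
have hs' x : (e \o h) (b x) = c ((e \o h) x) by rewrite /= hs es.
have ds' x : (e \o d) (b x) = c ((e \o d) x) by rewrite /= ds es.
by exists C, c, cS, Hc, (e \o h), (e \o d), hs', ds' => x; rewrite /= dh.
Qed.

Record next_stage (X : stage) := NextStage {
  new : fieldType; new_s : {rmorphism new -> new};
  new_surj : forall y, exists x, new_s x = y;
  new_model : model ACFA (diff_structure new_s);
  new_inl : {rmorphism cod X -> new}; new_inr : {rmorphism cod X -> new};
  new_inl_s : forall x, new_inl (cod_s X x) = new_s (new_inl x);
  new_inr_s : forall x, new_inr (cod_s X x) = new_s (new_inr x);
  new_square : forall x, new_inr (emb_l X x) = new_inl (emb_r X x) }.

Lemma next_stage_exists (X : stage) : exists N : next_stage X, True.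
Proof.
have [C [c [cS [Hc [i [j [ib [jb sq]]]]]]]] := amalgamated_stage
  (ACFA_alg_closed ACFA_companion (dom_model X)) (@dom_surj X) (@cod_surj X) (cod_model X)
  (emb_l_s X) (emb_r_s X).
by exists (NextStage cS Hc ib jb sq).
Qed.

Definition the_next_stage (X : stage) : next_stage X := projT1 (cid (next_stage_exists X)).

Definition step (X : stage) : stage :=
  Stage (@cod_surj X) (new_surj (n := the_next_stage X)) (cod_model X)
    (new_model (the_next_stage X)) (new_inl_s (the_next_stage X)) (new_inr_s (the_next_stage X)).

Lemma step_square (X : stage) x : emb_r (step X) (emb_l X x) = emb_l (step X) (emb_r X x).
Proof. exact: new_square. Qed.

Section Tower.
Variable X0 : stage.

Definition tower n : stage := iter n (step \o step) X0.
Definition tower_structure n : structure diff_lang := diff_structure (dom_s (tower n)).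
(* [dom (tower n)] is embedded in [dom (tower n.+1)] by [emb_l \o emb_r]; since [emb_r] stands for
   the new automorphism [tau] followed by the inclusion [emb_l], an element of [dom (tower n)]
   represents its image under [tau ^- n] in the colimit. *)
Lemma tower_colimit : exists (C : fieldType) (u v : C -> C) (c : forall n, {rmorphism dom (tower n) -> C}),
  [/\ is_aut u, is_aut v, model ACFA (diff_structure u), forall y, u (v y) = v (u y)
    & [/\ forall n x, c n (dom_s (tower n) x) = u (c n x),
       forall n x, c n.+1 (emb_l (step (tower n)) (emb_r (tower n) x)) = c n x
     & forall n x, v (c n x) = c n.+1 (emb_r (step (tower n)) (emb_r (tower n) x))]].
Proof.
pose k n (x : dom (tower n)) : dom (tower n.+1) := emb_l (step (tower n)) (emb_r (tower n) x).
have kE n : @elementary _ (tower_structure n) (tower_structure n.+1) (k n).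
  apply: (@ACFA_elementary _ ACFA_companion _ _ _ _ (emb_l (step (tower n)) \o emb_r (tower n))).
  - exact: (dom_model (tower n)).
  - exact: (dom_model (tower n.+1)).
  by move=> x /=; rewrite emb_r_s (emb_l_s (step (tower n))).
have [C [c [cE ck cS]]] := colimit kE (0 : dom (tower 0)).
have cmodel : model ACFA C.
  move=> p /(dom_model (tower 0)) Hp; apply/(@holds_env0_comp _ _ _ (c 0%N))/cE; exact: Hp.
have [F [u [uA CE]]] := diff_structure_of (ACFA_difference_field ACFA_companion cmodel).
subst C.
have gex n : exists g : {rmorphism dom (tower n) -> F},
    g =1 c n /\ forall x, g (dom_s (tower n) x) = u (g x).
  have [g gc gs] := embedding_rmorphism (elementary_embedding (cE n)).
  by exists g; split=> // x; exact: (gs tt x).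
pose g n := projT1 (cid (gex n)).
have gc n : g n =1 c n by rewrite /g; case: cid => ? [].
have gs n x : g n (dom_s (tower n) x) = u (g n x) by rewrite /g; case: cid => ? [].
have gk n x : g n.+1 (k n x) = g n x by rewrite !gc ck.
have gS y : exists n x, g n x = y by have [n [x <-]] := cS y; exists n, x; rewrite gc.
have gI n : injective (g n) by exact: fmorph_inj.
(* In terms of tau, [k] is tau, [rr] is its square and [ll] is the identity. Relative to the
   identifications along [k], the last two induce tau and its inverse, which gives surjectivity. *)
pose rr n (x : dom (tower n)) : dom (tower n.+1) := emb_r (step (tower n)) (emb_r (tower n) x).
pose ll n (x : dom (tower n)) : dom (tower n.+1) := emb_l (step (tower n)) (emb_l (tower n) x).
have sq n x : emb_r (step (tower n)) (emb_l (tower n) x) = k n x by exact: step_square.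
have sq' n (x : dom (tower n)) : emb_r (tower n.+1) (k n x) =
    emb_l (tower n.+1) (rr n x) by exact: (step_square (X := step (tower n)) (emb_r (tower n) x)).
have sq'' n (x : dom (tower n)) : emb_r (tower n.+1) (ll n x) =
    emb_l (tower n.+1) (k n x).
  by rewrite -sq; exact: (step_square (X := step (tower n)) (emb_l (tower n) x)).
have rk n x : rr n.+1 (k n x) = k n.+1 (rr n x) by rewrite /rr sq' sq.
have lk n x : ll n.+1 (k n x) = k n.+1 (ll n x) by rewrite /ll -sq'' -/(ll n x).
have rl n x : rr n.+1 (ll n x) = k n.+1 (k n x) by rewrite /rr sq'' sq.
have [v vE] : exists v : F -> F, forall n x, v (g n x) = g n.+1 (rr n x).
  by apply: (@colimit_lift diff_lang tower_structure k (diff_structure u) g F) => // n x; rewrite rk gk.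
have [v' v'E] : exists v' : F -> F, forall n x, v' (g n x) = g n.+1 (ll n x).
  by apply: (@colimit_lift diff_lang tower_structure k (diff_structure u) g F) => // n x; rewrite lk gk.
have two y y' : exists n x x', g n x = y /\ g n x' = y'.
  have push n l x : (n <= l)%N -> exists x', g l x' = g n x.
    elim: l => [|l IHl]; first by rewrite leqn0 => /eqP n0; subst n; exists x.
    rewrite leq_eqVlt => /orP[/eqP E|]; first by subst n; exists x.
    by rewrite ltnS => /IHl[x' E]; exists (k l x'); rewrite gk.
  have [n [x <-]] := gS y; have [m [x' <-]] := gS y'.
  have [z <-] := push n (maxn n m) x (leq_maxl _ _).
  have [z' <-] := push m (maxn n m) x' (leq_maxr _ _).
  by exists (maxn n m), z, z'.
exists F, u, v, g; split=> //.
- split=> [|y y'|y y'|y].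
  + by rewrite -{1}(rmorph1 (g 0%N)) vE /rr !rmorph1.
  + by have [n [x [x' [<- <-]]]] := two y y'; rewrite -rmorphB !vE /rr !rmorphB.
  + by have [n [x [x' [<- <-]]]] := two y y'; rewrite -rmorphM !vE /rr !rmorphM.
  by have [n [x <-]] := gS y; exists (v' (g n x)); rewrite v'E vE rl !gk.
- by move=> y; have [n [x <-]] := gS y; rewrite vE -!gs vE /rr emb_r_s (emb_r_s (step (tower n))).
Qed.
End Tower.

(** As [t] commutes with [s], both [i] and [i \o t] embed the difference field [K] into the model
    [B]. Amalgamating along them starts the tower with a partial automorphism that extends [t]. *)
Theorem commuting_extension (K : fieldType) (s t : {rmorphism K -> K}) :
  alg_closed K -> (forall y, exists x, s x = y) -> (forall y, exists x, t x = y) ->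
  (forall x, t (s x) = s (t x)) ->
  exists (C : fieldType) (u v : C -> C) (j : {rmorphism K -> C}),
  [/\ is_aut u, is_aut v, model ACFA (diff_structure u), forall y, u (v y) = v (u y)
    & (forall x, j (s x) = u (j x)) /\ forall x, j (t x) = v (j x)].
Proof.
move=> acK sS tS ts; have [B [b [i [bS Hb ib]]]] := ACFA_extension_morph sS.
have ib' x : (i \o t) (s x) = b ((i \o t) x) by rewrite /= ts ib.
have [C [c [cS [Hc [i' [j' [ic [jc sq]]]]]]]] := amalgamated_stage acK sS bS Hb ib ib'.
have [F [u [v [g [uA vA Hu uv [gs gk vE]]]]]] := tower_colimit (Stage bS cS Hb Hc ic jc).
exists F, u, v, (g 0%N \o i); split=> //; split=> x /=; first by rewrite ib gs.
pose X := Stage bS cS Hb Hc ic jc.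
have E1 : v (g 0%N (i x)) = g 1%N (emb_r (step X) (j' (i x))) := vE 0%N (i x).
have E2 : g 1%N (emb_l (step X) (j' (i (t x)))) = g 0%N (i (t x)) := gk 0%N (i (t x)).
have E3 : emb_r (step X) (i' (i (t x))) = emb_l (step X) (j' (i (t x))) :=
  step_square (X := X) (i (t x)).
have E4 : j' (i x) = i' (i (t x)) := sq x.
by rewrite E1 -E2 E4 E3.
Qed.
End CommutingExtension.

(** * Power series and Hensel's lemma *)

Section PowerSeries.
Variable N : fieldType.

Definition series : Type := nat -> N.
HB.instance Definition _ := gen_eqMixin series.
HB.instance Definition _ := gen_choiceMixin series.

Implicit Types f g h : series.

Definition sadd f g : series := fun n => f n + g n.
Definition sopp f : series := fun n => - f n.
Definition sconst (c : N) : series := fun n => if n == 0%N then c else 0.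
Definition smul f g : series := fun n => \sum_(i < n.+1) f i * g (n - i)%N.

Fact saddA : associative sadd.
Proof. by move=> f g h; apply: funext => n; rewrite /sadd addrA. Qed.
Fact saddC : commutative sadd.
Proof. by move=> f g; apply: funext => n; rewrite /sadd addrC. Qed.
Fact sadd0 : left_id (sconst 0) sadd.
Proof. by move=> f; apply: funext => n; rewrite /sadd /sconst if_same add0r. Qed.
Fact saddN : left_inverse (sconst 0) sopp sadd.
Proof. by move=> f; apply: funext => n; rewrite /sadd /sconst if_same addNr. Qed.
HB.instance Definition _ := GRing.isZmodule.Build series saddA saddC sadd0 saddN.

Definition trunc n f : {poly N} := \poly_(i < n) f i.

(** A coefficient of a product depends on truncations only, so the ring laws are inherited from
    polynomials. *)
Lemma smul_trunc n m f g : (n < m)%N -> smul f g n = (trunc m f * trunc m g)`_n.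
Proof.
move=> nm; rewrite /smul coefM; apply: eq_bigr => i _; rewrite !coef_poly.
by rewrite (leq_ltn_trans (leq_subr _ _) nm) (leq_trans (ltn_ord i)).
Qed.

Lemma coefM_congr n (p p' q q' : {poly N}) :
  (forall i, (i <= n)%N -> p`_i = p'`_i) -> (forall i, (i <= n)%N -> q`_i = q'`_i) ->
  (p * q)`_n = (p' * q')`_n.
Proof.
move=> pp qq; rewrite !coefM; apply: eq_bigr => i _.
by rewrite pp ?qq ?leq_subr // -ltnS.
Qed.

Lemma coef_trunc_smul n f g i : (i <= n)%N ->
  (trunc n.+1 (smul f g))`_i = (trunc n.+1 f * trunc n.+1 g)`_i.
Proof. by move=> le_in; rewrite coef_poly ltnS le_in (@smul_trunc _ n.+1). Qed.

Fact smulA : associative smul.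
Proof.
move=> f g h; apply: funext => n; rewrite !(@smul_trunc n n.+1) //.
transitivity ((trunc n.+1 f * (trunc n.+1 g * trunc n.+1 h))`_n).
  by apply: coefM_congr => // i; exact: coef_trunc_smul.
by rewrite mulrA; apply: coefM_congr => // i /coef_trunc_smul->.
Qed.
Fact smulC : commutative smul.
Proof. by move=> f g; apply: funext => n; rewrite !(@smul_trunc n n.+1) // mulrC. Qed.
Fact smul1 : left_id (sconst 1) smul.
Proof.
move=> f; apply: funext => n; rewrite /smul big_ord_recl subn0 /sconst /= mul1r.
by rewrite big1 ?addr0 // => i _; rewrite mul0r.
Qed.
Fact smulD : left_distributive smul sadd.
Proof.
move=> f g h; apply: funext => n; rewrite /smul /sadd -big_split /=.
by apply: eq_bigr => i _; rewrite mulrDl.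
Qed.
Fact s10 : sconst 1 != 0 :> series.
Proof. by apply/eqP => /(congr1 (fun f : series => f 0%N))/eqP; rewrite oner_eq0. Qed.
HB.instance Definition _ := GRing.Zmodule_isComNzRing.Build series smulA smulC smul1 smulD s10.

Lemma coef_sadd f g n : (f + g) n = f n + g n. Proof. by []. Qed.
Lemma coef_sopp f n : (- f) n = - f n. Proof. by []. Qed.
Lemma coef_s0 n : (0 : series) n = 0. Proof. by rewrite -[LHS]/(sconst 0 n) /sconst if_same. Qed.
Lemma coef_s1 n : (1 : series) n = (n == 0%N)%:R. Proof. by rewrite -[LHS]/(sconst 1 n) /sconst; case: eqP. Qed.
Lemma coef_smul f g n : (f * g) n = \sum_(i < n.+1) f i * g (n - i)%N. Proof. by []. Qed.

Definition order_ge a f := forall i, (i < a)%N -> f i = 0.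

Lemma order_geM a b f g : order_ge a f -> order_ge b g ->
  order_ge (a + b) (f * g) /\ (f * g) (a + b)%N = f a * g b.
Proof.
move=> fa gb; split=> [n nab|].
  rewrite coef_smul big1 // => i _; have [ia|ai] := ltnP i a; first by rewrite fa // mul0r.
  rewrite (gb (n - i)%N) ?mulr0 // ltn_subLR; first exact: leq_trans nab (leq_add ai (leqnn b)).
  by have := ltn_ord i; rewrite ltnS.
rewrite coef_smul (bigD1 (inord a)) //= inordK ?ltnS ?leq_addr // addKn big1 ?addr0 // => i ia.
have [lt_ia|] := ltnP i a; first by rewrite fa // mul0r.
rewrite leq_eqVlt => /orP[/eqP E|ai].
  by case/eqP: ia; apply: val_inj; rewrite /= inordK -?E // ltnS leq_addr.
rewrite (gb (a + b - i)%N) ?mulr0 // ltn_subLR ?ltn_add2r //.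
by have := ltn_ord i; rewrite ltnS.
Qed.

Lemma series_order f : f != 0 -> exists2 a, order_ge a f & f a != 0.
Proof.
move=> f0; have ex : exists n, f n != 0.
  apply: contrapT => /forallNP fn; case/eqP: f0; apply: funext => n.
  by rewrite coef_s0; apply/eqP/negPn/negP/fn.
case: (ex_minnP ex) => a fa mina; exists a => // i; apply: contraTeq => /mina.
by rewrite -leqNgt.
Qed.

Fact series_integral f g : f * g = 0 -> (f == 0) || (g == 0).
Proof.
move=> fg; apply/orP; have [_|f0] := eqVneq f 0; [by left | right].
apply/negPn/negP => g0; have [a fa fan] := series_order f0; have [b gb gbn] := series_order g0.
have [_] := order_geM fa gb; rewrite fg coef_s0 => /esym/eqP.
by rewrite mulf_eq0 (negbTE fan) (negbTE gbn).
Qed.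

Definition sunit : {pred series} := fun f => `[< exists g, g * f = 1 >].
Definition sinv f : series :=
  if pselect (exists g, g * f = 1) is left ex then projT1 (cid ex) else f.
Fact smulV : {in sunit, left_inverse 1 sinv *%R}.
Proof.
by move=> f /asboolP ex; rewrite /sinv; case: pselect => // ex'; case: cid.
Qed.
Fact sunitP f g : g * f = 1 -> sunit f.
Proof. by move=> gf; apply/asboolP; exists g. Qed.
Fact sinv_out : {in [predC sunit], sinv =1 id}.
Proof. by move=> f /asboolPn; rewrite /sinv; case: pselect. Qed.
HB.instance Definition _ := GRing.ComNzRing_hasMulInverse.Build series smulV sunitP sinv_out.
HB.instance Definition _ := GRing.ComUnitRing_isIntegral.Build series series_integral.

Definition uniformizer : series := fun n => (n == 1%N)%:R.

Lemma order_geX n : order_ge n (uniformizer ^+ n) /\ (uniformizer ^+ n) n = 1.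
Proof.
have u1 : order_ge 1 uniformizer by case.
elim: n => [|n [IH1 IH2]]; first by rewrite expr0 coef_s1.
by have [H1 H2] := order_geM u1 IH1; rewrite exprS; split=> //; rewrite H2 IH2 mulr1.
Qed.

(* Comparing orders at u = 0: y cannot have a pole of order 1/2. *)
Lemma no_artin_schreier_root f g : g != 0 -> uniformizer * (f * f - f * g) <> g * g.
Proof.
move=> g0; have [b gb gbn] := series_order g0.
have [f0|f0] := eqVneq f 0; first by rewrite f0 !mul0r subr0 mulr0 => /esym/eqP; rewrite mulf_eq0 orbb (negbTE g0).
have [a fa fan] := series_order f0.
have u1 : order_ge 1 uniformizer by case.
rewrite mulrBr => E.
have [ff ffn] := order_geM u1 (order_geM fa fa).1.
have [fg fgn] := order_geM u1 (order_geM fa gb).1.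
have [gg ggn] := order_geM gb gb.
have [ab|ba] := ltnP a b.
  have lt1 : (1 + (a + a) < 1 + (a + b))%N by rewrite !ltn_add2l.
  have lt2 : (1 + (a + a) < b + b)%N by have := leq_add ab ab; rewrite addSn addnS add1n.
  have := congr1 (fun h : series => h (1 + (a + a))%N) E.
  rewrite /= coef_sadd coef_sopp ffn (order_geM fa fa).2 (fg _ lt1) (gg _ lt2).
  by rewrite subr0 mul1r => /eqP; rewrite mulf_eq0 orbb (negbTE fan).
have lt1 : (b + b < 1 + (a + a))%N by rewrite add1n ltnS leq_add.
have lt2 : (b + b < 1 + (a + b))%N by rewrite add1n ltnS leq_add2r.
have := congr1 (fun h : series => h (b + b)%N) E.
rewrite /= coef_sadd coef_sopp (ff _ lt1) (fg _ lt2) ggn.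
by rewrite subr0 => /esym/eqP; rewrite mulf_eq0 orbb (negbTE gbn).
Qed.
End PowerSeries.

Lemma horner_taylor2 (R : comNzRingType) (p : {poly R}) a d :
  exists k, p.[a + d] = p.[a] + p^`().[a] * d + d * d * k.
Proof.
elim/poly_ind: p => [|p c [k IH]]; first by exists 0; rewrite deriv0 !horner0; ring.
exists (p^`().[a] + k * (a + d)); rewrite derivMXaddC !hornerE IH; ring.
Qed.

Section Hensel.
Variable N : fieldType.
Local Notation S := (series N).

Lemma residue_morphism : exists res : {rmorphism S -> N}, forall f, res f = f 0%N.
Proof.
by apply: (@rmorphism_of S N (fun f => f 0%N)) => // f g; rewrite coef_smul big_ord1.
Qed.
Definition residue : {rmorphism S -> N} := projT1 (cid residue_morphism).
Lemma residueE f : residue f = f 0%N. Proof. exact: projT2 (cid residue_morphism) f. Qed.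

Lemma series_of_poly_morphism :
  exists e : {rmorphism {poly N} -> S}, forall p n, e p n = p`_n.
Proof.
have [|p q|p q|e eE] := @rmorphism_of {poly N} S (fun p n => p`_n).
- by apply: funext => n; rewrite coef1 coef_s1.
- by apply: funext => n; rewrite coefB.
- by apply: funext => n; rewrite coefM.
by exists e => p n; rewrite eE.
Qed.

(** Taylor expansion at [c]: substitute X + c, then read off the coefficients. *)
Lemma expansion_morphism (c : N) : exists e : {rmorphism {poly N} -> S},
  [/\ injective e, forall p, residue (e p) = p.[c] & e ('X - c%:P) = uniformizer N].
Proof.
have [e eE] := series_of_poly_morphism.
exists (e \o (comp_poly ('X + c%:P))); split=> [|p|].
- apply/raddf_inj => p /= ep.
  have p0 : p \Po ('X + c%:P) = 0 by apply/polyP => n; rewrite -eE ep coef0 coef_s0.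
  have -> : p = (p \Po ('X + c%:P)) \Po ('X - c%:P).
    by rewrite -comp_polyA comp_polyD comp_polyX comp_polyC subrK comp_polyXr.
  by rewrite p0 comp_poly0.
- by rewrite residueE /= eE -horner_coef0 horner_comp !hornerE.
apply: funext => n; rewrite /= eE comp_polyB comp_polyX comp_polyC addrK coefX.
by case: n => [|[|n]].
Qed.

Lemma order_geD a (f g : S) : order_ge a f -> order_ge a g -> order_ge a (f + g).
Proof. by move=> fa ga i ia; rewrite coef_sadd fa // ga // addr0. Qed.

Lemma order_geMl a (f g : S) : order_ge a g -> order_ge a (f * g).
Proof. by move=> ga; apply: (order_geM (a := 0) _ ga).1. Qed.

Section Lift.
Variables (p : {poly S}) (r0 : N).
Hypotheses (r0_root : (p^^residue).[r0] = 0) (r0_simple : (p^`()^^residue).[r0] != 0).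
Let D := (p^`()^^residue).[r0].

(** Newton's method, one coefficient at a time: the new term cancels coefficient [n] of the value of
    [p], and the only division is by the residue [D] of the derivative. *)
Fixpoint approx n : S :=
  if n is m.+1 then
    approx m + sconst (- p.[approx m] n / D) * uniformizer N ^+ n
  else sconst r0.

Let correction n := sconst (- p.[approx n] n.+1 / D) * uniformizer N ^+ n.+1.

Lemma correction_order n : order_ge n.+1 (correction n) /\
  (correction n) n.+1 = - p.[approx n] n.+1 / D.
Proof.
have [u1 u2] := order_geX N n.+1.
have c0 : order_ge 0 (sconst (- p.[approx n] n.+1 / D)) by [].
by have [H1 H2] := order_geM c0 u1; split=> //; rewrite [LHS]H2 u2 mulr1.
Qed.

Lemma approx_residue n : residue (approx n) = r0.
Proof.
elim: n => [|n IHn]; first by rewrite residueE.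
by rewrite /= -/(correction n) rmorphD IHn residueE (correction_order n).1 // addr0.
Qed.

Lemma approx_order n : order_ge n.+1 p.[approx n].
Proof.
elim: n => [|n IHn] i.
  by rewrite ltnS leqn0 => /eqP->; rewrite -residueE -horner_map /= residueE.
have [k E] := horner_taylor2 p (approx n) (correction n).
have [c1 c2] := correction_order n.
rewrite /= -/(correction n) E ltnS leq_eqVlt => /orP[/eqP->|ltn]; last first.
  have H := order_geD (order_geD IHn (order_geMl p^`().[approx n] c1))
    (order_geMl (k * correction n) c1).
  have -> : correction n * correction n * k = k * correction n * correction n by ring.
  exact: H.
have d0 : order_ge 0 p^`().[approx n] by [].
rewrite !coef_sadd (order_geM d0 c1).2 c2.
rewrite (_ : p^`().[approx n] 0%N = D); last first.
  by rewrite -residueE -horner_map /= approx_residue.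
(* The quadratic term has order at least 2n + 2, beyond the coefficient n + 1 at stake. *)
have -> : (correction n * correction n * k) n.+1 = 0.
  rewrite mulrC; apply: (order_geMl _ (order_geM c1 c1).1).
  by rewrite addnS ltnS leq_addr.
by rewrite addr0 mulrC divfK ?subrr.
Qed.

Lemma hensel : exists2 r, p.[r] = 0 & residue r = r0.
Proof.
(* The diagonal: from step [n] on, coefficient [n] no longer changes. *)
pose r : S := fun n => approx n n.
have rE n i : (i <= n)%N -> approx n i = r i.
  elim: n => [|n IHn]; first by rewrite leqn0 => /eqP->.
  rewrite leq_eqVlt => /orP[/eqP->//|]; rewrite ltnS => le_in.
  by rewrite -IHn //= -/(correction n) coef_sadd (correction_order n).1 ?addr0.
exists r; last by rewrite residueE -(approx_residue 0) residueE.
apply: funext => n; rewrite coef_s0.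
have [k E] := horner_taylor2 p (approx n) (r - approx n).
have d : order_ge n.+1 (r - approx n).
  by move=> i ltn; rewrite coef_sadd coef_sopp rE ?subrr // -ltnS.
rewrite addrCA subrr addr0 in E; rewrite E.
have H : order_ge n.+1 (p.[approx n] + p^`().[approx n] * (r - approx n) +
    (r - approx n) * (r - approx n) * k).
  apply: order_geD; first by apply: order_geD; [exact: approx_order | exact: order_geMl].
  by rewrite mulrC; apply/order_geMl/order_geMl.
exact: H.
Qed.
End Lift.

(** At x = c the polynomial keeps its degree and its roots stay distinct, [r] replacing the
    discriminant. A Bezout identity over N[x] is easily carried through specializations and
    automorphisms. *)
Definition etale_at (c : N) (f : {poly {poly N}}) :=
  (lead_coef f).[c] != 0 /\ exists u v r, u * f + v * f^`() = r%:P /\ r.[c] != 0.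

(** The reduction of [f] at [c] has as many distinct roots as its degree; Hensel's lemma lifts each
    to a series, and no room is left for another root. *)
Lemma etale_roots (L : fieldType) (c : N) (e : {rmorphism {poly N} -> S})
    (m : {rmorphism S -> L}) (f : {poly {poly N}}) w :
  alg_closed N -> injective m -> (forall p, residue (e p) = p.[c]) ->
  etale_at c f -> ((f^^e)^^m).[w] = 0 -> exists r, w = m r.
Proof.
move=> acN mI ec [lf [u [v [r [uv rc]]]]] fw.
pose ev : {rmorphism {poly N} -> N} := horner_eval c.
have evE p : residue (e p) = ev p by rewrite ec.
have bez : u^^ev * f^^ev + v^^ev * (f^^ev)^`() = (r.[c])%:P.
  by rewrite deriv_map -!rmorphM -rmorphD uv /= map_polyC.
have sz : size (f^^ev) = size f by rewrite size_poly_eq.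
have f0 : f^^ev != 0.
  by rewrite -size_poly_eq0 sz size_poly_eq0; apply: contraNneq lf => ->; rewrite lead_coef0 horner0.
have [s fs] := alg_closed_splits (f^^ev) acN.
have l0 : lead_coef (f^^ev) != 0 by rewrite lead_coef_eq0.
have us : uniq s.
  rewrite -separable_prod_XsubC unlock.
  have : coprimep (f^^ev) ((f^^ev)^`()).
    apply/Bezout_coprimepP; exists (u^^ev, v^^ev) => /=.
    by rewrite bez -size_poly_eq1 size_polyC rc.
  by rewrite fs derivZ coprimepZl // coprimepZr.
have lift a : exists R : S, a \in s -> (f^^e).[R] = 0 /\ residue R = a.
  have [as_|] := boolP (a \in s); last by exists 0.
  have fa : (f^^ev).[a] = 0.
    rewrite fs hornerZ; apply/eqP; rewrite mulf_eq0; apply/orP; right.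
    by rewrite -rootE root_prod_XsubC.
  have [||R fR Ra] := @hensel (f^^e) a; last by exists R.
    by rewrite (map_poly_map _ evE).
  rewrite deriv_map (map_poly_map _ evE) -deriv_map.
  apply: contraNneq rc => f'a; have := congr1 (horner^~ a) bez.
  by rewrite !hornerE /= fa f'a !mulr0 addr0 => <-.
have [R RP] := boolp.choice lift.
have [wR|wR] := boolP (w \in [seq m (R a) | a <- s]).
  by have /mapP[a _ ->] := wR; exists (R a).
have F0 : (f^^e)^^m != 0.
  apply: contraNneq f0 => F0; have fe0 : f^^e = 0.
    apply/polyP => i; apply: mI; rewrite coef0 rmorph0 -coef_map F0 coef0; by [].
  by rewrite -(map_poly_map f evE) fe0 rmorph0.
have := @max_poly_roots _ ((f^^e)^^m) (w :: [seq m (R a) | a <- s]) F0.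
rewrite /= wR rootE fw eqxx /= map_inj_in_uniq => [|a b sa sb /mI Rab]; last first.
  by have [_ <-] := RP a sa; have [_ <-] := RP b sb; rewrite Rab.
rewrite us size_map; have -> : all (root (f^^e)^^m) [seq m (R a) | a <- s].
  by apply/allP => _ /mapP[a /RP[fR _] ->]; rewrite rootE horner_map fR rmorph0.
move=> /(_ isT isT); have szs : size (f^^ev) = (size s).+1.
  by rewrite fs size_scale // size_prod_XsubC.
rewrite ltnNge => /negP[]; apply: leq_trans (size_poly _ _) _.
by apply: leq_trans (size_poly _ _) _; rewrite -sz szs.
Qed.
End Hensel.

(** * Local automorphisms and their infinite products *)

Lemma algebraic_over_comp (A B : comNzRingType) (L : fieldType) (k : {rmorphism A -> B})
    (i : {rmorphism B -> L}) (i' : {rmorphism A -> L}) x :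
  (forall a, i (k a) = i' a) -> algebraic_over i' x -> algebraic_over i x.
Proof. by move=> ik [p p0 px]; exists (p^^k); rewrite (map_poly_map _ ik). Qed.

Section Inertia.
Variables (N K : fieldType) (pi : {rmorphism {poly N} -> K}) (c : N) (z : K).
Hypotheses (acN : alg_closed N) (acK : alg_closed K) (piI : injective pi).
Hypothesis Kalg : forall x, algebraic_over pi x.
Hypothesis zP : (z * z - z) * pi ('X - c%:P) = 1.

(* [H] consists of the elements of [K] that lie in N((x - c)), for an embedding of [K]
   over N(x) in an algebraic closure of N((x - c)). *)
Lemma local_field : exists (H : fieldType) (w : {rmorphism H -> K}) (k : {rmorphism {poly N} -> H}),
  [/\ forall p, w (k p) = pi p, forall h, w h <> z
    & forall f a, etale_at c f -> (f^^pi).[a] = 0 -> exists h, w h = a].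
Proof.
have [e [eI eres eX]] := expansion_morphism c.
have [L [i acL]] := algebraic_closure {fraction (series N)}.
pose m : {rmorphism series N -> L} := i \o @tofrac _.
have mI : injective m by move=> f g /fmorph_inj/eqP; rewrite tofrac_eq => /eqP.
have m0 f : (m f == 0) = (f == 0) by rewrite -(rmorph0 m) (inj_eq mI).
pose pi' : {rmorphism {poly N} -> L} := m \o e.
have ker p : pi p = 0 <-> pi' p = 0.
  by rewrite -(rmorph0 pi) -(rmorph0 pi'); split=> [/piI->|/mI/eI->].
have [th thE] := extend_embedding acL ker Kalg.
pose D x := exists f g, g != 0 /\ th x = m f / m g.
have [H [w wE]] : exists (H : fieldType) (w : {rmorphism H -> K}), forall x, D x <-> exists h, w h = x.
  apply: subfield_type.
  - by exists 1, 1; rewrite oner_eq0 !rmorph1 divr1.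
  - move=> x y [f [g [g0 E]]] [f' [g' [g0' E']]]; exists (f * g' - f' * g), (g * g').
    rewrite mulf_neq0 // rmorphB E E' !rmorphB !rmorphM; split=> //.
    by field; rewrite !m0 g0 g0'.
  - move=> x y [f [g [g0 E]]] [f' [g' [g0' E']]]; exists (f * f'), (g * g').
    rewrite mulf_neq0 // rmorphM E E' !rmorphM; split=> //.
    by field; rewrite !m0 g0 g0'.
  move=> x [f [g [g0 E]]]; have [f0|f0] := eqVneq f 0.
    exists 0, 1; rewrite oner_eq0 rmorph0 mul0r fmorphV E f0 rmorph0 mul0r invr0.
    by split.
  by exists g, f; rewrite fmorphV E invf_div.
have [k kE] : exists k : {rmorphism {poly N} -> H}, forall p, w (k p) = pi p.
  apply: rmorphism_through => p; apply/wE; exists (e p), 1.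
  by rewrite oner_eq0 rmorph1 divr1 thE.
exists H, w, k; split=> // [h wz|f a fe fa].
  have [f [g [g0 E]]] : D z by apply/wE; exists h.
  have mg0 : m g != 0 by rewrite m0.
  have : th ((z * z - z) * pi ('X - c%:P)) = 1 by rewrite zP rmorph1.
  rewrite rmorphM rmorphB rmorphM E thE /= eX => E1.
  apply: (no_artin_schreier_root (f := f) g0); apply: mI; rewrite !(rmorphM m) rmorphB !(rmorphM m).
  rewrite -[RHS]mul1r -E1; field; exact: mg0.
apply/wE; have [|r ar] := @etale_roots N L c e m f (th a) acN mI eres fe; last first.
  by exists r, 1; rewrite oner_eq0 rmorph1 divr1.
by rewrite (@map_poly_map _ _ _ e m _ f (fun=> erefl)) -(map_poly_map f thE) horner_map /= fa rmorph0.
Qed.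

(** [z] is quadratic over the subfield [H] and not in it, so the identity of [H] extends to the
    exchange of [z] and [1 - z], and then to [K]. *)
Theorem inertia : exists g : {rmorphism K -> K},
  [/\ forall p, g (pi p) = pi p, g z = 1 - z, z <> 1 - z, forall y, exists x, g x = y
    & forall f a, etale_at c f -> (f^^pi).[a] = 0 -> g a = a].
Proof.
have [H [w [k [wk wz wetale]]]] := local_field.
have [v wv] : exists v, w v = z * z - z.
  exists (k ('X - c%:P))^-1; rewrite fmorphV wk; apply: (mulIf (x := pi ('X - c%:P))).
    by apply: contraTneq isT => E; move/eqP: zP; rewrite E mulr0 eq_sym oner_eq0.
  rewrite zP mulVf //; apply: contraTneq isT => E; by move/eqP: zP; rewrite E mulr0 eq_sym oner_eq0.
have wz' h : w h <> 1 - z.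
  by move=> E; apply: (wz (1 - h)); rewrite rmorphB rmorph1 E subKr.
(* Equality would give 2z = 1, which is absurd in characteristic 2 and puts [z] in [H] otherwise. *)
have zz' : z <> 1 - z.
  move=> E; have z2 : 2%:R * z = 1 by rewrite mulr_natl mulr2n {1}E subrK.
  apply: (wz 2%:R^-1); rewrite fmorphV rmorph_nat; apply: (mulfI (x := 2%:R)).
    by apply: contra_eq_neq z2 => ->; rewrite mul0r eq_sym oner_neq0.
  rewrite z2 mulfV //; by apply: contra_eq_neq z2 => ->; rewrite mul0r eq_sym oner_neq0.
pose d : {poly H} := 'X^2 - 'X - v%:P.
have dmon : d \is monic.
  rewrite /d -addrA monicE lead_coefDl ?lead_coefXn // size_polyXn.
  apply: leq_ltn_trans (size_polyD _ _) _; rewrite !size_polyN size_polyX size_polyC.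
  by case: (v != 0).
have droot y : y * y - y = w v -> (d^^w).[y] = 0.
  move=> yv; rewrite !rmorphB rmorphXn /= map_polyX map_polyC !hornerE /= -yv; ring.
have szd : size d = 3%N.
  rewrite /d -addrA size_polyDl ?size_polyXn //.
  apply: leq_ltn_trans (size_polyD _ _) _; rewrite !size_polyN size_polyX size_polyC.
  by case: (v != 0).
(* Modulo [d] a polynomial has degree at most 1, and such a polynomial over [H] is zero if it
   vanishes at an element outside [H]. So [z] and [1 - z] satisfy the same relations over [H]. *)
have vanish y y' (q : {poly H}) : y * y - y = w v -> y' * y' - y' = w v ->
    (forall h, w h <> y) -> (q^^w).[y] = 0 -> (q^^w).[y'] = 0.
  move=> yv yv' wy; rewrite (divp_eq q d) !rmorphD !rmorphM !hornerE /=.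
  rewrite !droot // !mulr0 !add0r.
  have : (size (q %% d)%R <= 2)%N.
    by rewrite -ltnS -szd ltn_modp -size_poly_eq0 szd.
  move: (q %% d) => r szr ry.
  have rE : r = r`_1 *: 'X + (r`_0)%:P.
    apply/polyP => i; rewrite coefD coefZ coefX coefC.
    case: i => [|[|i]]; rewrite /= ?mulr0 ?mulr1 ?add0r ?addr0 //.
    by rewrite nth_default // (leq_trans szr).
  have r1 : r`_1 = 0.
    apply/eqP/negP => /negP r1; apply: (wy (- r`_0 / r`_1)).
    move: ry; rewrite {1}rE rmorphD /= map_polyZ map_polyX map_polyC !hornerE /= => ry.
    rewrite rmorphM rmorphN fmorphV; apply: (mulfI (x := w r`_1)); first by rewrite fmorph_eq0.
    rewrite mulrCA mulfV ?fmorph_eq0 // mulr1; apply/eqP; rewrite eq_sym -addr_eq0; exact/eqP.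
  have r0 : r`_0 = 0.
    apply/eqP; move/eqP: ry; rewrite {1}rE r1 scale0r add0r map_polyC hornerC fmorph_eq0; by [].
  by rewrite rE r1 r0 scale0r polyC0 addr0 rmorph0 horner0.
pose i1 := evalm w z; pose i2 := evalm w (1 - z).
have z'v : (1 - z) * (1 - z) - (1 - z) = w v by rewrite wv; ring.
have ker q : i1 q = 0 <-> i2 q = 0.
  by rewrite /i1 /i2 !evalmE; split; apply: vanish.
pose kk : {rmorphism {poly N} -> {poly H}} := polyC \o k.
have ik y p : evalm w y (kk p) = pi p by rewrite evalmE /= map_polyC hornerC /= wk.
have [||g [gi gS]] := @extend_automorphism _ K i1 i2 acK ker.
- by move=> x; apply: algebraic_over_comp (ik z) (Kalg x).
- by move=> x; apply: algebraic_over_comp (ik (1 - z)) (Kalg x).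
have gw h : g (w h) = w h.
  by have := gi h%:P; rewrite /i1 /i2 !evalmE map_polyC !hornerC.
exists g; split=> // [p||f a fe fa].
- by rewrite -wk gw.
- by have := gi 'X; rewrite /i1 /i2 !evalmE map_polyX !hornerX.
by have [h <-] := wetale f a fe fa.
Qed.
End Inertia.

(** * Reduction to separable relations *)

Lemma pchar_expn_inj (K : fieldType) p : p \in [pchar K] -> injective (fun x : K => x ^+ p).
Proof.
move=> pK x y /= /eqP; rewrite -subr_eq0 -(pFrobenius_autE pK) -(pFrobenius_autE pK y).
by rewrite -rmorphB /= fmorph_eq0 subr_eq0 => /eqP.
Qed.

Lemma deriv_eq0_comp (R : idomainType) (f : {poly R}) p : p \in [pchar R] ->
  f^`() = 0 -> exists h, f = h \Po 'X^p /\ (1 < size f -> size h < size f)%N.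
Proof.
move=> pR f0; have p_pr := pcharf_prime pR.
pose h := \poly_(i < ((size f).-1 %/ p).+1) f`_(i * p)%N.
have coef0 i : ~~ (p %| i)%N -> f`_i = 0.
  case: i => [|i] pi; first by rewrite dvdn0 in pi.
  have := congr1 (fun q : {poly R} => q`_i) f0; rewrite coef_deriv coef0 -mulr_natr => /eqP.
  by rewrite mulf_eq0 -(dvdn_pcharf pR) (negbTE pi) orbF => /eqP.
exists h; split=> [|sz1].
  apply/polyP => i; rewrite coef_comp_poly_Xn ?prime_gt0 //.
  case: ifP => [/dvdnP[k ->]|/negbT/coef0//]; rewrite mulnK ?prime_gt0 // coef_poly.
  case: ltnP => // kp; rewrite nth_default //.
  rewrite leqNgt; apply/negP => lt_kp; move: kp; rewrite leqNgt ltnS leq_divRL ?prime_gt0 //.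
  by rewrite -ltnS prednK ?lt_kp // (leq_trans _ lt_kp).
apply: leq_ltn_trans (size_poly _ _) _.
case: (size f) sz1 => [|[|n]] //= _; rewrite ltnS ltn_Pdiv // prime_gt1 //.
Qed.

(** Among the relations of all powers [a ^+ q] with injective q-th power map, one of least degree is
    separable: otherwise it is a polynomial in X^p and yields a shorter relation for the p-th power
    of [a ^+ q]. Thanks to injectivity, a morphism that fixes [a ^+ q] fixes [a]. *)
Lemma separable_power (N K : fieldType) (pi : {rmorphism {poly N} -> K}) a :
  injective pi -> algebraic_over pi a ->
  exists q (f : {poly {poly N}}) (g : {poly N}),
  [/\ injective (fun x : K => x ^+ q), (f^^pi).[a ^+ q] = 0, g != 0
    & forall c, g.[c] != 0 -> etale_at c f].
Proof.
move=> piI [p0 p0n p0a].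
have map0 (f : {poly {poly N}}) : f^^pi = 0 -> f = 0.
  by move=> f0; apply/polyP => i; apply: piI; rewrite coef0 rmorph0 -coef_map f0 coef0.
pose R n := `[< exists q (f : {poly {poly N}}),
  [/\ size f = n, f != 0, injective (fun x : K => x ^+ q) & (f^^pi).[a ^+ q] = 0] >].
have exR : exists n, R n.
  exists (size p0); apply/asboolP; exists 1%N, p0; split=> //.
  by apply: contraNneq p0n => ->; rewrite rmorph0.
case: (ex_minnP exR) => n /asboolP[q [f [szf f0 qI fa]]] minf.
have small (h : {poly {poly N}}) : (size h < size f)%N -> (h^^pi).[a ^+ q] = 0 -> h = 0.
  move=> lth ha; apply/eqP/negP => /negP h0; suff: (n <= size h)%N by rewrite leqNgt -szf lth.
  by apply: minf; apply/asboolP; exists q, h.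
have sz1 : (1 < size f)%N.
  rewrite ltnNge; apply/negP => /size1_polyC fC; move: fa; rewrite fC map_polyC hornerC /= => /eqP.
  by rewrite -(rmorph0 pi) (inj_eq piI) => /eqP c0; move: f0; rewrite fC c0 polyC0 eqxx.
have minP : minimal_relation pi (a ^+ q) f.
  split=> //.
    by rewrite -(rmorph0 pi) (inj_eq piI) lead_coef_eq0.
  move=> h; have -> : size (h^^pi) = size h.
    apply: size_map_inj_poly => //; exact: rmorph0.
  by move=> lth /(small h lth)->; rewrite rmorph0.
have df0 : f^`() != 0.
  apply/eqP => df0.
  have lf : (lead_coef f) *+ (size f).-1 = 0.
    have := congr1 (fun q : {poly _} => q`_(size f).-2) df0.
    by rewrite coef_deriv coef0 lead_coefE; case: (size f) sz1 => [|[|]].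
  have [p pK] : exists p, p \in [pchar K].
    apply: (@natf0_pchar _ (size f).-1); first by case: (size f) sz1 => [|[|]].
    have := congr1 pi lf; rewrite rmorphMn rmorph0 -mulr_natr => /eqP; rewrite mulf_eq0.
    by rewrite -{1}(rmorph0 pi) (inj_eq piI) lead_coef_eq0 (negbTE f0).
  have pN : p \in [pchar {poly N}].
    rewrite inE; have /andP[-> /=] := pK.
    by rewrite -(inj_eq piI) rmorph_nat rmorph0.
  have [h [fh szh]] := deriv_eq0_comp pN df0.
  have h0 : h != 0 by apply: contraNneq f0 => h0; rewrite fh h0 comp_poly0.
  suff: (n <= size h)%N by rewrite leqNgt -szf szh.
  apply: minf; apply/asboolP; exists (q * p)%N, h; split=> //.
    by move=> x y /=; rewrite !exprM => /(pchar_expn_inj pK)/qI.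
  move: fa; rewrite {1}fh map_comp_poly horner_comp map_polyXn hornerXn.
  by rewrite exprM.
have dfa : (f^`()^^pi).[a ^+ q] != 0.
  by apply: contraNneq df0 => /small->//; exact: lt_size_deriv.
have [u [v [r [s [uv s0 r0]]]]] := minimal_relation_bezout minP dfa.
move/map0: s0 => s0; rewrite s0 addr0 in uv.
have rn0 : r != 0 by apply: contraNneq r0 => ->; rewrite rmorph0.
(* [r] comes from the Bezout identity of [f] and its derivative; the other factor keeps the degree
   at [c]. *)
exists q, f, (r * lead_coef f); split=> //; first by rewrite mulf_neq0 // lead_coef_eq0.
move=> c; rewrite hornerM mulf_eq0 negb_or => /andP[rc lc]; split=> //.
by exists v, u, r; rewrite addrC.
Qed.

Fixpoint iterm (R : comNzRingType) (s : {rmorphism R -> R}) n : {rmorphism R -> R} :=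
  if n is m.+1 then s \o iterm s m else idfun.

Lemma itermSr (R : comNzRingType) (s : {rmorphism R -> R}) n x :
  iterm s n.+1 x = iterm s n (s x).
Proof. by elim: n => //= n <-. Qed.

Lemma itermD (R : comNzRingType) (s : {rmorphism R -> R}) n m x :
  iterm s (n + m) x = iterm s n (iterm s m x).
Proof. by elim: n => //= n ->. Qed.

Lemma itermK (R : comNzRingType) (s r : {rmorphism R -> R}) n x :
  (forall x, s (r x) = x) -> iterm s n (iterm r n x) = x.
Proof. by move=> sr; elim: n => // n IHn; rewrite itermSr /= sr. Qed.

Lemma iterm_comm (R S : comNzRingType) (s : {rmorphism R -> R}) (t : {rmorphism S -> S})
    (j : R -> S) n x : (forall x, j (s x) = t (j x)) -> j (iterm s n x) = iterm t n (j x).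
Proof. by move=> js; elim: n => //= n <-. Qed.

Lemma etale_twist (N : fieldType) (h : {rmorphism N -> N}) c (f : {poly {poly N}}) :
  etale_at c f -> etale_at (h c) (f^^(map_poly h)).
Proof.
case=> lc [u [v [r [uv rc]]]]; split.
  by rewrite lead_coef_map_inj ?rmorph0 //; [rewrite horner_map fmorph_eq0 | exact: map_poly_inj].
exists (u^^(map_poly h)), (v^^(map_poly h)), (r^^h).
by rewrite deriv_map -!rmorphM -rmorphD uv /= map_polyC horner_map fmorph_eq0.
Qed.

Section InfiniteProduct.
Variables (N K : fieldType) (pi : {rmorphism {poly N} -> K}) (sN rN : {rmorphism N -> N}).
Variables (s r g : {rmorphism K -> K}) (b : N).
Hypotheses (srN : forall x, sN (rN x) = x) (rsN : forall x, rN (sN x) = x).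
Hypotheses (sr : forall x, s (r x) = x) (rs : forall x, r (s x) = x).
Hypothesis s_pi : forall p, s (pi p) = pi (p^^sN).
Hypothesis g_pi : forall p, g (pi p) = pi p.
Hypothesis piI : injective pi.
Hypothesis Kalg : forall x, algebraic_over pi x.
Hypothesis g_etale : forall (f : {poly {poly N}}) a, etale_at b f -> (f^^pi).[a] = 0 -> g a = a.
Hypothesis orbit : forall n m, iterm sN n b = iterm sN m b -> n = m.

Lemma r_pi p : r (pi p) = pi (p^^rN).
Proof.
apply: (fmorph_inj s); rewrite sr s_pi; congr (pi _).
by rewrite (@map_poly_map _ _ _ rN sN id _ srN) map_poly_id.
Qed.

(** [g] fixes what is unramified at [b], and a morphism that carries [c] to [b] reduces the case of
    [c] to this one. The q-th power takes care of inseparability. *)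
Lemma fix_twist (h : {rmorphism K -> K}) (hN : {rmorphism N -> N}) q (f : {poly {poly N}}) c x :
  (forall p, h (pi p) = pi (p^^hN)) -> injective (fun x : K => x ^+ q) -> hN c = b ->
  etale_at c f -> (f^^pi).[x ^+ q] = 0 -> g (h x) = h x.
Proof.
move=> hpi qI hc fc fx; apply: qI; rewrite -!rmorphXn.
apply: (g_etale (f := f^^(map_poly hN))); first by rewrite -hc; exact: etale_twist.
rewrite (_ : _^^pi = (f^^pi)^^h); first by rewrite horner_map fx rmorph0.
by apply/polyP => i; rewrite !coef_map /= -hpi.
Qed.

Lemma iterm_pi (h : {rmorphism K -> K}) (hN : {rmorphism N -> N}) n p :
  (forall p, h (pi p) = pi (p^^hN)) -> iterm h n (pi p) = pi (p^^(iterm hN n)).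
Proof.
move=> hpi; elim: n => [|n IHn]; first by rewrite map_poly_id.
by rewrite /= IHn hpi; congr (pi _); apply: map_poly_map.
Qed.

(* This is the product of the conjugates [s ^ n g s ^ - n], for [- m <= n < l]; recall that [r = s ^ - 1]. *)
Definition partial_product m l : {rmorphism K -> K} :=
  iterm r m \o (iterm (g \o s) (m + l) \o iterm r l).

Lemma partial_product_pi m l p : partial_product m l (pi p) = pi p.
Proof.
have gs_pi p' : (g \o s) (pi p') = pi (p'^^sN) by rewrite /= s_pi g_pi.
rewrite /= (iterm_pi _ _ r_pi) (iterm_pi _ _ gs_pi) (iterm_pi _ _ r_pi); congr (pi _).
apply/polyP => i; rewrite !coef_map /= itermD (itermK _ _ srN) //.
exact: (itermK _ _ rsN).
Qed.

Section Stabilization.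
Variables (q : nat) (f : {poly {poly N}}) (x : K) (n0 : nat).
Hypotheses (qI : injective (fun x : K => x ^+ q)) (fx : (f^^pi).[x ^+ q] = 0).
Hypothesis f_etale : forall n, (n0 <= n)%N ->
  etale_at (iterm sN n b) f /\ etale_at (iterm rN n b) f.

Lemma partial_product_root m l : (f^^pi).[partial_product m l x ^+ q] = 0.
Proof.
rewrite -rmorphXn -[f^^pi](_ : (f^^pi)^^(partial_product m l) = _).
  by rewrite horner_map fx rmorph0.
by apply: map_poly_map => a; exact: partial_product_pi.
Qed.

(** The extra factor, the conjugate of [g] by the l-th power of [s], acts first, on [x] itself. *)
Lemma partial_productSr m l : (n0 <= l)%N -> partial_product m l.+1 x = partial_product m l x.
Proof.
move=> /f_etale[fs _].
have E : g (iterm r l x) = iterm r l x.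
  apply: (fix_twist (h := iterm r l) (hN := iterm rN l) _ qI _ fs fx).
    by move=> p; exact: iterm_pi r_pi.
  exact: itermK.
by rewrite /= addnS itermSr /= sr E.
Qed.

(** The extra factor acts last, on the image of [x]; that image satisfies the same relation as [x],
    because partial products fix N[x]. *)
Lemma partial_productSl m l : (n0 <= m.+1)%N -> partial_product m.+1 l x = partial_product m l x.
Proof.
move=> /f_etale[_ fr].
have E : g (iterm s m.+1 (partial_product m l x)) = iterm s m.+1 (partial_product m l x).
  apply: (fix_twist (h := iterm s m.+1) (hN := iterm sN m.+1) _ qI _ fr (partial_product_root m l)).
    by move=> p; exact: iterm_pi s_pi.
  exact: itermK.
pose y := iterm (g \o s) (m + l) (iterm r l x).
have Ey : iterm s m.+1 (partial_product m l x) = s y by rewrite /= (itermK _ _ sr).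
rewrite Ey in E.
by rewrite -[LHS]/(iterm r m.+1 (g (s y))) E itermSr rs.
Qed.

Lemma partial_product_stable m l : (n0 <= m)%N -> (n0 <= l)%N ->
  partial_product m l x = partial_product n0 n0 x.
Proof.
move=> m0 l0; transitivity (partial_product n0 l x).
  elim: m m0 => [|m IHm]; first by rewrite leqn0 => /eqP->.
  rewrite leq_eqVlt => /orP[/eqP->//|nm]; rewrite partial_productSl ?IHm //; exact: ltnW.
elim: l l0 => [|l IHl]; first by rewrite leqn0 => /eqP->.
by rewrite leq_eqVlt => /orP[/eqP->//|nl]; rewrite partial_productSr ?IHl.
Qed.
End Stabilization.

Lemma eventually_nonroot (p : {poly N}) (u : nat -> N) : p != 0 -> injective u ->
  exists n0, forall n, (n0 <= n)%N -> p.[u n] != 0.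
Proof.
move=> p0 uI; apply: contrapT => /forallNP nex.
have big m : exists s : seq nat, [/\ size s = m, uniq s & all (fun n => root p (u n)) s].
  elim: m => [|m [l [szl ul rl]]]; first by exists [::].
  (* An index beyond the sum of [l] exceeds every element of [l], hence is new. *)
  have /existsNP[n /not_implyP[ln /negP/negPn pn]] := nex (\sum_(i <- l) i).+1.
  exists (n :: l); rewrite /= szl ul rl andbT rootE pn; split=> //.
  apply/negP => nl; move: ln; rewrite (big_rem n) //= ltnNge => /negP[]; exact: leq_addr.
have [l [szl ul rl]] := big (size p).
have := @max_poly_roots _ p [seq u n | n <- l] p0.
by rewrite all_map rl map_inj_uniq // ul size_map szl ltnn => /(_ isT isT).
Qed.

Lemma rN_orbit n m : iterm rN n b = iterm rN m b -> n = m.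
Proof.
have main k l : iterm rN k b = iterm rN (k + l) b -> l = 0%N.
  move=> /(congr1 (iterm sN k)); rewrite itermD !(itermK _ _ srN) => /(congr1 (iterm sN l)).
  by rewrite (itermK _ _ srN) => /(@orbit l 0).
have [nm|/ltnW mn] := leqP n m.
  by rewrite -(subnKC nm) => /main->; rewrite addn0.
by rewrite -(subnKC mn) => /esym/main->; rewrite addn0.
Qed.

(** A relation for [x] is etale outside finitely many points, and the orbit of [b] eventually leaves
    these in both directions. *)
Lemma partial_product_limit x : exists n0, forall m l, (n0 <= m)%N -> (n0 <= l)%N ->
  partial_product m l x = partial_product n0 n0 x.
Proof.
have [q [f [d [qI fx d0 df]]]] := separable_power piI (Kalg x).
have [n1 H1] := eventually_nonroot d0 orbit; have [n2 H2] := eventually_nonroot d0 rN_orbit.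
exists (maxn n1 n2) => m l; apply: (partial_product_stable (q := q) (f := f)) => // n.
by rewrite geq_max => /andP[/H1/df ? /H2/df ?].
Qed.

Theorem infinite_product : exists G : {rmorphism K -> K},
  [/\ forall x, G (s x) = s (G x), forall p, G (pi p) = pi p
    & forall x, exists n0, forall m l, (n0 <= m)%N -> (n0 <= l)%N -> partial_product m l x = G x].
Proof.
have /boolp.choice[G0 GE] : forall x, exists y, exists n0, forall m l,
    (n0 <= m)%N -> (n0 <= l)%N -> partial_product m l x = y.
  by move=> x; have [n0 H] := partial_product_limit x; exists (partial_product n0 n0 x), n0.
have uni x n y : (forall m l, (n <= m)%N -> (n <= l)%N -> partial_product m l x = y) -> G0 x = y.
  move=> H; have [n0 H0] := GE x.
  by rewrite -(H0 (maxn n n0) (maxn n n0)) ?leq_maxr // H ?leq_maxl.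
have [|x y|x y|G G0E] := @rmorphism_of K K G0.
- by apply: (uni _ 0%N) => m l _ _; rewrite rmorph1.
- have [n1 H1] := GE x; have [n2 H2] := GE y; apply: (uni _ (maxn n1 n2)) => m l.
  by rewrite !geq_max => /andP[? ?] /andP[? ?]; rewrite rmorphB H1 // H2.
- have [n1 H1] := GE x; have [n2 H2] := GE y; apply: (uni _ (maxn n1 n2)) => m l.
  by rewrite !geq_max => /andP[? ?] /andP[? ?]; rewrite rmorphM H1 // H2.
exists G; split=> [x|p|x]; rewrite ?G0E.
- have [n0 H] := GE x; apply: (uni _ n0.+1) => m [//|l] m0 l0.
  (* Moving [s] across the product shifts the window of conjugates by one. *)
  have -> : partial_product m l.+1 (s x) = s (partial_product m.+1 l x).
    rewrite -[LHS]/(iterm r m (iterm (g \o s) (m + l.+1) (iterm r l.+1 (s x)))) itermSr rs addnS.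
    by rewrite -[RHS]/(s (r (iterm r m (iterm (g \o s) (m + l).+1 (iterm r l x))))) sr.
  by rewrite H //; exact: leqW (ltnW m0).
- by apply: (uni _ 0%N) => m l _ _; rewrite partial_product_pi.
exact: GE.
Qed.

End InfiniteProduct.

(** * The extension realizing the pattern *)

Section FixedTranscendental.
Variables (N : fieldType) (c : nat -> N).
Hypotheses (acN : alg_closed N) (cI : injective c).

(* [K] is the relative algebraic closure of [N(x)] in [N^nat / U], where [x] is
   the class of the sequence [c], and [act] is the coefficientwise action. *)
Theorem fixed_transcendental : exists (K : fieldType) (pi : {rmorphism {poly N} -> K})
    (act : {rmorphism N -> N} -> {rmorphism K -> K}),
  [/\ alg_closed K, injective pi, forall x, algebraic_over pi x
    & [/\ forall h : {rmorphism N -> N}, (forall k, h (c k) = c k) -> forall p, act h (pi p) = pi (p^^h),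
      forall h1 h2 : {rmorphism N -> N}, (forall k, h1 (c k) = c k) -> (forall k, h2 (c k) = c k) ->
        (forall x, h1 (h2 x) = h2 (h1 x)) -> forall y, act h1 (act h2 y) = act h2 (act h1 y)
      & forall h1 h2 : {rmorphism N -> N}, (forall k, h1 (c k) = c k) -> (forall k, h2 (c k) = c k) ->
        (forall x, h1 (h2 x) = x) -> forall y, act h1 (act h2 y) = y]].
Proof.
have [U UU Uge] := ultrafilter_nat.
have [E [tE [pi0 pi0P]]] := @ultraproduct_field nat U unit (fun=> N) (fun _ _ x => x) UU.
have acE : alg_closed E by apply: ultraproduct_alg_closed pi0P (fun=> acN).
have [d dE] := ultra_diagonal pi0P (fun=> idfun).
pose pi1 := evalm d (pi0 c).
have pi1E p : pi1 p = pi0 (fun k => p.[c k]).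
  rewrite /pi1 evalmE; elim/poly_ind: p => [|p a IH].
    rewrite rmorph0 horner0 -(ultra0 pi0P); congr pi0; apply: funext => k; by rewrite horner0.
  rewrite rmorphD rmorphM /= map_polyX map_polyC !hornerE /= IH dE -(ultraM pi0P) -(ultraD pi0P).
  by congr pi0; apply: funext => k; rewrite !hornerE.
have pi1I : injective pi1.
  apply/raddf_inj => p pi1p; apply/eqP/negP => /negP p0.
  have [n0 H] := eventually_nonroot p0 cI.
  have /(ultra_eq0 pi0P) pU := etrans (esym (pi1E p)) pi1p.
  have /filter_ex[k [/= pk nk]] : U ([set k | p.[c k] = 0] `&` [set k | (n0 <= k)%N]).
    exact: filterI.
  by have := H k nk; rewrite pk eqxx.
have [K [v [pi [vpi Kalg valg acK]]]] := relative_closure_closed pi1 acE.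
have actE (h : {rmorphism N -> N}) : (forall k, h (c k) = c k) ->
    exists hK : {rmorphism K -> K}, forall y f, v y = pi0 f -> v (hK y) = pi0 (h \o f).
  move=> hc; have [f0 f0E] := boolp.choice (ultra_surj pi0P).
  have hU f f' : pi0 f = pi0 f' -> pi0 (h \o f) = pi0 (h \o f').
    by move=> /(ultra_eq pi0P) ff; apply/(ultra_eq pi0P); apply: filterS ff => i /= ->.
  have [|y y'|y y'|hE hEE] := @rmorphism_of E E (fun y => pi0 (h \o f0 y)).
  - rewrite -(ultra1 pi0P) (hU _ (fun=> 1)); last by rewrite f0E (ultra1 pi0P).
    by congr pi0; apply: funext => k; rewrite /= rmorph1.
  - rewrite -(ultraB pi0P) (hU _ (fun k => f0 y k - f0 y' k)).
      by congr pi0; apply: funext => k; rewrite /= rmorphB.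
    by rewrite (ultraB pi0P) !f0E.
  - rewrite -(ultraM pi0P) (hU _ (fun k => f0 y k * f0 y' k)).
      by congr pi0; apply: funext => k; rewrite /= rmorphM.
    by rewrite (ultraM pi0P) !f0E.
  have hEpi f : hE (pi0 f) = pi0 (h \o f) by rewrite hEE; apply: hU; rewrite f0E.
  (* As [h] fixes every [c k], it maps the image of N[x] into itself; algebraic elements then go to
     algebraic ones, so that [K] is preserved. *)
  have hEpi1 p : hE (pi1 p) = pi1 (p^^h).
    rewrite !pi1E hEpi; congr pi0; apply: funext => k.
    by rewrite /= -{2}(hc k) horner_map.
  have [|hK vhK] := @rmorphism_through _ _ _ v (hE \o v).
    move=> y; apply: valg; have [p p0 py] := Kalg y.
    have E1 : (p^^(map_poly h))^^pi1 = ((p^^pi)^^v)^^hE.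
      by apply/polyP => i; rewrite !coef_map /= vpi hEpi1.
    exists (p^^(map_poly h)); rewrite E1; first by rewrite !map_poly_eq0.
    by rewrite /= !horner_map /= py !rmorph0.
  by exists hK => y f vy; rewrite vhK /= vy hEpi.
(* The action is made total by the identity for maps that move some [c k]. *)
pose act (h : {rmorphism N -> N}) : {rmorphism K -> K} :=
  if pselect (forall k, h (c k) = c k) is left hc then projT1 (cid (actE h hc)) else idfun.
have actP (h : {rmorphism N -> N}) : (forall k, h (c k) = c k) -> forall y f, v y = pi0 f -> v (act h y) = pi0 (h \o f).
  by rewrite /act; case: pselect => // hc _; case: cid.
exists K, pi, act; split=> //; first by move=> p q pq; apply: pi1I; rewrite -!vpi pq.
split=> [h hc p|h1 h2 hc1 hc2 h12 y|h1 h2 hc1 hc2 h12 y]; apply: (fmorph_inj v).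
- rewrite (actP h hc _ (fun k => p.[c k])) ?vpi ?pi1E //; congr pi0; apply: funext => k.
  by rewrite /= -{2}(hc k) horner_map.
- have [f fE] := ultra_surj pi0P (v y); have {}fE := esym fE.
  rewrite (actP h1 hc1 _ _ (actP h2 hc2 _ _ fE)) (actP h2 hc2 _ _ (actP h1 hc1 _ _ fE)).
  by congr pi0; apply: funext => k /=.
have [f fE] := ultra_surj pi0P (v y); have {}fE := esym fE.
rewrite (actP h1 hc1 _ _ (actP h2 hc2 _ _ fE)) fE.
by congr pi0; apply: funext => k /=.
Qed.
End FixedTranscendental.

Section ArtinSchreierCover.
Variable N : fieldType.

(** The inner variable is x, the outer one Y; the roots are the elements y of the pattern. *)
Definition cover (a : N) : {poly {poly N}} := ('X - a%:P)%:P * ('X^2 - 'X) - 1.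

Lemma cover_horner (K : fieldType) (pi : {rmorphism {poly N} -> K}) a y :
  ((cover a)^^pi).[y] = (y * y - y) * pi ('X - a%:P) - 1.
Proof.
rewrite /cover; move: ('X - a%:P) => u.
by rewrite !(rmorphB, rmorphM, rmorph1) /= map_polyC !map_polyX !hornerE mulrC.
Qed.

(* [f' ^ 2 - 4 (x - a) f = (x - a) (x - a + 4)], where [f = cover a]. *)
Lemma cover_etale a c : c != a -> c != a - 4%:R -> etale_at c (cover a).
Proof.
move=> ca ca4; split.
  have -> : lead_coef (cover a) = 'X - a%:P; last by rewrite !hornerE subr_eq0.
  have a0 : ('X - a%:P)%:P != 0 :> {poly {poly N}} by rewrite polyC_eq0 polyXsubC_eq0.
  have ltX : (size (- 'X : {poly {poly N}}) < size ('X^2 : {poly {poly N}}))%N.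
    by rewrite size_polyN size_polyX size_polyXn.
  have l2 : lead_coef ('X^2 - 'X : {poly {poly N}}) = 1 by rewrite lead_coefDl // lead_coefXn.
  have s2 : size ('X^2 - 'X : {poly {poly N}}) = 3%N by rewrite size_polyDl // size_polyXn.
  rewrite /cover lead_coefDl; first by rewrite lead_coefM l2 mulr1 lead_coefC.
  rewrite size_polyN size_poly1 size_Cmul ?s2 //; by rewrite polyXsubC_eq0.
pose u : {poly N} := 'X - a%:P.
exists (- (u%:P *+ 4)), (cover a)^`(), (u * (u + 4%:R)); split; last first.
  have uc : u.[c] = c - a by rewrite hornerXsubC.
  rewrite hornerM (hornerD u) uc -(rmorph_nat polyC) /= hornerC mulf_neq0 ?subr_eq0 //.
  apply: contraNneq ca4 => E; apply/eqP.
  have -> : c = (c - a + 4%:R) + (a - 4%:R) by ring.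
  by rewrite E add0r.
have E4 : (4%:R : {poly N})%:P = 4%:R by exact: (rmorph_nat polyC).
have -> : (cover a)^`() = u%:P * ('X *+ 2 - 1).
  rewrite /cover -/u -polyC1 derivB derivM derivB derivXn derivX !derivC. by rewrite mul0r add0r subr0 expr1.
have -> : (u * (u + 4%:R))%:P = u%:P * (u%:P + 4%:R) by rewrite -E4 -polyCD -polyCM.
rewrite /cover -/u; ring.
Qed.
End ArtinSchreierCover.

Lemma artin_schreier_conjugate (K : fieldType) (u y y' : K) :
  (y * y - y) * u = 1 -> (y' * y' - y') * u = 1 -> y' = y \/ y' = 1 - y.
Proof.
move=> yu y'u; have u0 : u != 0.
  by apply: contra_eq_neq yu => ->; rewrite mulr0 eq_sym oner_neq0.
have : (y' - y) * (y' - (1 - y)) == 0.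
  rewrite -(inj_eq (mulIf u0)) mul0r; apply/eqP.
  have -> : (y' - y) * (y' - (1 - y)) * u = (y' * y' - y') * u - (y * y - y) * u by ring.
  by rewrite yu y'u subrr.
by rewrite mulf_eq0 !subr_eq0 => /orP[/eqP|/eqP]; [left|right].
Qed.

(** By [ta] and [tb], sigma and tau send y to roots of one equation, and likewise z. The hypotheses
    on orbits keep all conjugates of [b] away from the points [a] and [a - 4] of the first cover,
    and all but [b] itself away from the points [b] and [b - 4] of the second. *)
Theorem pattern_extension (N : fieldType) (s t : {rmorphism N -> N}) (c : nat -> N) (a b : N) :
  alg_closed N -> (forall y, exists x, s x = y) -> (forall y, exists x, t x = y) ->
  (forall x, t (s x) = s (t x)) ->
  injective c -> (forall k, s (c k) = c k) -> (forall k, t (c k) = c k) ->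
  t a = s a -> t b = s b ->
  (forall n m, iterm s n b <> iterm s m a) -> (forall n m, iterm s n b <> iterm s m a - 4%:R) ->
  (forall n m, iterm s n b = iterm s m b -> n = m) ->
  (forall n m, iterm s n b = iterm s m b - 4%:R -> n = m) ->
  exists (K : fieldType) (s' t' : {rmorphism K -> K}) (j : {rmorphism N -> K}) x y z,
  [/\ alg_closed K, (forall y, exists x, s' x = y) /\ (forall y, exists x, t' x = y),
      forall x, t' (s' x) = s' (t' x), (forall x, j (s x) = s' (j x)) /\ (forall x, j (t x) = t' (j x))
    & [/\ s' x = x, t' x = x, (y * y - y) * (x - j a) = 1, (z * z - z) * (x - j b) = 1
        & ~ (t' y = s' y <-> t' z = s' z)]].
Proof.
move=> acN sS tS ts cI sc tc ta tb ba ba4 bb bb4.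
have [K [pi [act [acK piI Kalg [act_pi act_comm act_inv]]]]] := fixed_transcendental acN cI.
have [rN [srN rsN]] := surjective_inverse sS.
have [qN [tqN qtN]] := surjective_inverse tS.
have rc k : rN (c k) = c k by rewrite -{1}(sc k) rsN.
have qc k : qN (c k) = c k by rewrite -{1}(tc k) qtN.
pose sK := act s; pose tK := act t; pose rK := act rN.
have sK_pi := act_pi s sc; have tK_pi := act_pi t tc.
have srK : forall y, sK (rK y) = y := act_inv _ _ sc rc srN.
have rsK : forall y, rK (sK y) = y := act_inv _ _ rc sc rsN.
have tsK : forall y, tK (sK y) = sK (tK y) := act_comm _ _ tc sc ts.
pose j : {rmorphism N -> K} := pi \o polyC; pose x := pi 'X.
have sKx : sK x = x by rewrite /x sK_pi map_polyX.
have tKx : tK x = x by rewrite /x tK_pi map_polyX.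
have js u : j (s u) = sK (j u) by rewrite /j /= sK_pi map_polyC.
have jt u : j (t u) = tK (j u) by rewrite /j /= tK_pi map_polyC.
have xE u : x - j u = pi ('X - u%:P) by rewrite rmorphB.
have ex_root u : exists y, (y * y - y) * (x - j u) = 1.
  have u0 : x - j u != 0.
    by rewrite xE -(rmorph0 pi) (inj_eq piI) polyXsubC_eq0.
  have [|y] := acK ('X^2 - 'X - ((x - j u)^-1)%:P).
    rewrite -addrA size_polyDl size_polyXn // -opprD size_polyN.
    apply: leq_ltn_trans (size_polyD _ _) _; rewrite size_polyX size_polyC.
    by case: (_ != 0).
  rewrite !hornerE => /eqP; rewrite subr_eq0 => /eqP yE.
  by exists y; rewrite -expr2 yE mulVf.
have [y yP] := ex_root a; have [z zP] := ex_root b.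
have ytP : (tK y * tK y - tK y) * (x - j (s a)) = 1.
  by rewrite -(rmorph1 tK) -yP !(rmorphM, rmorphB) tKx -jt ta.
have ysP : (sK y * sK y - sK y) * (x - j (s a)) = 1.
  by rewrite -(rmorph1 sK) -yP !(rmorphM, rmorphB) sKx -js.
have ztP : (tK z * tK z - tK z) * (x - j (s b)) = 1.
  by rewrite -(rmorph1 tK) -zP !(rmorphM, rmorphB) tKx -jt tb.
have zsP : (sK z * sK z - sK z) * (x - j (s b)) = 1.
  by rewrite -(rmorph1 sK) -zP !(rmorphM, rmorphB) sKx -js.
have sKS u : exists v, sK v = u by exists (rK u).
have tKS u : exists v, tK v = u.
  by exists (act qN u); exact: (act_inv t qN tc qc tqN).
have [|same] := pselect (~ (tK y = sK y <-> tK z = sK z)).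
  by move=> diff; exists K, sK, tK, j, x, y, z.
have {}same : tK y = sK y <-> tK z = sK z by apply: contrapT.
have zP' : (z * z - z) * pi ('X - b%:P) = 1 by rewrite -xE.
have [g [g_pi gz zz' _ g_etale]] := inertia acN acK piI Kalg zP'.
have orbit n m : iterm s n b = iterm s m b -> n = m by exact: bb.
have [G [Gs Gpi Glim]] :=
  infinite_product srN rsN srK rsK sK_pi g_pi piI Kalg g_etale orbit.
have rb n u : iterm rN n b = u -> b = iterm s n u.
  by move=> <-; rewrite (itermK _ _ srN).
have rb4 n u : iterm rN n b = u - 4%:R -> b = iterm s n u - 4%:R.
  by move=> /rb->; rewrite rmorphB rmorph_nat.
have etale_a n : (0 <= n)%N ->
    etale_at (iterm s n b) (cover a) /\ etale_at (iterm rN n b) (cover a).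
  move=> _; split; apply: cover_etale; apply/eqP.
  - exact: (ba n 0%N).
  - exact: (ba4 n 0%N).
  - by move=> /rb; exact: (ba 0%N n).
  - by move=> /rb4; exact: (ba4 0%N n).
(* The bound starts at 1: at [b] itself the second cover is ramified, and there [g] moves [z]. *)
have etale_b n : (1 <= n)%N ->
    etale_at (iterm s n b) (cover b) /\ etale_at (iterm rN n b) (cover b).
  case: n => // n _; split; apply: cover_etale; apply/eqP.
  - by move/(bb n.+1 0%N).
  - by move/(bb4 n.+1 0%N).
  - by move=> /rb/(bb 0%N n.+1).
  - by move=> /rb4/(bb4 0%N n.+1).
have q1 : injective (fun u : K => u ^+ 1) by move=> u v; rewrite !expr1.
have Ya : ((cover a)^^pi).[y ^+ 1] = 0 by rewrite expr1 cover_horner -xE yP subrr.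
have Zb : ((cover b)^^pi).[z ^+ 1] = 0 by rewrite expr1 cover_horner -xE zP subrr.
have Gy : G y = y.
  have [n0 H] := Glim y; rewrite -(H n0 n0) //.
  by rewrite (partial_product_stable srN rsN srK rsK sK_pi g_pi g_etale q1 Ya etale_a).
have Gz : G z = 1 - z.
  have [n0 H] := Glim z; rewrite -(H n0.+1 n0.+1) //.
  rewrite (partial_product_stable srN rsN srK rsK sK_pi g_pi g_etale q1 Zb etale_b) //.
  (* Two factors remain in [partial_product 1 1]: [g], which exchanges [z] and [1 - z], and its
     conjugate with index -1, which fixes [z]. *)
  have fixed : g (sK z) = sK z.
    exact: (fix_twist g_etale (c := rN b) sK_pi q1 (srN b) (etale_b 1%N isT).2 Zb).
  by rewrite /= srK gz !rmorphB !rmorph1 fixed rsK.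
have GS : forall u, exists v, G v = u by exact: algebraic_surjective acK Gpi Kalg.
exists K, sK, (tK \o G), j, x, y, z; split=> //.
- by split=> // u; have [v <-] := tKS u; have [w <-] := GS v; exists w.
- by move=> u /=; rewrite Gs tsK.
- by split=> // u; rewrite jt -[RHS]/(tK (G (pi u%:P))) Gpi.
(* As [tK z] is either [sK z] or [1 - sK z], composing with [G] flips the bit of [z]; the bit of [y]
   is kept since [G] fixes [y]. *)
have tz : (tK \o G) z = sK z <-> tK z <> sK z.
  rewrite /= Gz rmorphB rmorph1; split=> [E tzs|ntz].
    apply: zz'; apply: (fmorph_inj sK); rewrite [RHS]rmorphB rmorph1 -tzs E tzs.
    by rewrite -tzs.
  by have [//|->] := artin_schreier_conjugate zsP ztP; rewrite subKr.
split=> //; first by rewrite /= Gpi.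
by rewrite tz /= Gy same; case: (pselect (tK z = sK z)) => E [H1 H2]; [exact: (H1 E) | exact: (E (H2 E))].
Qed.

(** * The theorem *)

Lemma poly_morphism_eq (R S : comNzRingType) (f g : {rmorphism {poly R} -> S}) :
  (forall a, f a%:P = g a%:P) -> f 'X = g 'X -> forall p, f p = g p.
Proof.
move=> fgC fgX; elim/poly_ind => [|p a IH]; first by rewrite !rmorph0.
by rewrite !rmorphD !rmorphM /= IH fgC fgX.
Qed.

(** The automorphism of F[X] given by [s] on coefficients and X -> uX extends to the algebraic
    closure of F(X), in which [w] is X. *)
Theorem twisted_rational_extension (F : fieldType) (s : {rmorphism F -> F}) (u : F) :
  (forall y, exists x, s x = y) -> u != 0 ->
  exists (K : fieldType) (t : {rmorphism K -> K}) (j : {rmorphism F -> K}) w,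
  [/\ forall y, exists x, t x = y, forall x, j (s x) = t (j x), t w = j u * w
    & forall p : {poly F}, p != 0 -> (p^^j).[w] != 0].
Proof.
move=> sS u0; have [r [sr rs]] := surjective_inverse sS.
have [L [i acL]] := algebraic_closure {fraction {poly F}}.
have [K [v [k [vk Kalg _ acK]]]] := relative_closure_closed (i \o @tofrac _) acL.
have kI p : k p = 0 -> p = 0.
  move=> kp; have := vk p; rewrite kp rmorph0 /= => /esym/eqP.
  by rewrite fmorph_eq0 tofrac_eq0 => /eqP.
pose f : {rmorphism {poly F} -> {poly F}} := evalm (polyC \o s) (u%:P * 'X).
pose g : {rmorphism {poly F} -> {poly F}} := evalm (polyC \o r) ((r u^-1)%:P * 'X).
have fC a : f a%:P = (s a)%:P by rewrite /f evalmE map_polyC hornerC.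
have gC a : g a%:P = (r a)%:P by rewrite /g evalmE map_polyC hornerC.
have fX : f 'X = u%:P * 'X by rewrite /f evalmE map_polyX hornerX.
have gX : g 'X = (r u^-1)%:P * 'X by rewrite /g evalmE map_polyX hornerX.
have fg p : f (g p) = p.
  apply: (@poly_morphism_eq _ _ (f \o g) idfun) => [a|] /=; first by rewrite gC fC sr.
  by rewrite gX rmorphM fC fX sr mulrA -polyCM mulVf // mul1r.
have gf p : g (f p) = p.
  apply: (@poly_morphism_eq _ _ (g \o f) idfun) => [a|] /=; first by rewrite fC gC rs.
  by rewrite fX rmorphM gC gX mulrA -polyCM -rmorphM divff // rmorph1 mul1r.
have [|||t [tk tS]] := @extend_automorphism _ K k (k \o f) acK.
- move=> p; split=> [/kI->|/= /kI fp]; first by rewrite /= !rmorph0.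
  by rewrite (etrans (esym (gf p)) (etrans (congr1 g fp) (rmorph0 g))) rmorph0.
- exact: Kalg.
- by move=> x; apply: (algebraic_over_comp (k := g)) (Kalg x) => p /=; rewrite fg.
exists K, t, (k \o polyC), (k 'X); split=> // [x||p p0].
- by rewrite /= tk /= fC.
- by rewrite tk /= fX rmorphM.
have -> : (p^^(k \o polyC)).[k 'X] = k p; last by apply: contra_neq p0 => /kI.
apply: (@poly_morphism_eq _ _ (evalm (k \o polyC) (k 'X)) k) => [a|].
  by rewrite evalmE map_polyC hornerC.
by rewrite evalmE map_polyX hornerX.
Qed.

(** * Reducts to the language of difference fields *)

Section Reduct.
Variable M : structure diff_tau_lang.

Definition reduct_interp (f : ring_symbol unit) : ('I_(ring_arity f) -> M) -> M :=
  match f return ('I_(ring_arity f) -> M) -> M with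
  | Zero => @interp _ M Zero
  | One => @interp _ M One
  | Opp => @interp _ M Opp
  | Add => @interp _ M Add
  | Mul => @interp _ M Mul
  | Aut _ => @interp _ M (Aut sigma)
  end.

Definition reduct : structure diff_lang := @Structure diff_lang M reduct_interp.

Lemma eval_lift n (e : 'I_n -> M) t : @eval diff_tau_lang M n e (lift_term t) = @eval diff_lang reduct n e t.
Proof.
elim: t => //= f args IH.
by case: f args IH => [||||| a] args IH /=; congr (interp _); apply: funext.
Qed.

Lemma holds_lift n (e : 'I_n -> M) p :
  @holds diff_tau_lang M n e (lift_formula p) <-> @holds diff_lang reduct n e p.
Proof.
elim: p e => {n} [n|n s t|n p IHp q IHq|n p IHp] e //=.
- by rewrite !eval_lift.
- by split=> pq /IHp/pq/IHq.
- by split=> H x; apply/IHp.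
Qed.
End Reduct.

Lemma reduct_field_structure (F : fieldType) (st : option unit -> F -> F) :
  reduct (field_structure st) = diff_structure (st sigma).
Proof.
by congr (@Structure diff_lang F _); apply: functional_extensionality_dep; case.
Qed.

(** [with_commuting_aut] lists no field axioms; they are read off the reduct, which has the same
    ring operations. *)
Lemma field_axiom_reduct (M : structure diff_tau_lang) :
  (forall p, field_axiom p -> satisfies (reduct M) p) ->
  forall p, field_axiom p -> satisfies M p.
Proof.
rewrite /satisfies => H p; case.
- rewrite holds_AllE => x; rewrite holds_AllE => y; rewrite holds_AllE => z.
  by have := holds_All (holds_All (holds_All (H _ (ax_addA _)) x) y) z; rewrite !holdsE !evalE.
- rewrite holds_AllE => x; rewrite holds_AllE => y.
  by have := holds_All (holds_All (H _ (ax_addC _)) x) y; rewrite !holdsE !evalE.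
- by rewrite holds_AllE => x; have := holds_All (H _ (ax_add0 _)) x; rewrite !holdsE !evalE.
- by rewrite holds_AllE => x; have := holds_All (H _ (ax_addN _)) x; rewrite !holdsE !evalE.
- rewrite holds_AllE => x; rewrite holds_AllE => y; rewrite holds_AllE => z.
  by have := holds_All (holds_All (holds_All (H _ (ax_mulA _)) x) y) z; rewrite !holdsE !evalE.
- rewrite holds_AllE => x; rewrite holds_AllE => y.
  by have := holds_All (holds_All (H _ (ax_mulC _)) x) y; rewrite !holdsE !evalE.
- by rewrite holds_AllE => x; have := holds_All (H _ (ax_mul1 _)) x; rewrite !holdsE !evalE.
- rewrite holds_AllE => x; rewrite holds_AllE => y; rewrite holds_AllE => z.
  by have := holds_All (holds_All (holds_All (H _ (ax_mulDl _)) x) y) z; rewrite !holdsE !evalE.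
- by have := H _ (ax_neq10 _); rewrite !holdsE !evalE.
rewrite holds_AllE => x; have := holds_All (H _ (ax_inv _)) x; rewrite !holdsE !evalE => ex /ex[y].
by rewrite !holdsE !evalE => E; exists y; rewrite !holdsE !evalE.
Qed.

Section CommutingModels.
Variables (ACFA T : theory diff_lang).
Hypotheses (ACFA_companion : is_ACFA ACFA) (T_ACFA : extends ACFA T).

Lemma extends_model M : model T M -> model ACFA M.
Proof. by move=> HM p /T_ACFA; apply. Qed.

Lemma commuting_model (F : fieldType) (st : option unit -> F -> F) :
  model T (diff_structure (st sigma)) -> is_aut (st tau) ->
  (forall x, st tau (st sigma x) = st sigma (st tau x)) ->
  model (with_commuting_aut T) (field_structure st).
Proof.
move=> HT tA ts _ [p /HT Hp|p ax|].
- have Hr : satisfies (reduct (field_structure st)) p by rewrite reduct_field_structure.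
  by apply/holds_lift; exact: holds_env0 Hr.
- by move: p ax; apply/aut_axiomP.
exact/commute_axiomP.
Qed.

Lemma commuting_model_inv M : model (with_commuting_aut T) M ->
  exists (F : fieldType) (st : option unit -> F -> F),
  [/\ M = field_structure st, model T (diff_structure (st sigma)), is_aut (st tau)
    & forall x, st tau (st sigma x) = st sigma (st tau x)].
Proof.
move=> HM; have HT : model T (reduct M).
  by move=> p Tp; apply/holds_lift; exact: HM (wca_base Tp).
have HD := ACFA_difference_field ACFA_companion (extends_model HT).
have [|F [st E]] := structure_is_field (M := M).
  by apply: field_axiom_reduct => p ax; apply: HD; left.
subst M; exists F, st; split=> //.
- by apply/aut_axiomP => p ax; apply: HM; exact: wca_aut.
by apply/commute_axiomP; apply: HM; exact: wca_comm.
Qed.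
End CommutingModels.

(** * The pattern as an existential formula *)

Section Pattern.
Local Open Scope fol_scope.

(** The variables of index 0 to 4 are z, y, x, a, b. The innermost block encodes the equivalence of
    the two equations; the outer negation turns the chain of implications into the conjunction of
    its premises with the failure of that equivalence. *)
Definition pattern_matrix : formula diff_tau_lang 5 :=
  ~~ ((taut sigma 'v_2 == 'v_2) ==> (taut tau 'v_2 == 'v_2) ==>
      (('v_1 * 'v_1 + - 'v_1) * ('v_2 + - 'v_3) == 1) ==>
      (('v_0 * 'v_0 + - 'v_0) * ('v_2 + - 'v_4) == 1) ==>
      ~~ (((taut tau 'v_1 == taut sigma 'v_1) ==> (taut tau 'v_0 == taut sigma 'v_0)) ==>
          ~~ ((taut tau 'v_0 == taut sigma 'v_0) ==> (taut tau 'v_1 == taut sigma 'v_1)))).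

Definition pattern : formula diff_tau_lang 2 := Ex (Ex (Ex pattern_matrix)).
End Pattern.

Lemma pattern_existential : existential pattern.
Proof. by do 3!apply: ex_Ex; apply: ex_qf; rewrite /pattern_matrix /Not; do !constructor. Qed.

Definition env2 (T : Type) (a b : T) : 'I_2 -> T := fun i => if val i == 0%N then a else b.

Lemma patternP (F : fieldType) (st : option unit -> F -> F) (a b : F) :
  @holds _ (field_structure st) _ (env2 a b) pattern <->
  exists x y z, [/\ st sigma x = x, st tau x = x, (y * y - y) * (x - a) = 1,
    (z * z - z) * (x - b) = 1 & ~ (st tau y = st sigma y <-> st tau z = st sigma z)].
Proof.
have E x y z : @holds _ (field_structure st) _
    (env_cons z (env_cons y (env_cons x (env2 a b)))) pattern_matrix <->
    [/\ st sigma x = x, st tau x = x, (y * y - y) * (x - a) = 1,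
    (z * z - z) * (x - b) = 1 & ~ (st tau y = st sigma y <-> st tau z = st sigma z)].
  rewrite /pattern_matrix !holdsE !evalE !opE /=; split.
    by move=> H; split; apply: contrapT => H'; apply: H; tauto.
  by case=> *; tauto.
rewrite /pattern holds_Ex; split=> [[x]|[x [y [z H]]]].
  by rewrite !holds_Ex => -[y]; rewrite holds_Ex => -[z /E]; exists x, y, z.
by exists x; rewrite holds_Ex; exists y; rewrite holds_Ex; exists z; apply/E.
Qed.

Lemma comp_env2 (T T' : Type) (h : T -> T') a b : h \o env2 a b = env2 (h a) (h b).
Proof. by apply: funext => i; rewrite /env2 /=; case: ifP. Qed.

Lemma pattern_orbit (F : fieldType) (st : option unit -> F -> F) (s : {rmorphism F -> F}) a n :
  (s : F -> F) = st sigma -> is_aut (st tau) ->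
  (forall x, st tau (st sigma x) = st sigma (st tau x)) ->
  ~ @holds _ (field_structure st) _ (env2 a (iterm s n a)) pattern.
Proof.
move=> sE /is_aut_morph[t tE _] ts /patternP[x [y [z [sx tx yP zP]]]]; apply.
rewrite -sE in ts sx *; rewrite -!tE; have {}ts u : t (s u) = s (t u) by rewrite !tE ts.
have sxn : iterm s n x = x by elim: n {zP} => //= n ->.
have tn u : t (iterm s n u) = iterm s n (t u) by apply: (iterm_comm (j := t)) => v; rewrite ts.
have sn u : s (iterm s n u) = iterm s n (s u) by apply: (iterm_comm (j := s)).
have ynP : (iterm s n y * iterm s n y - iterm s n y) * (x - iterm s n a) = 1.
  by have := congr1 (iterm s n) yP; rewrite rmorphM !rmorphB rmorphM rmorph1 sxn.
have E : t (iterm s n y) = s (iterm s n y) <-> t y = s y.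
  by rewrite tn sn; split=> [/fmorph_inj|->].
rewrite -E; have [->//|->] := artin_schreier_conjugate ynP zP.
by rewrite !rmorphB !rmorph1; split=> [->//|/addrI/oppr_inj].
Qed.

(** * Refuting a model companion inside an ultrapower *)

Section Companion.
Variables (ACFA T : theory diff_lang).
Hypotheses (ACFA_companion : is_ACFA ACFA) (T_completion : completion ACFA T).

Lemma T_extends : extends ACFA T. Proof. by case: T_completion. Qed.

Lemma model_is_aut (F : fieldType) (s : F -> F) : model T (diff_structure s) -> is_aut s.
Proof.
by move/(extends_model T_extends)/(ACFA_difference_field ACFA_companion)/diff_structureP.
Qed.

(* Then [s ^ n a = z ^ n * a], so that the [s]-orbit of [a] is infinite. *)
Lemma initial_model : exists (F : fieldType) (s : {rmorphism F -> F}) (z a : F),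
  [/\ forall y, exists x, s x = y, model T (diff_structure s), s z = z /\ s a = z * a,
      forall n, (0 < n)%N -> z ^+ n != 1 & a != 0].
Proof.
have [_ [M HM] _] := T_completion.
have MA := extends_model T_extends HM.
have [F [s [sA E]]] := diff_structure_of (ACFA_difference_field ACFA_companion MA).
subst M; have [s1 s1E _] := is_aut_morph sA; have {}s1E : (s1 : F -> F) = s by exact: funext.
subst s; have sS : forall y, exists x, s1 x = y by case: sA.
(* With multiplier 1 the new element [z] is fixed by the automorphism; being transcendental, it is
   no root of unity. It is then the multiplier for [a]. *)
have [K1 [t1 [j1 [z [t1S j1s t1z zt]]]]] := twisted_rational_extension sS (oner_neq0 F).
rewrite rmorph1 mul1r in t1z.
have z0 : z != 0 by have := zt 'X; rewrite map_polyX hornerX polyX_eq0; apply.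
have [K2 [t2 [j2 [a [t2S j2s t2a at_]]]]] := twisted_rational_extension t1S z0.
have [L [t3 [j3 [t3S HL j3s]]]] := ACFA_extension_morph ACFA_companion t2S.
exists L, t3, (j3 (j2 z)), (j3 a); split=> //.
- have js x : (j3 \o (j2 \o j1)) (s1 x) = t3 ((j3 \o (j2 \o j1)) x) by rewrite /= j1s j2s j3s.
  (* By model completeness the larger field is an elementary extension of the given model, hence a
     model of [T]. *)
  have el := ACFA_elementary ACFA_companion MA HL js.
  move=> p /HM Hp; apply/(@holds_env0_comp _ (diff_structure s1) (diff_structure t3) (j3 \o (j2 \o j1))).
  exact/el.
- by rewrite -j3s -j2s t1z -j3s t2a rmorphM.
- move=> n n0; rewrite -rmorphXn -rmorphXn -(rmorph1 (j3 \o j2)) /= !fmorph_eq -subr_eq0.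
  have := zt ('X^n - 1); rewrite rmorphB rmorph1 /= map_polyXn !hornerE; apply.
  by rewrite -size_poly_gt0 size_XnsubC.
have := at_ 'X; rewrite map_polyX hornerX polyX_eq0 => /(_ isT).
by rewrite fmorph_eq0.
Qed.

(** The axioms of [S] are unknown; its models are handled through their closure under ultrapowers,
    the elementarity of embeddings between them, and the embeddings to and from commuting models. *)
Theorem no_model_companion S : ~ model_companion (with_commuting_aut T) S.
Proof.
case=> mcS toS ofS.
have [F0 [s [z [a [sS HT [sz sa] z_order a0]]]]] := initial_model.
have [M HM [h hP]] := toS _ (@commuting_model T F0 (fun=> s) HT (rmorph_is_aut sS) (fun=> erefl)).
(* The pattern is existential, so it would persist in a commuting model above [M], where
   [pattern_orbit] excludes it. *)
have no_pattern k : ~ holds (env2 (h a) (h (iterm s k a))) pattern.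
  have [N HN [g gP]] := ofS M HM.
  have [F [st [NE HF tA ts]]] := commuting_model_inv ACFA_companion T_extends HN.
  subst N; move/(existential_embedding gP pattern_existential); rewrite comp_env2.
  have [q qE qs] := embedding_rmorphism (embedding_comp hP gP).
  have sA := model_is_aut HF.
  have [s' s'E _] := is_aut_morph sA; have {}s'E : (s' : F -> F) = st sigma by exact: funext.
  have -> : g (h (iterm s k a)) = iterm s' k (g (h a)).
    rewrite -[g (h _)]qE -[g (h a)]qE; apply: iterm_comm => u.
    by rewrite s'E; exact: (qs sigma u).
  exact: (pattern_orbit s'E tA ts).
have [U UU Uge] := ultrafilter_nat.
have [P [pi piP]] := @ultraproduct_exists _ nat U (fun=> M) (fun=> h 0) UU.
pose b k := iterm s k a.
have P_no_pattern : ~ holds (env2 (pi (fun=> h a)) (pi (fun k => h (b k)))) pattern.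
  have -> : env2 (pi (fun=> h a)) (pi (fun k => h (b k))) =
      fun i => pi (env2 (fun=> h a) (fun k => h (b k)) i).
    by apply: funext => i; rewrite /env2; case: ifP.
  move/(ultra_los piP)/filter_ex => [k] /=.
  rewrite (_ : (fun i => _) = env2 (h a) (h (b k))); first exact: no_pattern.
  by apply: funext => i; rewrite /env2; case: ifP.
have HP : model S P.
  move=> p Sp; have Hp := HM p Sp.
  apply: (@holds_env0 _ _ _ (fun i => pi (fun=> @env0 M i))).
  by apply/(ultra_los piP); apply: filterS filterT => k _; exact: holds_env0 Hp.
have [N HN [g gP]] := ofS P HP.
have [F [st [NE HF tA ts]]] := commuting_model_inv ACFA_companion T_extends HN.
subst N.
(* [Q] embeds sequences over [F0], modulo [U], into [F]: through [h] into the ultrapower of [M],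
   then through [g]. On its image sigma and tau both act as [s] on each entry. *)
pose Q (f : nat -> F0) : F := g (pi (fun k => h (f k))).
have Q_interp (f : ring_symbol (option unit)) (x : 'I_(ring_arity f) -> nat -> F0) :
    Q (fun k => ring_interp (fun=> s) (fun i => x i k)) = ring_interp st (fun i => Q (x i)).
  rewrite /Q -[RHS](gP.2 f (fun i => pi (fun k => h (x i k)))); congr g.
  rewrite (ultra_interp piP); congr pi; apply: funext => k.
  exact: (hP.2 f).
have QB u v : Q (fun k => u k - v k) = Q u - Q v.
  rewrite (Q_interp Add (fun i => if val i == 0%N then u else fun k => - v k)) /=.
  by rewrite (Q_interp Opp (fun=> v)).
have QM u v : Q (fun k => u k * v k) = Q u * Q v.
  by rewrite (Q_interp Mul (fun i => if val i == 0%N then u else v)).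
have Q1 : Q (fun=> 1) = 1 by rewrite (Q_interp One (fun=> fun=> 0)).
have Qs o u : Q (fun k => s (u k)) = st o (Q u) by rewrite (Q_interp (Aut o) (fun=> u)).
have Q_eq u v : Q u = Q v -> U [set k | u k = v k].
  by move/gP.1/(ultra_eq piP); apply: filterS => k /= /hP.1.
have [|x y|x y|q qE] := @rmorphism_of F0 F (fun x => Q (fun=> x)) => //.
have acF : alg_closed F := ACFA_alg_closed ACFA_companion (extends_model T_extends HF).
have sA := model_is_aut HF.
have [s' s'E _] := is_aut_morph sA; have {}s'E : (s' : F -> F) = st sigma by exact: funext.
have [t' t'E _] := is_aut_morph tA; have {}t'E : (t' : F -> F) = st tau by exact: funext.
have s's u : Q (fun k => s (u k)) = s' (Q u) by rewrite s'E; exact: Qs.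
have t's u : Q (fun k => s (u k)) = t' (Q u) by rewrite t'E; exact: Qs.
have Qb n : iterm s' n (Q b) = Q (fun k => b (n + k)%N).
  elim: n => //= n ->; rewrite -s's; congr Q; exact: funext.
have Qa n : iterm s' n (Q (fun=> a)) = Q (fun=> b n).
  by elim: n => //= n ->; rewrite -s's.
have Q4 u : Q u - 4%:R = Q (fun k => u k - 4%:R).
  by rewrite QB; congr (_ - _); rewrite -(rmorph_nat q 4) qE.
have z0 : z != 0.
  apply: contraNneq a0 => z0; apply/eqP/(fmorph_inj s).
  by rewrite sa z0 mul0r rmorph0.
have zI : injective (fun n => z ^+ n).
  have main n m : (n < m)%N -> z ^+ n != z ^+ m.
    move=> nm; rewrite -(subnKC (ltnW nm)) exprD -{1}[z ^+ n]mulr1.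
    by rewrite (inj_eq (mulfI (expf_neq0 n z0))) eq_sym z_order // subn_gt0.
  move=> n m /= /eqP; apply: contraTeq; rewrite neq_ltn => /orP[/main//|/main].
  by rewrite eq_sym.
have bE n : b n = z ^+ n * a.
  elim: n => [|n IHn]; first by rewrite expr0 mul1r.
  by rewrite /b /= -/(b n) IHn rmorphM rmorphXn sz sa mulrA exprSr.
have bI n m : b n = b m -> n = m by rewrite !bE => /(mulIf a0)/zI.
have sb n : s (b n) = z * b n by rewrite -[LHS]/(b n.+1) !bE exprS mulrA.
(* Applying [s] multiplies b_n by z, hence also b_m - 4, which leaves 4(z - 1) = 0. As z is not 1,
   this gives 4 = 0, and injectivity of [b] concludes. *)
have b4 n m : b n = b m - 4%:R -> n = m.
  move=> E; apply: bI; rewrite E; apply/eqP; rewrite -subr_eq0 addrAC subrr add0r oppr_eq0.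
  have : z * (b m - 4%:R) = z * b m - 4%:R by rewrite -E -!sb E rmorphB rmorph_nat.
  rewrite mulrBr => /addrI/oppr_inj/eqP; rewrite -subr_eq0 -{2}[4%:R]mul1r -mulrBl mulf_eq0.
  by rewrite subr_eq0 -[z == 1]/(z ^+ 1 == 1) (negbTE (z_order 1%N isT)).
(* Sets of indices bounded below belong to [U], so sequences that differ from some rank on have
   different images. *)
have no_eq n0 (u v : nat -> F0) : (forall k, (n0 <= k)%N -> u k <> v k) -> Q u <> Q v.
  move=> uv /Q_eq uvU; have /filter_ex[k [/= E /uv]] : U ([set k | u k = v k] `&` [set k | (n0 <= k)%N]).
    exact: filterI.
  exact.
(* The fixed elements c_k are the powers of z. *)
have cI : injective (fun k => q z ^+ k).
  by move=> n m /=; rewrite -!rmorphXn => /fmorph_inj/zI.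
have qz o : st o (q z) = q z by rewrite !qE -Qs sz.
have ca o k : (forall g : {rmorphism F -> F}, (g : F -> F) = st o -> g (q z ^+ k) = q z ^+ k).
  by move=> f fE; rewrite rmorphXn fE qz.
have [||||||||||||K [u [v [j [x [y [w [acK [uS vS] vu [ju jv] pat]]]]]]]] :=
  @pattern_extension F s' t' (fun k => q z ^+ k) (Q (fun=> a)) (Q b) acF.
- by rewrite s'E; case: sA.
- by rewrite t'E; case: tA.
- by move=> e; rewrite s'E t'E ts.
- exact: cI.
- by move=> k; exact: (ca sigma).
- by move=> k; exact: (ca tau).
- by rewrite -s's -t's.
- by rewrite -s's -t's.
(* Entry k compares b_(n + k) with b_m, and these differ as soon as k > m. *)
- move=> n m; rewrite Qb Qa; apply: (no_eq m.+1) => k mk /bI E.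
  by move: mk; rewrite -E ltnNge leq_addl.
- move=> n m; rewrite Qb Qa Q4; apply: (no_eq m.+1) => k mk /b4 E.
  by move: mk; rewrite -E ltnNge leq_addl.
- move=> n m; rewrite !Qb => E; apply: contrapT => nm; apply: (no_eq 0%N) E => k _ /bI/addIn.
  exact: nm.
- move=> n m; rewrite !Qb Q4 => E; apply: contrapT => nm; apply: (no_eq 0%N) E => k _ /b4/addIn.
  exact: nm.
have [C [u' [v' [i [u'A v'A HC u'v' [iu iv]]]]]] := commuting_extension ACFA_companion acK uS vS vu.
pose stC (o : option unit) : C -> C := if o is Some _ then u' else v'.
(* Model completeness makes the map from [F] to [C] elementary for sigma alone, so [T] passes to
   [C]. *)
have HTC : model T (diff_structure u').
  have HAF := extends_model T_extends HF.
  have ijs e : (i \o j) (st sigma e) = u' ((i \o j) e) by rewrite /= -s'E ju iu.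
  have el := ACFA_elementary ACFA_companion HAF HC ijs.
  move=> p /HF Hp; apply/(@holds_env0_comp _ (diff_structure (st sigma)) (diff_structure u') (i \o j)).
  exact/el.
(* [M'] is a model of [S] above [C], so the map from [P] to [M'] is elementary: the pattern goes up
   from [K] to [M'] and comes down to [P]. *)
have [M' HM' [k kP]] := toS _ (@commuting_model T C stC HTC v'A (fun e => esym (u'v' e))).
have eF : @embedding _ (field_structure st) (field_structure stC) (i \o j).
  apply: structure_embedding => -[[]|] e /=; first by rewrite -[st _]s'E ju iu.
  by rewrite -[st _]t'E jv iv.
have el := mcS P M' HP HM' _ (embedding_comp (embedding_comp gP eF) kP).
pose stK (o : option unit) : K -> K := if o is Some _ then u else v.
have iK : @embedding _ (field_structure stK) (field_structure stC) i.
  by apply: structure_embedding => -[[]|] e /=; [exact: iu | exact: iv].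
have patK : @holds _ (field_structure stK) _ (env2 (j (Q (fun=> a))) (j (Q b))) pattern.
  by apply/patternP; exists x, y, w.
apply: P_no_pattern; apply/el.
have := existential_embedding kP pattern_existential (existential_embedding iK pattern_existential patK).
by rewrite !comp_env2.
Qed.
End Companion.

Theorem theorem1p2 (ACFA T : theory diff_lang) (hACFA : is_ACFA ACFA)
    (hT : completion ACFA T) :
  ~ exists S : theory diff_tau_lang, model_companion (with_commuting_aut T) S.
Proof. by case=> S; exact: (no_model_companion hACFA hT). Qed.
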